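(* Let $\mathcal{C}$ be a semi-abelian category satisfying condition (UA), let $B$ be an object of $\mathcal{C}$, and assume that $\mathbf{PXMod}_B(\mathcal{C})$ has enough (regular) projectives. Let $(\partial\colon X\to B,\xi_X)$ be a precrossed $B$-module and let $p\colon(\partial_P\colon P\to B,\xi_P)\to(\partial\colon X\to B,\xi_X)$ be a regular epimorphism in $\mathbf{PXMod}_B(\mathcal{C})$ with projective domain. Then the fundamental group of $(\partial\colon X\to B,\xi_X)$ is given by the Hopf formula $$\pi_1(\partial\colon X\to B,\xi_X)\cong\frac{K[p]\wedge\langle P,P\rangle}{\langle P,K[p]\rangle}.$$
   Context: Internal actions. Let $\mathcal{C}$ be a semi-abelian category. For objects $B,X$, $B\flat X$ denotes the kernel of $[1,0]\colon B+X\to B$; $B\flat(-)$ is the functor part of a monad on $\mathcal{C}$, and an internal $B$-action on $X$ is an algebra $\xi\colon B\flat X\to X$ of this monad. For $u\colon A\to B$, $v\colon X\to Y$, $u\flat v\colon A\flat X\to B\flat Y$ is the restriction of $u+v$. Internal $B$-actions are equivalent to points over $B$ (split epimorphisms onto $B$ with a chosen section): $\xi$ corresponds to $p_B\colon X\rtimes_\xi B\to B$ with section $i_B$ and kernel $j_X\colon X\to X\rtimes_\xi B$, where $j_X\xi=[i_B,j_X]\ker[1,0]$. The pullback action of $\xi$ along $u\colon A\to B$ is $u^*(\xi)=\xi\cdot(u\flat 1_X)$. The conjugation action $\chi\colon B\flat B\to B$ is the restriction of $[1,1]\colon B+B\to B$ to $B\flat B$ (similarly for $X$). Condition (UA): for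 every cospan $f\colon A\to B$, $g\colon C\to B$ in $\mathcal{C}$ that is jointly extremal epimorphic, and for all internal actions $\xi_1\colon A\flat X\to X$, $\xi_2\colon C\flat X\to X$, $\xi_3,\xi_4\colon B\flat X\to X$ on a same object $X$ with $\xi_3(f\flat 1)=\xi_1=\xi_4(f\flat 1)$ and $\xi_3(g\flat 1)=\xi_2=\xi_4(g\flat 1)$, one has $\xi_3=\xi_4$. It is known that (UA) implies the ''Smith is Huq'' condition (SH) (two equivalence relations on an object centralize each other in the Smith–Pedicchio sense if and only if the corresponding normal subobjects commute in the sense of Huq). Precrossed and crossed modules. A precrossed $B$-module in $\mathcal{C}$ is a pair $(\partial\colon X\to B,\xi)$ with $\xi\colon B\flat X\to X$ an internal action and $\partial\xi=\chi(1\flat\partial)$. A morphism $(\partial,\xi)\to(\partial',\xi')$ is a morphism $f\colon X\to Y$ with $\partial'f=\partial$ and $f\xi=\xi'(1\flat f)$. These form the category $\mathbf{PXMod}_B(\mathcal{C})$, equivalent to the category $\mathbf{RG}_B(\mathcal{C})$ of internal reflexive graphs $(d,c\colon X_1\to B, e\colon B\to X_1)$, $de=1=ce$, over the fixed object $B$: a reflexive graph is sent to $X=K[d]$, $\partial=c\cdot\ker(d)$, with the action corresponding to the point $(d,e)$; so $X_1=X\rtimes_\xi B$. Under (SH), $(\partial,\xi)$ is a crossed module if and only if $\xi(\partial\flat 1)=\chi\colon X\flat X\to X$; equivalently, if and only if the corresponding reflexive graph is an internal groupoid. Crossed modules over $B$ form a full reflective (Birkhoff) subcategory $\mathbf{XMod}_B(\mathcal{C})$,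 with reflector $G\colon\mathbf{PXMod}_B(\mathcal{C})\to\mathbf{XMod}_B(\mathcal{C})$ and unit $\eta$. The category $\mathbf{PXMod}_B(\mathcal{C})$ is quasi-pointed with initial object $0\to B$; regular epimorphisms are those morphisms whose underlying morphism in $\mathcal{C}$ is a regular epimorphism; the kernel $K[f]$ of $f\colon X\to Y$ (the pullback of the initial object along $f$) has as underlying object the kernel of $f$ in $\mathcal{C}$, with structure morphism $0\colon K[f]\to B$. Peiffer commutator. Let $(\partial\colon X\to B,\xi)$, $(\partial'\colon Y\to B,\xi')$ be precrossed $B$-modules with corresponding reflexive graphs $X_1,Y_1$. Put $X\rtimes Y=X\rtimes_{\partial'^*\xi}Y$, with $j_X\colon X\to X\rtimes Y$, $i_Y\colon Y\to X\rtimes Y$, and the precrossed $B$-module structure that is the normalization of the reflexive graph $X_1\times_BY_1$ (pullback of $d_X$ and $c_Y$, with domain $d_Yp_2$, codomain $c_Xp_1$ and unit $(e_X,e_Y)$); symmetrically $Y\rtimes X=Y\rtimes_{\partial^*\xi'}X$ with $j_Y$, $i_X$. Then $j_X,i_Y,i_X,j_Y$ are morphisms of precrossed modules. Let $X+_{\mathsf{PX}}Y$ be the coproduct in $\mathbf{PXMod}_B(\mathcal{C})$. The Peiffer product $X\bowtie Y$ is the pushout in $\mathbf{PXMod}_B(\mathcal{C})$ of $[j_X,i_Y]\colon X+_{\mathsf{PX}}Y\to X\rtimes Y$ and $[i_X,j_Y]\colon X+_{\mathsf{PX}}Y\to Y\rtimes X$, and $\Sigma\colon X+_{\mathsf{PX}}Y\to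 X\bowtie Y$ is the diagonal of this pushout. If $m\colon X\to A$, $n\colon Y\to A$ are precrossed $B$-submodules (monomorphisms in $\mathbf{PXMod}_B(\mathcal{C})$) of $A$, the Peiffer commutator $\langle X,Y\rangle$ is the subobject of $A$ given by the regular image of the kernel of $\Sigma$ along $[m,n]\colon X+_{\mathsf{PX}}Y\to A$. A quotient $M/N$ denotes the codomain of the cokernel in $\mathbf{PXMod}_B(\mathcal{C})$ of the inclusion $N\to M$. Galois theory. An extension (regular epimorphism) $f\colon X\to Y$ in $\mathbf{PXMod}_B(\mathcal{C})$ is trivial if the naturality square $\eta_Y f=G(f)\eta_X$ is a pullback; it is central if there is a regular epimorphism $p\colon Z\to Y$ such that the pullback of $f$ along $p$ is trivial, and normal if one can take $p=f$ (here every central extension is normal). For a normal extension $f\colon X\to Y$ with kernel pair $(Eq[f],p_1,p_2)$, its Galois groupoid is the reflection under $G$ of this kernel pair, and its Galois group $\mathrm{Gal}(f,0)$ is the intersection of the kernels of $G(p_1)$ and $G(p_2)$. A central extension $u$ of $X$ is weakly universal if for every central extension $c$ with codomain $X$ there is a morphism $t$ with $ct=u$; such a $u$ is, for instance, the extension $\overline p\colon P/\langle P,K[p]\rangle\to X$ induced by a regular epimorphism $p\colon P\to X$ with $P$ projective (with respect to regular epimorphisms). The fundamental group $\pi_1(\partial\colon X\to B,\xi_X)$ is the Galois group $\mathrm{Gal}(u,0)$ of a weakly universal central extension $u$ of $(\partial\colon X\to B,\xi_X)$; up to isomorphism it does not depend on the choice of $u$. *)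

(* Defs.v *)
From Stdlib Require Import IndefiniteDescription ProofIrrelevance.

Set Implicit Arguments.
Unset Strict Implicit.

(** * Categories *)

Record Category := {
  Ob :> Type;
  Hom : Ob -> Ob -> Type;
  idm : forall X, Hom X X;
  comp : forall X Y Z, Hom Y Z -> Hom X Y -> Hom X Z;
  comp_idl : forall X Y (f : Hom X Y), comp (idm Y) f = f;
  comp_idr : forall X Y (f : Hom X Y), comp f (idm X) = f;
  comp_assoc : forall X Y Z W (h : Hom Z W) (g : Hom Y Z) (f : Hom X Y),
    comp h (comp g f) = comp (comp h g) f }.

Arguments Hom {c} X Y.
Arguments idm {c} X.
Arguments comp {c X Y Z} g f.

Notation "X ~> Y" := (Hom X Y) (at level 60, no associativity).
Notation "g ∘ f" := (comp g f) (at level 40, left associativity).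

Section CategoryNotions.
Context {C : Category}.

Definition is_iso {X Y : C} (f : X ~> Y) :=
  exists g : Y ~> X, g ∘ f = idm X /\ f ∘ g = idm Y.

Definition isomorphic (X Y : C) := exists f : X ~> Y, is_iso f.

Definition is_mono {X Y : C} (f : X ~> Y) :=
  forall (W : C) (a b : W ~> X), f ∘ a = f ∘ b -> a = b.

Definition is_initial (I : C) := forall X, exists! f : I ~> X, True.
Definition is_terminal (T : C) := forall X, exists! f : X ~> T, True.

Definition is_pullback {X Y Z P : C}
    (f : X ~> Z) (g : Y ~> Z) (p : P ~> X) (q : P ~> Y) :=
  f ∘ p = g ∘ q /\
  forall (W : C) (a : W ~> X) (b : W ~> Y), f ∘ a = g ∘ b ->
    exists! h : W ~> P, p ∘ h = a /\ q ∘ h = b.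

Definition is_pushout {Z X Y Q : C}
    (f : Z ~> X) (g : Z ~> Y) (i : X ~> Q) (j : Y ~> Q) :=
  i ∘ f = j ∘ g /\
  forall (W : C) (a : X ~> W) (b : Y ~> W), a ∘ f = b ∘ g ->
    exists! h : Q ~> W, h ∘ i = a /\ h ∘ j = b.

Definition is_coproduct {X Y S : C} (i : X ~> S) (j : Y ~> S) :=
  forall (W : C) (a : X ~> W) (b : Y ~> W),
    exists! h : S ~> W, h ∘ i = a /\ h ∘ j = b.

Definition is_coequalizer {R X Q : C} (f g : R ~> X) (q : X ~> Q) :=
  q ∘ f = q ∘ g /\
  forall (W : C) (a : X ~> W), a ∘ f = a ∘ g -> exists! h : Q ~> W, h ∘ q = a.

Definition is_regular_epi {X Q : C} (q : X ~> Q) :=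
  exists (R : C) (f g : R ~> X), is_coequalizer f g q.

Definition is_kernel_pair {X Y E : C} (f : X ~> Y) (p1 p2 : E ~> X) :=
  is_pullback f f p1 p2.

(** Kernels and cokernels are relative to the initial object, as usual in a
    quasi-pointed category; the initial object need not be terminal.  A morphism
    [n : N ~> M] has a cokernel only if [N] maps to the initial object. *)
Definition is_kernel {K X Y : C} (f : X ~> Y) (k : K ~> X) :=
  exists (O : C) (o : O ~> Y) (t : K ~> O),
    is_initial O /\ is_pullback f o k t.

Definition is_cokernel {N M Q : C} (n : N ~> M) (q : M ~> Q) :=
  exists (O : C) (t : N ~> O) (o : O ~> Q),
    is_initial O /\ is_pushout n t q o.

Definition is_regular_image {X Y I : C} (f : X ~> Y) (m : I ~> Y) :=
  is_mono m /\ exists e : X ~> I, is_regular_epi e /\ m ∘ e = f.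

Definition is_intersection {M N L A : C}
    (m : M ~> A) (n : N ~> A) (l : L ~> A) :=
  exists (a : L ~> M) (b : L ~> N), is_pullback m n a b /\ m ∘ a = l.

Definition jointly_extremal_epi {A D B : C} (f : A ~> B) (g : D ~> B) :=
  forall (M : C) (m : M ~> B) (f' : A ~> M) (g' : D ~> M),
    is_mono m -> m ∘ f' = f -> m ∘ g' = g -> is_iso m.

Definition is_projective (P : C) :=
  forall (X Y : C) (e : X ~> Y) (f : P ~> Y), is_regular_epi e ->
    exists g : P ~> X, e ∘ g = f.

Definition in_rel {R X W : C} (r1 r2 : R ~> X) (a b : W ~> X) :=
  exists h : W ~> R, r1 ∘ h = a /\ r2 ∘ h = b.

Definition is_equivalence_relation {R X : C} (r1 r2 : R ~> X) :=
  (forall (W : C) (a b : W ~> R),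
      r1 ∘ a = r1 ∘ b -> r2 ∘ a = r2 ∘ b -> a = b) /\
  (forall (W : C) (a : W ~> X), in_rel r1 r2 a a) /\
  (forall (W : C) (a b : W ~> X), in_rel r1 r2 a b -> in_rel r1 r2 b a) /\
  (forall (W : C) (a b c : W ~> X),
      in_rel r1 r2 a b -> in_rel r1 r2 b c -> in_rel r1 r2 a c).

End CategoryNotions.

Definition enough_projectives (C : Category) :=
  forall X : C, exists (P : C) (p : P ~> X), is_projective P /\ is_regular_epi p.

(** * Semi-abelian categories *)

(** Pointed, finitely complete, with binary coproducts, Barr exact and Bourn
    protomodular: the change-of-base functors of the fibration of points
    reflect isomorphisms. *)
Record SemiAbelian := {
  cat :> Category;

  zero : cat;
  zero_initial : is_initial zero;
  zero_terminal : is_terminal zero;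

  pb : forall X Y Z : cat, X ~> Z -> Y ~> Z -> cat;
  pb1 : forall (X Y Z : cat) (f : X ~> Z) (g : Y ~> Z), pb f g ~> X;
  pb2 : forall (X Y Z : cat) (f : X ~> Z) (g : Y ~> Z), pb f g ~> Y;
  pb_pullback : forall (X Y Z : cat) (f : X ~> Z) (g : Y ~> Z),
    is_pullback f g (pb1 f g) (pb2 f g);

  sum : cat -> cat -> cat;
  in1 : forall X Y : cat, X ~> sum X Y;
  in2 : forall X Y : cat, Y ~> sum X Y;
  sum_coproduct : forall X Y : cat, is_coproduct (in1 X Y) (in2 X Y);

  kernel_pair_coequalizer :
    forall (E X Y : cat) (f : X ~> Y) (p1 p2 : E ~> X), is_kernel_pair f p1 p2 ->
      exists (Q : cat) (q : X ~> Q), is_coequalizer p1 p2 q;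
  regular_epi_pullback :
    forall (X Y Z P : cat) (f : X ~> Z) (g : Y ~> Z) (p : P ~> X) (q : P ~> Y),
      is_pullback f g p q -> is_regular_epi f -> is_regular_epi q;
  equivalence_relation_effective :
    forall (R X : cat) (r1 r2 : R ~> X), is_equivalence_relation r1 r2 ->
      exists (Y : cat) (f : X ~> Y), is_kernel_pair f r1 r2;

  protomodular :
    forall (Y Y' : cat) (v : Y' ~> Y)
      (A : cat) (p : A ~> Y) (s : Y ~> A)
      (A' : cat) (p' : A' ~> Y) (s' : Y ~> A') (h : A ~> A')
      (W : cat) (a : W ~> A) (q : W ~> Y')
      (W' : cat) (a' : W' ~> A') (q' : W' ~> Y') (w : W ~> W'),
      p ∘ s = idm Y -> p' ∘ s' = idm Y -> p' ∘ h = p -> h ∘ s = s' ->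
      is_pullback p v a q -> is_pullback p' v a' q' ->
      a' ∘ w = h ∘ a -> q' ∘ w = q -> is_iso w -> is_iso h }.

Arguments zero {_}.
Arguments in1 {_} X Y.
Arguments in2 {_} X Y.

Definition the {A : Type} {P : A -> Prop} (h : exists! x, P x) : A :=
  proj1_sig (constructive_definite_description P h).

Lemma the_spec (A : Type) (P : A -> Prop) (h : exists! x, P x) : P (the h).
Proof. exact (proj2_sig (constructive_definite_description P h)). Qed.

(** * Internal actions *)

Section Actions.
Context {C : SemiAbelian}.

Definition from_zero (X : C) : zero ~> X := the (zero_initial X).
Definition to_zero (X : C) : X ~> zero := the (zero_terminal X).
Definition zero_mor (X Y : C) : X ~> Y := from_zero Y ∘ to_zero X.

Definition copair {X Y W : C} (a : X ~> W) (b : Y ~> W) : sum X Y ~> W :=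
  the (sum_coproduct a b).

Definition sum_map {X Y X' Y' : C} (u : X ~> X') (v : Y ~> Y') :
    sum X Y ~> sum X' Y' :=
  copair (in1 X' Y' ∘ u) (in2 X' Y' ∘ v).

(** [[1,0] : B + X ~> B], its kernel object [B♭X], and the kernel map. *)
Definition sum_proj (B X : C) : sum B X ~> B := copair (idm B) (zero_mor X B).
Definition flat (B X : C) : C := pb (sum_proj B X) (from_zero B).
Definition flat_ker (B X : C) : flat B X ~> sum B X :=
  pb1 (sum_proj B X) (from_zero B).

Lemma copair_in1 (X Y W : C) (a : X ~> W) (b : Y ~> W) :
  copair a b ∘ in1 X Y = a.
Proof. exact (proj1 (the_spec (sum_coproduct a b))). Qed.

Lemma copair_in2 (X Y W : C) (a : X ~> W) (b : Y ~> W) :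
  copair a b ∘ in2 X Y = b.
Proof. exact (proj2 (the_spec (sum_coproduct a b))). Qed.

Lemma sum_ext (X Y W : C) (f g : sum X Y ~> W) :
  f ∘ in1 X Y = g ∘ in1 X Y -> f ∘ in2 X Y = g ∘ in2 X Y -> f = g.
Proof.
intros H1 H2.
destruct (sum_coproduct (g ∘ in1 X Y) (g ∘ in2 X Y)) as [h [_ Hu]].
transitivity h; [symmetry|]; apply Hu; auto.
Qed.

Lemma to_zero_unique (X : C) (f g : X ~> zero) : f = g.
Proof.
destruct (zero_terminal X) as [h [_ Hu]].
transitivity h; [symmetry|]; apply Hu; exact I.
Qed.

Lemma from_zero_unique (X : C) (f g : zero ~> X) : f = g.
Proof.
destruct (zero_initial X) as [h [_ Hu]].
transitivity h; [symmetry|]; apply Hu; exact I.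
Qed.

Lemma zero_mor_l (X Y Z : C) (f : X ~> Y) : zero_mor Y Z ∘ f = zero_mor X Z.
Proof. unfold zero_mor. rewrite <- comp_assoc. f_equal. apply to_zero_unique. Qed.

Lemma zero_mor_r (X Y Z : C) (f : Y ~> Z) : f ∘ zero_mor X Y = zero_mor X Z.
Proof. unfold zero_mor. rewrite comp_assoc. f_equal. apply from_zero_unique. Qed.

Lemma flat_ker_zero (B X : C) : sum_proj B X ∘ flat_ker B X = zero_mor _ _.
Proof.
etransitivity; [exact (proj1 (pb_pullback (sum_proj B X) (from_zero B)))|].
unfold zero_mor. f_equal. apply to_zero_unique.
Qed.

Lemma flat_lift_ex (B X W : C) (h : W ~> sum B X) :
  sum_proj B X ∘ h = zero_mor W B -> exists! k : W ~> flat B X, flat_ker B X ∘ k = h.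
Proof.
intros H.
destruct (proj2 (pb_pullback (sum_proj B X) (from_zero B)) W h (to_zero W) H)
  as [k [[Hk _] Hu]].
exists k; split; [exact Hk|].
intros k' Hk'. apply Hu; split; [exact Hk' | apply to_zero_unique].
Qed.

Lemma flat_ker_mono (B X W : C) (a b : W ~> flat B X) :
  flat_ker B X ∘ a = flat_ker B X ∘ b -> a = b.
Proof.
intros H.
destruct (@flat_lift_ex B X W (flat_ker B X ∘ b)) as [k [_ Hu]].
- rewrite comp_assoc, flat_ker_zero. apply zero_mor_l.
- transitivity k; [symmetry|]; apply Hu; auto.
Qed.

Lemma flat_map_ok (A B X Y : C) (u : A ~> B) (v : X ~> Y) :
  sum_proj B Y ∘ (sum_map u v ∘ flat_ker A X) = zero_mor _ _.
Proof.
assert (E : sum_proj B Y ∘ sum_map u v = u ∘ sum_proj A X).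
{ unfold sum_proj, sum_map. apply sum_ext; rewrite <- !comp_assoc.
  - rewrite !copair_in1, comp_assoc, copair_in1, comp_idl, comp_idr. reflexivity.
  - rewrite !copair_in2, comp_assoc, copair_in2, zero_mor_l, zero_mor_r.
    reflexivity. }
rewrite comp_assoc, E, <- comp_assoc, flat_ker_zero. apply zero_mor_r.
Qed.

Lemma flat_unit_ok (B X : C) : sum_proj B X ∘ in2 B X = zero_mor _ _.
Proof. apply copair_in2. Qed.

Lemma flat_mult_ok (B X : C) :
  sum_proj B X ∘ (copair (in1 B X) (flat_ker B X) ∘ flat_ker B (flat B X))
  = zero_mor _ _.
Proof.
assert (E : sum_proj B X ∘ copair (in1 B X) (flat_ker B X)
            = sum_proj B (flat B X)).
{ apply sum_ext; rewrite <- !comp_assoc.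
  - rewrite copair_in1. unfold sum_proj. rewrite !copair_in1. reflexivity.
  - rewrite copair_in2, flat_ker_zero. symmetry. apply copair_in2. }
rewrite comp_assoc, E. apply flat_ker_zero.
Qed.

(** The functor [♭] and the unit and multiplication of the monad [B♭(-)]. *)
Definition flat_map {A B X Y : C} (u : A ~> B) (v : X ~> Y) :
    flat A X ~> flat B Y :=
  the (flat_lift_ex (flat_map_ok u v)).
Definition flat_unit (B X : C) : X ~> flat B X :=
  the (flat_lift_ex (flat_unit_ok B X)).
Definition flat_mult (B X : C) : flat B (flat B X) ~> flat B X :=
  the (flat_lift_ex (flat_mult_ok B X)).

Definition is_action {B X : C} (xi : flat B X ~> X) :=
  xi ∘ flat_unit B X = idm X /\
  xi ∘ flat_mult B X = xi ∘ flat_map (idm B) xi.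

Definition pullback_action {A B X : C} (u : A ~> B) (xi : flat B X ~> X) :
    flat A X ~> X :=
  xi ∘ flat_map u (idm X).

Definition conj_action (B : C) : flat B B ~> B :=
  copair (idm B) (idm B) ∘ flat_ker B B.

(** [(p, i)] is the point over [B] with kernel [j] that corresponds to [xi];
    so [S] is the semi-direct product of [X] and [B]. *)
Definition is_semidirect {B X S : C} (xi : flat B X ~> X)
    (p : S ~> B) (i : B ~> S) (j : X ~> S) :=
  p ∘ i = idm B /\ is_kernel p j /\ j ∘ xi = copair i j ∘ flat_ker B X.

Lemma flat_map_spec (A B X Y : C) (u : A ~> B) (v : X ~> Y) :
  flat_ker B Y ∘ flat_map u v = sum_map u v ∘ flat_ker A X.
Proof. exact (the_spec (flat_lift_ex (flat_map_ok u v))). Qed.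

Lemma flat_map_id (B X : C) : flat_map (idm B) (idm X) = idm (flat B X).
Proof.
apply flat_ker_mono. rewrite flat_map_spec, comp_idr.
replace (sum_map (idm B) (idm X)) with (idm (sum B X)); [apply comp_idl|].
unfold sum_map. apply sum_ext.
- rewrite copair_in1, comp_idl, comp_idr. reflexivity.
- rewrite copair_in2, comp_idl, comp_idr. reflexivity.
Qed.

Lemma flat_map_comp (B X Y Z : C) (g : Y ~> Z) (f : X ~> Y) :
  flat_map (idm B) (g ∘ f) = flat_map (idm B) g ∘ flat_map (idm B) f.
Proof.
apply flat_ker_mono.
rewrite comp_assoc, !flat_map_spec, <- comp_assoc, flat_map_spec, comp_assoc.
f_equal. unfold sum_map. apply sum_ext; rewrite <- comp_assoc.
- rewrite !copair_in1, comp_assoc, copair_in1, <- comp_assoc, comp_idl. reflexivity.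
- rewrite !copair_in2, !comp_assoc, copair_in2. reflexivity.
Qed.

End Actions.

Definition UA (C : SemiAbelian) :=
  forall (A B D X : C) (f : A ~> B) (g : D ~> B)
    (xi1 : flat A X ~> X) (xi2 : flat D X ~> X) (xi3 xi4 : flat B X ~> X),
    jointly_extremal_epi f g ->
    is_action xi1 -> is_action xi2 -> is_action xi3 -> is_action xi4 ->
    pullback_action f xi3 = xi1 -> pullback_action f xi4 = xi1 ->
    pullback_action g xi3 = xi2 -> pullback_action g xi4 = xi2 ->
    xi3 = xi4.

(** * Precrossed and crossed modules *)

Section PrecrossedModules.
Context {C : SemiAbelian} (B : C).

Record PrecrossedModule := {
  px_ob : C;
  px_bd : px_ob ~> B;
  px_act : flat B px_ob ~> px_ob;
  px_is_action : is_action px_act;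
  px_precrossed : px_bd ∘ px_act = conj_action B ∘ flat_map (idm B) px_bd }.

Record PXHom (X Y : PrecrossedModule) := {
  px_map : px_ob X ~> px_ob Y;
  px_map_bd : px_bd Y ∘ px_map = px_bd X;
  px_map_act : px_map ∘ px_act X = px_act Y ∘ flat_map (idm B) px_map }.

Lemma PXHom_ext (X Y : PrecrossedModule) (f g : PXHom X Y) :
  px_map f = px_map g -> f = g.
Proof.
destruct f as [f f1 f2], g as [g g1 g2]; simpl; intros ->.
f_equal; apply proof_irrelevance.
Qed.

Lemma px_id_act (X : PrecrossedModule) :
  idm (px_ob X) ∘ px_act X = px_act X ∘ flat_map (idm B) (idm (px_ob X)).
Proof. rewrite flat_map_id, comp_idl, comp_idr. reflexivity. Qed.

Definition px_id (X : PrecrossedModule) : PXHom X X :=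
  Build_PXHom (comp_idr (px_bd X)) (px_id_act X).

Lemma px_comp_bd (X Y Z : PrecrossedModule) (g : PXHom Y Z) (f : PXHom X Y) :
  px_bd Z ∘ (px_map g ∘ px_map f) = px_bd X.
Proof. rewrite comp_assoc, px_map_bd. apply px_map_bd. Qed.

Lemma px_comp_act (X Y Z : PrecrossedModule) (g : PXHom Y Z) (f : PXHom X Y) :
  (px_map g ∘ px_map f) ∘ px_act X
  = px_act Z ∘ flat_map (idm B) (px_map g ∘ px_map f).
Proof.
rewrite flat_map_comp, <- comp_assoc, px_map_act, !comp_assoc, px_map_act.
reflexivity.
Qed.

Definition px_comp (X Y Z : PrecrossedModule) (g : PXHom Y Z) (f : PXHom X Y) :
    PXHom X Z :=
  Build_PXHom (px_comp_bd g f) (px_comp_act g f).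

Definition PXMod : Category.
Proof.
refine {| Ob := PrecrossedModule; Hom := PXHom; idm := px_id; comp := px_comp |};
  intros; apply PXHom_ext; simpl.
- apply comp_idl.
- apply comp_idr.
- apply comp_assoc.
Defined.

(** The Peiffer condition; this is the notion of internal crossed module under
    the "Smith is Huq" condition, hence under [UA]. *)
Definition is_crossed (X : PXMod) :=
  px_act X ∘ flat_map (px_bd X) (idm (px_ob X)) = conj_action (px_ob X).

(** [(d, c, e)] is the reflexive graph over [B] whose normalization, taken along
    the kernel [k] of [d], is the precrossed module [X]. *)
Definition is_graph_of {X1 : C} (X : PXMod)
    (d c : X1 ~> B) (e : B ~> X1) (k : px_ob X ~> X1) :=
  is_semidirect (px_act X) d e k /\ c ∘ e = idm B /\ c ∘ k = px_bd X.

(** * The Peiffer commutator *)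

(** [S] is the semi-direct product [X ⋊ Y] along the pulled back action, with
    kernel [jX] and section [iY], carrying the precrossed structure that
    normalizes the composite reflexive graph [W = X1 ×_B Y1]; the last four
    equations identify the inclusion [kS] of [X ⋊ Y] in [W] as the kernel of the
    domain map. *)
Definition is_semidirect_px {X Y S : PXMod} (jX : X ~> S) (iY : Y ~> S) :=
  exists (X1 : C) (dX cX : X1 ~> B) (eX : B ~> X1) (kX : px_ob X ~> X1)
    (Y1 : C) (dY cY : Y1 ~> B) (eY : B ~> Y1) (kY : px_ob Y ~> Y1)
    (W : C) (q1 : W ~> X1) (q2 : W ~> Y1) (eW : B ~> W) (kS : px_ob S ~> W)
    (pY : px_ob S ~> px_ob Y),
    is_graph_of dX cX eX kX /\ is_graph_of dY cY eY kY /\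
    is_pullback dX cY q1 q2 /\ q1 ∘ eW = eX /\ q2 ∘ eW = eY /\
    is_graph_of (dY ∘ q2) (cX ∘ q1) eW kS /\
    is_semidirect (pullback_action (px_bd Y) (px_act X))
      pY (px_map iY) (px_map jX) /\
    q1 ∘ (kS ∘ px_map jX) = kX /\
    q2 ∘ (kS ∘ px_map jX) = zero_mor (px_ob X) Y1 /\
    q1 ∘ (kS ∘ px_map iY) = eX ∘ px_bd Y /\
    q2 ∘ (kS ∘ px_map iY) = kY.

(** [i1], [i2] are the coproduct injections into [X + Y], [Q] is the Peiffer
    product of [X] and [Y], and [Sigma] is the diagonal of the pushout square
    that defines it. *)
Definition is_peiffer_product {X Y XY Q : PXMod}
    (i1 : X ~> XY) (i2 : Y ~> XY) (Sigma : XY ~> Q) :=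
  exists (S T : PXMod) (jX : X ~> S) (iY : Y ~> S) (iX : X ~> T) (jY : Y ~> T)
    (s : XY ~> S) (t : XY ~> T) (u : S ~> Q) (v : T ~> Q),
    is_coproduct i1 i2 /\ is_semidirect_px jX iY /\ is_semidirect_px jY iX /\
    s ∘ i1 = jX /\ s ∘ i2 = iY /\ t ∘ i1 = iX /\ t ∘ i2 = jY /\
    is_pushout s t u v /\ u ∘ s = Sigma.

Definition is_peiffer_commutator {X Y A L : PXMod}
    (m : X ~> A) (n : Y ~> A) (l : L ~> A) :=
  is_mono m /\ is_mono n /\
  exists (XY Q K : PXMod) (i1 : X ~> XY) (i2 : Y ~> XY) (Sigma : XY ~> Q)
    (k : K ~> XY) (mn : XY ~> A),
    is_peiffer_product i1 i2 Sigma /\ is_kernel Sigma k /\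
    mn ∘ i1 = m /\ mn ∘ i2 = n /\ is_regular_image (mn ∘ k) l.

(** * Galois theory of crossed modules in precrossed modules *)

Definition is_reflection {X GX : PXMod} (eta : X ~> GX) :=
  is_crossed GX /\
  forall (Y : PXMod) (f : X ~> Y), is_crossed Y ->
    exists! g : GX ~> Y, g ∘ eta = f.

Definition is_trivial_extension {X Y : PXMod} (f : X ~> Y) :=
  is_regular_epi f /\
  exists (GX GY : PXMod) (etaX : X ~> GX) (etaY : Y ~> GY) (Gf : GX ~> GY),
    is_reflection etaX /\ is_reflection etaY /\ is_pullback etaY Gf f etaX.

Definition is_central_extension {X Y : PXMod} (f : X ~> Y) :=
  is_regular_epi f /\
  exists (Z W : PXMod) (p : Z ~> Y) (p' : W ~> X) (f' : W ~> Z),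
    is_regular_epi p /\ is_pullback f p p' f' /\ is_trivial_extension f'.

Definition is_weakly_universal_central {X U : PXMod} (u : U ~> X) :=
  is_central_extension u /\
  forall (Z : PXMod) (c : Z ~> X), is_central_extension c ->
    exists t : U ~> Z, c ∘ t = u.

(** [Gal] is [Gal(f, 0)]. *)
Definition is_galois_group {X Y : PXMod} (f : X ~> Y) (Gal : PXMod) :=
  exists (E GE GX : PXMod) (p1 p2 : E ~> X) (etaE : E ~> GE) (etaX : X ~> GX)
    (Gp1 Gp2 : GE ~> GX) (K1 K2 : PXMod) (k1 : K1 ~> GE) (k2 : K2 ~> GE)
    (l : Gal ~> GE),
    is_kernel_pair f p1 p2 /\ is_reflection etaE /\ is_reflection etaX /\
    Gp1 ∘ etaE = etaX ∘ p1 /\ Gp2 ∘ etaE = etaX ∘ p2 /\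
    is_kernel Gp1 k1 /\ is_kernel Gp2 k2 /\ is_intersection k1 k2 l.

Definition is_fundamental_group (X pi1 : PXMod) :=
  exists (U : PXMod) (u : U ~> X),
    is_weakly_universal_central u /\ is_galois_group u pi1.

(** [Q = (K[p] ∧ ⟨P,P⟩) / ⟨P,K[p]⟩]. *)
Definition is_hopf_quotient {P X : PXMod} (p : P ~> X) (Q : PXMod) :=
  exists (K PP N M : PXMod) (k : K ~> P) (pp : PP ~> P) (n : N ~> P) (m : M ~> P)
    (i : N ~> M) (q : M ~> Q),
    is_kernel p k /\
    is_peiffer_commutator (idm P) (idm P) pp /\
    is_peiffer_commutator (idm P) k n /\
    is_intersection k pp m /\
    m ∘ i = n /\ is_cokernel i q.

End PrecrossedModules.

(* Main.v *)
Require Import Defs.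
From Stdlib Require Import IndefiniteDescription Classical.

Set Implicit Arguments.
Unset Strict Implicit.

(** A precrossed module [X] over [B] is the same thing as a reflexive graph
    [X1] over [B], with [X1] the semi-direct product of [X] and [B].  The functor
    [gr] that sends [X] to [X1] is full and faithful onto the morphisms of graphs,
    and limits, coequalizers and pushouts of graphs are computed in the
    semi-abelian category.  So precrossed modules again form an exact
    protomodular category ([px_exact]), and one can calculate with composable
    pairs of arrows.

    The semi-direct product of [X] and [Y] corresponds to the graph
    [X1 ×_B Y1] of composable pairs.  Hence [a : X ~> Z] and [b : Y ~> Z] extend
    to it exactly when there is an operation [X1 ×_B Y1 ~> Z1] that restricts to
    [a] and [b] on pairs with one component a unit; then [a] and [b]
    [cooperate].  By the universal property of the Peiffer product, a morphism
    [g] kills the Peiffer commutator of [m] and [n] exactly when [g ∘ m] and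
    [g ∘ n] cooperate in both orders ([peiffer_null]).  The condition [UA] serves
    to identify crossed modules with the objects whose identity cooperates with
    itself ([crossed_cooperate]): the two actions of [Z1] on [Z] that have to be
    compared agree on [B] and on [Z].  Therefore the reflection of [X] is its
    quotient by the commutator of [X] with itself, and a morphism into [X]
    factors through that commutator exactly when it [vanishes], that is, becomes
    null in every crossed module.

    A regular epimorphism [f : X ~> Y] with kernel [k] is central exactly when [k]
    and the identity of [X] cooperate in both orders.  This is inherited from trivial
    extensions ([central_cooperate]).  Conversely, the two operations give two
    descriptions of the kernel pair [E1] of [f]: a pair of arrows with equal
    image is [(x, x∘κ)], and also [(x, κ∘x)], for an arrow [κ] of the kernel.
    Comparing them shows that transport of kernel arrows along [x] does not need
    [x] to be invertible, so [X1 ×_B K1] has a crossed quotient obtained by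
    reflecting [X1]; this quotient is the reflection of [E1], and the projection
    of the kernel pair is a trivial extension ([kernel_pair_trivial]).

    It follows that the Galois group of a central extension [u : U ~> X] is the
    largest subobject of [U] that is null in [X] and vanishes
    ([galois_vanishing_kernel]).  Parallel morphisms over [X] into a central
    extension agree on vanishing elements ([central_vanishing_eq]), so this
    subobject is the same for all weakly universal central extensions.  For the
    extension induced by [p] on the quotient of [P] by the commutator of [P] and
    [K[p]], which is weakly universal because [P] is projective, the subobject is
    the quotient of the intersection of [K[p]] and the commutator of [P] with
    itself ([vanishing_kernel_cokernel]). *)

(** * Equational reasoning *)

Lemma pre2 {D : Category} {X Y Z : D} {g : Y ~> Z} {f : X ~> Y} {h : X ~> Z}
  (H : g ∘ f = h) {W : D} (x : W ~> X) : g ∘ (f ∘ x) = h ∘ x.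
Proof. now rewrite <- H, comp_assoc. Qed.

Lemma pre3 {D : Category} {X Y Z T : D} {k : Z ~> T} {g : Y ~> Z} {f : X ~> Y}
  {h : X ~> T} (H : k ∘ (g ∘ f) = h) {W : D} (x : W ~> X) :
  k ∘ (g ∘ (f ∘ x)) = h ∘ x.
Proof. now rewrite <- H, !comp_assoc. Qed.

Lemma pre4 {D : Category} {X Y Z T U : D} {l : T ~> U} {k : Z ~> T} {g : Y ~> Z}
  {f : X ~> Y} {h : X ~> U} (H : l ∘ (k ∘ (g ∘ f)) = h) {W : D} (x : W ~> X) :
  l ∘ (k ∘ (g ∘ (f ∘ x))) = h ∘ x.
Proof. now rewrite <- H, !comp_assoc. Qed.

(** Composites are kept associated to the right, so that [g ∘ (f ∘ x)] reads as
    the value of [g] at the value of [f] at a generalized element [x]; [rw]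
    rewrites with an equation between composites inside such a chain. *)
Ltac ra := rewrite <- ?comp_assoc, ?comp_idl, ?comp_idr.

Ltac rw_with E :=
  rewrite <- ?comp_assoc, ?comp_idl, ?comp_idr in E;
  first [ rewrite (pre4 E) | rewrite (pre3 E) | rewrite (pre2 E) | rewrite E ].

Tactic Notation "rw" constr(H) :=
  let E := fresh "E" in pose proof H as E; ra; rw_with E; clear E; ra.
Tactic Notation "rw" "<-" constr(H) :=
  let E := fresh "E" in pose proof (eq_sym H) as E; ra; rw_with E; clear E; ra.

(** * Pullbacks, regular epimorphisms and null morphisms *)

Section Basics.
Context {D : Category}.

Lemma pb_ext {X Y Z P : D} {f : X ~> Z} {g : Y ~> Z} {p : P ~> X} {q : P ~> Y}
  (H : is_pullback f g p q) {W : D} (a b : W ~> P) :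
  p ∘ a = p ∘ b -> q ∘ a = q ∘ b -> a = b.
Proof.
intros H1 H2. destruct H as [E U].
destruct (U W (p ∘ b) (q ∘ b)) as [h [_ Hu]].
{ ra. now rw E. }
transitivity h; [symmetry|]; apply Hu; auto.
Qed.

Lemma pb_lift {X Y Z P : D} {f : X ~> Z} {g : Y ~> Z} {p : P ~> X} {q : P ~> Y}
  (H : is_pullback f g p q) {W : D} (a : W ~> X) (b : W ~> Y) :
  f ∘ a = g ∘ b -> exists h : W ~> P, p ∘ h = a /\ q ∘ h = b.
Proof.
intros E. destruct (proj2 H W a b E) as [h [Hh _]]. now exists h.
Qed.

Lemma mk_pb {X Y Z P : D} (f : X ~> Z) (g : Y ~> Z) (p : P ~> X) (q : P ~> Y) :
  f ∘ p = g ∘ q ->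
  (forall (W : D) (a b : W ~> P), p ∘ a = p ∘ b -> q ∘ a = q ∘ b -> a = b) ->
  (forall (W : D) (a : W ~> X) (b : W ~> Y), f ∘ a = g ∘ b ->
     exists h : W ~> P, p ∘ h = a /\ q ∘ h = b) ->
  is_pullback f g p q.
Proof.
intros E U L. split; [exact E|]. intros W a b H.
destruct (L W a b H) as [h [H1 H2]]. exists h; split; [auto|].
intros h' [H1' H2']. apply U; congruence.
Qed.

Lemma pb_sym {X Y Z P : D} {f : X ~> Z} {g : Y ~> Z} {p : P ~> X} {q : P ~> Y} :
  is_pullback f g p q -> is_pullback g f q p.
Proof.
intros H. apply mk_pb.
- symmetry. apply H.
- intros W a b H1 H2. now apply (pb_ext H).
- intros W a b E. destruct (pb_lift H (eq_sym E)) as [h [? ?]]. now exists h.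
Qed.

Lemma pb_iso {X Y Z P P' : D} {f : X ~> Z} {g : Y ~> Z} {p : P ~> X} {q : P ~> Y}
  {p' : P' ~> X} {q' : P' ~> Y} :
  is_pullback f g p q -> is_pullback f g p' q' ->
  exists (h : P' ~> P) (h' : P ~> P'), h' ∘ h = idm P' /\ h ∘ h' = idm P /\
    p ∘ h = p' /\ q ∘ h = q'.
Proof.
intros H H'.
destruct (pb_lift H (proj1 H')) as [h [H1 H2]].
destruct (pb_lift H' (proj1 H)) as [h' [H1' H2']].
exists h, h'. repeat split; auto.
- apply (pb_ext H'); [rw H1'; rewrite H1|rw H2'; rewrite H2]; now ra.
- apply (pb_ext H); [rw H1; rewrite H1'|rw H2; rewrite H2']; now ra.
Qed.

Lemma pb_along_iso {X Y Z P P' : D} {f : X ~> Z} {g : Y ~> Z} {p : P ~> X} {q : P ~> Y}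
  (h : P' ~> P) :
  is_pullback f g p q -> is_iso h -> is_pullback f g (p ∘ h) (q ∘ h).
Proof.
intros H [h' [H1 H2]]. apply mk_pb.
- rewrite !comp_assoc. f_equal. apply H.
- intros W a b E1 E2. rewrite <- (comp_idl a), <- (comp_idl b), <- H1. ra. f_equal.
  apply (pb_ext H); now rewrite !comp_assoc.
- intros W a b E. destruct (pb_lift H E) as [x [X1 X2]]. exists (h' ∘ x).
  split; now rw H2.
Qed.

Lemma pb_mono {X Y Z P : D} {f : X ~> Z} {g : Y ~> Z} {p : P ~> X} {q : P ~> Y} :
  is_pullback f g p q -> is_mono f -> is_mono q.
Proof.
intros H Hf W a b E. apply (pb_ext H); [|exact E].
apply Hf. rewrite !comp_assoc, (proj1 H). ra. now rewrite E.
Qed.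

Lemma iso_id (X : D) : is_iso (idm X).
Proof. exists (idm X). now rewrite comp_idl. Qed.

Lemma iso_comp {X Y Z : D} (g : Y ~> Z) (f : X ~> Y) :
  is_iso g -> is_iso f -> is_iso (g ∘ f).
Proof.
intros [g' [G1 G2]] [f' [F1 F2]]. exists (f' ∘ g'). split.
- ra. rw G1. exact F1.
- ra. rw F2. exact G2.
Qed.

Lemma iso_mono {X Y : D} (f : X ~> Y) : is_iso f -> is_mono f.
Proof.
intros [f' [F1 F2]] W a b E.
rewrite <- (comp_idl a), <- (comp_idl b), <- F1. ra. now rewrite E.
Qed.

Lemma split_mono {X Y : D} {f : X ~> Y} {g : Y ~> X} :
  g ∘ f = idm X -> is_mono f.
Proof.
intros E W a b H. rewrite <- (comp_idl a), <- (comp_idl b), <- E. ra. now rewrite H.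
Qed.

Lemma mono_split_iso {X Y : D} (m : X ~> Y) (s : Y ~> X) :
  is_mono m -> m ∘ s = idm Y -> is_iso m.
Proof.
intros M E. exists s. split; [|exact E]. apply M. now rw E.
Qed.

Lemma mono_comp {X Y Z : D} (g : Y ~> Z) (f : X ~> Y) :
  is_mono g -> is_mono f -> is_mono (g ∘ f).
Proof. intros G F W a b E. apply F, G. now rewrite !comp_assoc. Qed.

Definition is_epi {X Y : D} (f : X ~> Y) :=
  forall (W : D) (a b : Y ~> W), a ∘ f = b ∘ f -> a = b.

Lemma coeq_lift {R X Q : D} {f g : R ~> X} {q : X ~> Q} (H : is_coequalizer f g q)
  {W : D} (a : X ~> W) : a ∘ f = a ∘ g -> exists h, h ∘ q = a.
Proof. intros E. destruct (proj2 H W a E) as [h [Hh _]]. now exists h. Qed.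

Lemma coeq_epi {R X Q : D} {f g : R ~> X} {q : X ~> Q} :
  is_coequalizer f g q -> is_epi q.
Proof.
intros [E U] W a b H.
destruct (U W (b ∘ q)) as [h [_ Hu]].
{ ra. now rewrite E. }
transitivity h; [symmetry|]; apply Hu; auto.
Qed.

Lemma mk_coeq {R X Q : D} (f g : R ~> X) (q : X ~> Q) :
  q ∘ f = q ∘ g -> is_epi q ->
  (forall (W : D) (a : X ~> W), a ∘ f = a ∘ g -> exists h, h ∘ q = a) ->
  is_coequalizer f g q.
Proof.
intros E P L. split; [exact E|]. intros W a H. destruct (L W a H) as [h Hh].
exists h; split; [exact Hh|]. intros h' H'. apply P. congruence.
Qed.

Lemma reg_epi {X Y : D} {q : X ~> Y} : is_regular_epi q -> is_epi q.
Proof. intros [R [f [g H]]]. exact (coeq_epi H). Qed.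

Lemma reg_fill {X Y A B : D} {e : X ~> Y} {m : A ~> B} {a : X ~> A} {b : Y ~> B} :
  is_regular_epi e -> is_mono m -> m ∘ a = b ∘ e -> exists h, h ∘ e = a /\ m ∘ h = b.
Proof.
intros He M E. pose proof (reg_epi He) as Ep. destruct He as [R [f [g H]]].
destruct (coeq_lift H (a := a)) as [h Hh].
{ apply M. rewrite !comp_assoc, E. ra. now rewrite (proj1 H). }
exists h; split; [exact Hh|]. apply Ep. ra. now rewrite Hh.
Qed.

Lemma reg_mono_iso {X Y : D} {e : X ~> Y} :
  is_regular_epi e -> is_mono e -> is_iso e.
Proof.
intros He M. destruct (reg_fill He M (a := idm X) (b := idm Y)) as [h [H1 H2]].
{ now ra. }
now exists h.
Qed.

Lemma split_reg {X Y : D} {f : X ~> Y} {s : Y ~> X} :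
  f ∘ s = idm Y -> is_regular_epi f.
Proof.
intros E. exists X, (s ∘ f), (idm X). apply mk_coeq.
- ra. now rw E.
- intros W a b H. rewrite <- (comp_idr a), <- (comp_idr b), <- E.
  now rewrite !comp_assoc, H.
- intros W a H. exists (a ∘ s). ra. rewrite comp_idr in H. exact H.
Qed.

Lemma iso_reg {X Y : D} (f : X ~> Y) : is_iso f -> is_regular_epi f.
Proof. intros [g [_ H]]. exact (split_reg H). Qed.

Lemma reg_coeq_kp {E X Y : D} {f : X ~> Y} {p1 p2 : E ~> X} :
  is_regular_epi f -> is_kernel_pair f p1 p2 -> is_coequalizer p1 p2 f.
Proof.
intros Hf K. pose proof (reg_epi Hf) as Ep. destruct Hf as [R [a [b H]]].
apply mk_coeq; [apply K|exact Ep|].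
intros W x Hx. apply (coeq_lift H).
destruct (pb_lift K (proj1 H)) as [h [<- <-]]. now rw Hx.
Qed.

Lemma reg_comp_iso {X Y Z : D} (i : Y ~> Z) (q : X ~> Y) :
  is_iso i -> is_regular_epi q -> is_regular_epi (i ∘ q).
Proof.
intros [j [J1 J2]] Hq. pose proof (reg_epi Hq) as Ep. destruct Hq as [R [f [g H]]].
exists R, f, g. apply mk_coeq.
- ra. now rewrite (proj1 H).
- intros W a b E. rewrite <- (comp_idr a), <- (comp_idr b), <- J2.
  rewrite !comp_assoc. f_equal. apply Ep. now ra.
- intros W a E. destruct (coeq_lift H E) as [h Hh]. exists (h ∘ j). ra. now rw J1.
Qed.

Lemma kp_diag {E X Y : D} {f : X ~> Y} {p1 p2 : E ~> X} :
  is_kernel_pair f p1 p2 -> exists d : X ~> E, p1 ∘ d = idm X /\ p2 ∘ d = idm X.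
Proof. intros K. now apply (pb_lift K). Qed.

(** In a quasi-pointed category null morphisms are those that factor through the
    initial object; there need not be one between two given objects. *)
Definition is_null {X Y : D} (f : X ~> Y) :=
  exists (O : D) (o : O ~> Y) (t : X ~> O), is_initial O /\ f = o ∘ t.

Lemma null_l {X Y Z : D} (g : Y ~> Z) (f : X ~> Y) : is_null f -> is_null (g ∘ f).
Proof.
intros [O [o [t [H ->]]]]. exists O, (g ∘ o), t. now rewrite comp_assoc.
Qed.

Lemma null_r {X Y Z : D} (g : Y ~> Z) (f : X ~> Y) : is_null g -> is_null (g ∘ f).
Proof.
intros [O [o [t [H ->]]]]. exists O, o, (t ∘ f). now rewrite comp_assoc.
Qed.

Lemma initial_ex {O : D} (H : is_initial O) (X : D) : exists o : O ~> X, True.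
Proof. destruct (H X) as [o _]. now exists o. Qed.

Lemma initial_eq {O : D} (H : is_initial O) {X : D} (a b : O ~> X) : a = b.
Proof.
destruct (H X) as [h [_ U]]. transitivity h; [symmetry|]; now apply U.
Qed.

Lemma null_to {O : D} (HO : is_initial O) {X Y : D} (f : X ~> Y) (o : O ~> Y) :
  is_null f -> exists t : X ~> O, f = o ∘ t.
Proof.
intros [O1 [o' [t [H ->]]]]. destruct (initial_ex H O) as [j _].
exists (j ∘ t). rewrite comp_assoc. f_equal. apply (initial_eq H).
Qed.

Lemma null_mono {X Y Z : D} (m : Y ~> Z) (f : X ~> Y) :
  is_mono m -> is_null (m ∘ f) -> is_null f.
Proof.
intros M [O [o [t [H E]]]]. destruct (initial_ex H Y) as [j _].
exists O, j, t. split; [exact H|]. apply M. rewrite E, comp_assoc. f_equal.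
apply (initial_eq H).
Qed.

End Basics.

(** * Exact protomodular categories *)

(** What semi-abelian categories and categories of precrossed modules have in
    common: Barr exact, protomodular and quasi-pointed.  The second field says
    that the map from the initial to the terminal object is a monomorphism, and
    protomodularity is stated for comparison along the identity of the pulled
    back object. *)
Class ExactProtomodular (D : Category) : Prop := {
  ep_initial : exists O : D, is_initial O;
  ep_initial_sub : forall (O W : D) (a b : W ~> O), is_initial O -> a = b;
  ep_terminal : exists T : D, is_terminal T;
  ep_pullback : forall (X Y Z : D) (f : X ~> Z) (g : Y ~> Z),
    exists (P : D) (p : P ~> X) (q : P ~> Y), is_pullback f g p q;
  ep_coequalizer : forall (E X Y : D) (f : X ~> Y) (p1 p2 : E ~> X),
    is_kernel_pair f p1 p2 -> exists (Q : D) (q : X ~> Q), is_coequalizer p1 p2 q;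
  ep_stable : forall (X Y Z P : D) (f : X ~> Z) (g : Y ~> Z) (p : P ~> X) (q : P ~> Y),
    is_pullback f g p q -> is_regular_epi f -> is_regular_epi q;
  ep_effective : forall (R X : D) (r1 r2 : R ~> X),
    is_equivalence_relation r1 r2 -> exists (Y : D) (f : X ~> Y), is_kernel_pair f r1 r2;
  ep_protomodular : forall (Y Y' : D) (v : Y' ~> Y)
    (A : D) (p : A ~> Y) (s : Y ~> A) (A' : D) (p' : A' ~> Y) (s' : Y ~> A')
    (h : A ~> A') (W : D) (a : W ~> A) (q : W ~> Y'),
    p ∘ s = idm Y -> p' ∘ s' = idm Y -> p' ∘ h = p -> h ∘ s = s' ->
    is_pullback p v a q -> is_pullback p' v (h ∘ a) q -> is_iso h }.

Section Exact.
Context {D : Category} {EP : ExactProtomodular D}.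

Lemma null_eq {X Y : D} (f g : X ~> Y) : is_null f -> is_null g -> f = g.
Proof.
intros [O [o [t [H ->]]]] Hg. destruct (null_to H o Hg) as [t' ->].
f_equal. now apply ep_initial_sub.
Qed.

Lemma null_epi {X Y Z : D} (e : X ~> Y) (f : Y ~> Z) :
  is_regular_epi e -> is_null (f ∘ e) -> is_null f.
Proof.
intros He [O [o [t [H E]]]]. pose proof (reg_epi He) as Ep.
destruct He as [R [r1 [r2 Hr]]].
destruct (coeq_lift Hr (a := t)) as [t' Ht]; [now apply ep_initial_sub|].
exists O, o, t'. split; [exact H|]. apply Ep. now rewrite E, <- Ht, comp_assoc.
Qed.

Lemma kernel_null {K X Y : D} {f : X ~> Y} {k : K ~> X} : is_kernel f k -> is_null (f ∘ k).
Proof. intros [O [o [t [H P]]]]. exists O, o, t. split; [exact H|apply P]. Qed.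

Lemma kernel_mono {K X Y : D} {f : X ~> Y} {k : K ~> X} : is_kernel f k -> is_mono k.
Proof.
intros [O [o [t [H P]]]] W a b E. apply (pb_ext P); [exact E|].
now apply ep_initial_sub.
Qed.

Lemma kernel_lift {K X Y : D} {f : X ~> Y} {k : K ~> X} (H : is_kernel f k)
  {W : D} (a : W ~> X) : is_null (f ∘ a) -> exists h, k ∘ h = a.
Proof.
intros Hn. destruct H as [O [o [t [H P]]]].
destruct (null_to H o Hn) as [u Hu].
destruct (pb_lift P Hu) as [h [Hh _]]. now exists h.
Qed.

Lemma mk_kernel {K X Y : D} (f : X ~> Y) (k : K ~> X) :
  is_null (f ∘ k) -> is_mono k ->
  (forall (W : D) (a : W ~> X), is_null (f ∘ a) -> exists h, k ∘ h = a) ->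
  is_kernel f k.
Proof.
intros [O [o [t [H E]]]] M L. exists O, o, t. split; [exact H|].
apply mk_pb; [exact E|intros; now apply M|].
intros W a b Hab. destruct (L W a) as [h Hh].
{ now exists O, o, b. }
exists h; split; [exact Hh|now apply ep_initial_sub].
Qed.

Lemma kernel_ex {X Y : D} (f : X ~> Y) : exists (K : D) (k : K ~> X), is_kernel f k.
Proof.
destruct ep_initial as [O H]. destruct (initial_ex H Y) as [o _].
destruct (ep_pullback f o) as [K [k [t P]]]. exists K, k, O, o, t. now split.
Qed.

(** The image is the coequalizer of the kernel pair of [f]; the induced [m] is a
    monomorphism because two elements of the quotient with the same image lift,
    after regular covers, to a pair in the kernel pair. *)
Lemma image_ex {X Y : D} (f : X ~> Y) :
  exists (I : D) (e : X ~> I) (m : I ~> Y), is_regular_epi e /\ is_mono m /\ m ∘ e = f.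
Proof.
destruct (ep_pullback f f) as [E [p1 [p2 K]]].
destruct (ep_coequalizer K) as [Q [q H]].
destruct (coeq_lift H (proj1 K)) as [m Hm].
assert (Hq : is_regular_epi q) by now exists E, p1, p2.
exists Q, q, m. split; [exact Hq|split; [|exact Hm]].
intros W a b Hab.
destruct (ep_pullback q a) as [W1 [x [w1 P1]]].
destruct (ep_pullback q (b ∘ w1)) as [W2 [y [w2 P2]]].
apply (reg_epi (ep_stable P1 Hq)), (reg_epi (ep_stable P2 Hq)).
rewrite <- (proj1 P1), <- (proj1 P2).
destruct (pb_lift K (a := x ∘ w2) (b := y)) as [h [H1 H2]].
{ rewrite <- Hm. ra. rw (proj1 P1). rw (proj1 P2). now rw Hab. }
rewrite <- H2. ra. rewrite <- H1. now rw (proj1 H).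
Qed.

Definition is_extremal {X Y : D} (f : X ~> Y) :=
  forall (M : D) (m : M ~> Y) (g : X ~> M), is_mono m -> m ∘ g = f -> is_iso m.

Lemma reg_extremal {X Y : D} (f : X ~> Y) : is_regular_epi f -> is_extremal f.
Proof.
intros H M m g Hm E. destruct (reg_fill H Hm (a := g) (b := idm Y)) as [h [_ Hh]].
{ now rewrite comp_idl. }
exact (mono_split_iso Hm Hh).
Qed.

Lemma extremal_reg {X Y : D} (f : X ~> Y) : is_extremal f -> is_regular_epi f.
Proof.
intros H. destruct (image_ex f) as [I [e [m [He [Hm E]]]]].
rewrite <- E. apply reg_comp_iso; [|exact He]. exact (H _ _ _ Hm E).
Qed.

Lemma reg_comp {X Y Z : D} (g : Y ~> Z) (f : X ~> Y) :
  is_regular_epi g -> is_regular_epi f -> is_regular_epi (g ∘ f).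
Proof.
intros G F. apply extremal_reg. intros M m h Hm E.
destruct (reg_fill F Hm E) as [k [_ Hk]].
exact (reg_extremal G Hm Hk).
Qed.

Lemma reg_cancel {X Y Z : D} {g : Y ~> Z} {f : X ~> Y} :
  is_regular_epi (g ∘ f) -> is_regular_epi g.
Proof.
intros H. apply extremal_reg. intros M m h Hm E.
apply (reg_extremal H (m := m) (g := h ∘ f)); [exact Hm|]. rewrite <- E. now ra.
Qed.

Lemma prod_ex (X Y : D) : exists (P : D) (p : P ~> X) (q : P ~> Y),
  (forall (W : D) (a b : W ~> P), p ∘ a = p ∘ b -> q ∘ a = q ∘ b -> a = b) /\
  (forall (W : D) (a : W ~> X) (b : W ~> Y), exists h, p ∘ h = a /\ q ∘ h = b).
Proof.
destruct (ep_terminal (D := D)) as [T H].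
destruct (H X) as [x _], (H Y) as [y _].
destruct (ep_pullback x y) as [P [p [q HP]]]. exists P, p, q. split.
- intros W a b. exact (pb_ext HP (a := a) (b := b)).
- intros W a b. apply (pb_lift HP).
  destruct (H W) as [w [_ U]]. transitivity w; [symmetry|]; now apply U.
Qed.

Lemma jee_sym {A B' Z : D} (f : A ~> Z) (g : B' ~> Z) :
  jointly_extremal_epi f g -> jointly_extremal_epi g f.
Proof. intros H M m f' g' Hm E1 E2. exact (H M m g' f' Hm E2 E1). Qed.

(** Pulling [m] back along [h] gives a subobject of [Z] that contains the two
    jointly extremal morphisms. *)
Lemma jee_factor {A B' Z Y M : D} {f : A ~> Z} {g : B' ~> Z} (J : jointly_extremal_epi f g)
  (h : Z ~> Y) (m : M ~> Y) (f' : A ~> M) (g' : B' ~> M) :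
  is_mono m -> m ∘ f' = h ∘ f -> m ∘ g' = h ∘ g -> exists h', m ∘ h' = h.
Proof.
intros Hm E1 E2. destruct (ep_pullback m h) as [P [p [q HP]]].
destruct (pb_lift HP E1) as [a [_ A2]]. destruct (pb_lift HP E2) as [b [_ B2]].
destruct (J P q a b (pb_mono HP Hm) A2 B2) as [r [_ R]].
exists (p ∘ r). ra. rw (proj1 HP). now rw R.
Qed.

Lemma jee_epi {A B' Z Y : D} {f : A ~> Z} {g : B' ~> Z} (J : jointly_extremal_epi f g)
  (a b : Z ~> Y) : a ∘ f = b ∘ f -> a ∘ g = b ∘ g -> a = b.
Proof.
intros E1 E2.
destruct (prod_ex Y Y) as [P [p [q [U L]]]].
destruct (L Y (idm Y) (idm Y)) as [d [D1 D2]].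
destruct (L Z a b) as [c [C1 C2]].
destruct (jee_factor J (h := c) (m := d) (f' := a ∘ f) (g' := a ∘ g)) as [h Hh].
- exact (split_mono D1).
- apply U; ra; rw D1 || rw D2; rw C1 || rw C2; auto.
- apply U; ra; rw D1 || rw D2; rw C1 || rw C2; auto.
- rewrite <- C1, <- C2, <- Hh. rw D1. now rw D2.
Qed.

(** Protomodularity: a subobject of [A] that contains the section [s] is again
    split over [Y], and if it contains a fibre of [p] then it has the same fibre. *)
Lemma split_pb_jee {A Y Y' W : D} {p : A ~> Y} {s : Y ~> A} {v : Y' ~> Y}
  {a : W ~> A} {q : W ~> Y'} :
  p ∘ s = idm Y -> is_pullback p v a q -> jointly_extremal_epi s a.
Proof.
intros E HP M m f' g' Hm E1 E2.
apply (@ep_protomodular D EP Y Y' v M (p ∘ m) f' A p s m W g' q); auto.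
- ra. now rewrite E1.
- apply mk_pb.
  + ra. rewrite E2. apply HP.
  + intros V x y H1 H2. apply (pb_ext HP); [|exact H2].
    rewrite <- E2. ra. now rewrite H1.
  + intros V x y H. destruct (pb_lift HP (a := m ∘ x) (b := y)) as [h [H1 H2]].
    { now rewrite comp_assoc. }
    exists h. split; [|exact H2]. apply Hm. now rw E2.
- now rewrite E2.
Qed.

Lemma split_jee {A Y K : D} {p : A ~> Y} {s : Y ~> A} {k : K ~> A} :
  p ∘ s = idm Y -> is_kernel p k -> jointly_extremal_epi s k.
Proof. intros E [O [o [t [_ HP]]]]. exact (split_pb_jee E HP). Qed.

(** The fibre of the projection [q] along the section [t] is [X], included by
    [s1], so that [split_pb_jee] applies to [q] and its section [s2]. *)
Lemma pb_jee {X Y Z W : D} {f : X ~> Z} {s : Z ~> X} {g : Y ~> Z} {t : Z ~> Y}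
  {p : W ~> X} {q : W ~> Y} {s1 : X ~> W} {s2 : Y ~> W} :
  g ∘ t = idm Z -> is_pullback f g p q ->
  p ∘ s1 = idm X -> q ∘ s1 = t ∘ f -> p ∘ s2 = s ∘ g -> q ∘ s2 = idm Y ->
  jointly_extremal_epi s1 s2.
Proof.
intros Et HP A1 A2 B1 B2. apply jee_sym.
apply (split_pb_jee (p := q) (v := t) (q := f) B2).
apply mk_pb.
- exact A2.
- intros V x y H _. rewrite <- (comp_idl x), <- (comp_idl y), <- A1. ra. now rewrite H.
- intros V x z H. exists (p ∘ x).
  assert (E : f ∘ (p ∘ x) = z). { rw (proj1 HP). rewrite H. now rw Et. }
  split; [|exact E]. apply (pb_ext HP).
  + now rw A1.
  + rw A2. now rewrite E.
Qed.

(** The triples [(a, b), (c, b), (c, d)] of related pairs form a pullback of two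
    split epimorphisms.  By [pb_jee] it is covered by the triples with [b = d]
    and those with [a = c], and for these [a] and [d] are obviously related. *)
Lemma difunctional {R X : D} {r1 r2 : R ~> X} :
  (forall (W : D) (a b : W ~> R), r1 ∘ a = r1 ∘ b -> r2 ∘ a = r2 ∘ b -> a = b) ->
  forall (W : D) (a b c d : W ~> X),
  in_rel r1 r2 a b -> in_rel r1 r2 c b -> in_rel r1 r2 c d -> in_rel r1 r2 a d.
Proof.
intros U W a b c d [w1 [A1 B1]] [w2 [C2 B2]] [w3 [C3 D3]].
destruct (ep_pullback r2 r2) as [E2 [u1 [u2 K2]]].
destruct (ep_pullback r1 r1) as [E1 [v1 [v2 K1]]].
destruct (kp_diag K2) as [d2 [D21 D22]]. destruct (kp_diag K1) as [d1 [D11 D12]].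
destruct (ep_pullback u2 v1) as [T [t1 [t2 HT]]].
destruct (pb_lift HT (a := idm E2) (b := d1 ∘ u2)) as [s1 [S11 S12]].
{ ra. now rw D11. }
destruct (pb_lift HT (a := d2 ∘ v1) (b := idm E1)) as [s2 [S21 S22]].
{ ra. now rw D22. }
assert (J := pb_jee D11 HT S11 S12 S21 S22).
destruct (prod_ex X X) as [P [p [q [PU PL]]]].
destruct (PL R r1 r2) as [m [M1 M2]].
destruct (PL T (r1 ∘ (u1 ∘ t1)) (r2 ∘ (v2 ∘ t2))) as [h [H1 H2]].
destruct (jee_factor J (h := h) (m := m) (f' := u1) (g' := v2)) as [h' Hh].
- intros V x y E. apply U.
  + rewrite <- M1. ra. now rewrite E.
  + rewrite <- M2. ra. now rewrite E.
- apply PU.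
  + rw M1. rw H1. now rw S11.
  + rw M2. rw H2. rw S12. rw D12. apply K2.
- apply PU.
  + rw M1. rw H1. rw S21. rw D21. symmetry. apply K1.
  + rw M2. rw H2. now rw S22.
- destruct (pb_lift K2 (a := w1) (b := w2)) as [x [X1 X2]]; [congruence|].
  destruct (pb_lift K1 (a := w2) (b := w3)) as [y [Y1 Y2]]; [congruence|].
  destruct (pb_lift HT (a := x) (b := y)) as [z [Z1 Z2]]; [congruence|].
  exists (h' ∘ z). split.
  + rewrite <- M1. ra. rw Hh. rw H1. rw Z1. now rw X1.
  + rewrite <- M2. ra. rw Hh. rw H2. rw Z2. now rw Y2.
Qed.

Lemma reflexive_equivalence {R X : D} {r1 r2 : R ~> X} (d : X ~> R) :
  (forall (W : D) (a b : W ~> R), r1 ∘ a = r1 ∘ b -> r2 ∘ a = r2 ∘ b -> a = b) ->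
  r1 ∘ d = idm X -> r2 ∘ d = idm X -> is_equivalence_relation r1 r2.
Proof.
intros U D1 D2.
assert (Rf : forall (W : D) (a : W ~> X), in_rel r1 r2 a a).
{ intros W a. exists (d ∘ a). split; [now rw D1|now rw D2]. }
split; [exact U|split; [exact Rf|split]].
- intros W a b H. exact (difunctional U (Rf _ b) H (Rf _ a)).
- intros W a b c H1 H2. exact (difunctional U H1 (Rf _ b) H2).
Qed.

(** The image of [(f, g)] is a reflexive relation, hence an effective
    equivalence relation; its quotient is the coequalizer.  Reflexivity is only
    asked up to the regular cover [r], which allows direct images of equivalence
    relations. *)
Lemma reflexive_coequalizer {R X X' : D} {f g : R ~> X} {r : X' ~> X} {s : X' ~> R} :
  is_regular_epi r -> f ∘ s = r -> g ∘ s = r ->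
  exists (I Q : D) (e : R ~> I) (r1 r2 : I ~> X) (q : X ~> Q),
    is_regular_epi e /\ r1 ∘ e = f /\ r2 ∘ e = g /\
    is_kernel_pair q r1 r2 /\ is_coequalizer f g q.
Proof.
intros Hr Fs Gs.
destruct (prod_ex X X) as [P [p [q [PU PL]]]].
destruct (PL R f g) as [fg [F1 F2]].
destruct (PL X (idm X) (idm X)) as [dg [G1 G2]].
destruct (image_ex fg) as [I [e [m [He [Hm E]]]]].
destruct (reg_fill Hr Hm (a := e ∘ s) (b := dg)) as [d [_ Hd]].
{ rw E. apply PU; [rw F1; now rw G1 | rw F2; now rw G2]. }
destruct (@ep_effective D EP I X (p ∘ m) (q ∘ m)) as [Y [h K]].
{ apply (reflexive_equivalence (d := d)).
  - intros W a b H1 H2. apply Hm, PU; now ra; rewrite <- ?comp_assoc in H1, H2.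
  - now rw Hd.
  - now rw Hd. }
destruct (ep_coequalizer K) as [Q [c Hc]].
destruct (coeq_lift Hc (proj1 K)) as [n Hn].
exists I, Q, e, (p ∘ m), (q ∘ m), c.
assert (E1 : (p ∘ m) ∘ e = f) by now rw E.
assert (E2 : (q ∘ m) ∘ e = g) by now rw E.
repeat split; auto.
- apply Hc.
- intros W a b H. apply (proj2 K). rewrite <- Hn. ra. now rewrite H.
- rewrite <- E1, <- E2. rewrite !comp_assoc. f_equal.
  generalize (proj1 Hc). now ra.
- intros W a H. apply (proj2 Hc). apply (reg_epi He). ra.
  rewrite <- E1, <- E2 in H. generalize H. now ra.
Qed.

(** The kernel pair of [q] is covered by the diagonal and the kernel of its first
    projection, and [g] equalizes the two projections on both. *)
Lemma normal_epi {K X Q Z : D} {q : X ~> Q} {k : K ~> X} (g : X ~> Z) :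
  is_regular_epi q -> is_kernel q k -> is_null (g ∘ k) -> exists h, h ∘ q = g.
Proof.
intros Hq Hk Hg.
destruct (ep_pullback q q) as [E [p1 [p2 KP]]].
destruct (kp_diag KP) as [d [D1 D2]].
apply (coeq_lift (reg_coeq_kp Hq KP)).
destruct (kernel_ex p1) as [N [n Hn]].
apply (jee_epi (split_jee D1 Hn)).
- ra. now rewrite D1, D2.
- ra. pose proof (kernel_null Hn) as N1.
  destruct (kernel_lift Hk (a := p2 ∘ n)) as [h Hh].
  { rw <- (proj1 KP). now apply null_l. }
  rewrite <- Hh. apply null_eq; [now apply null_l|].
  rewrite comp_assoc. now apply null_r.
Qed.

(** Direct images of normal subobjects are normal.  The direct image along [r]
    of the kernel pair of [q] is an equivalence relation on [A], with quotient
    [g].  An element of the kernel of [g] is locally of the form [r x'] with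
    [(x, x')] in the kernel pair of [q] and [r x] null; such pairs are covered by
    the diagonal and the kernel of [q], so the element lies in [l]. *)
Lemma image_kernel {K X S A L : D} {q : X ~> S} {k : K ~> X} {r : X ~> A} {e : K ~> L}
  {l : L ~> A} :
  is_regular_epi q -> is_kernel q k -> is_regular_epi r ->
  is_regular_epi e -> is_mono l -> l ∘ e = r ∘ k ->
  exists (Z : D) (g : A ~> Z), is_regular_epi g /\ is_kernel g l.
Proof.
intros Hq Hk Hr He Hl E.
destruct (ep_pullback q q) as [T [p1 [p2 KP]]].
destruct (kp_diag KP) as [d [D1 D2]].
destruct (@reflexive_coequalizer T A X (r ∘ p1) (r ∘ p2) r d) as
  [I [Z [c [r1 [r2 [g [Hc [C1 [C2 [KG Hg]]]]]]]]]].
{ exact Hr. } { now rw D1. } { now rw D2. }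
exists Z, g. split; [now exists T, (r ∘ p1), (r ∘ p2)|].
destruct (kernel_ex r) as [N [n Hn]].
destruct (ep_pullback p1 n) as [T' [t [t' HT]]].
destruct (pb_lift HT (a := d ∘ n) (b := idm N)) as [s [S1 S2]].
{ now rw D1. }
destruct (kernel_ex t') as [N' [n' Hn']].
assert (NP : is_null (p1 ∘ (t ∘ n'))).
{ rw (proj1 HT). apply null_l, kernel_null, Hn'. }
destruct (kernel_lift Hk (a := p2 ∘ (t ∘ n'))) as [z Hz].
{ rw <- (proj1 KP). now apply null_l. }
assert (NR := kernel_null Hn).
destruct NR as [O [o [u [HO Ho]]]].
destruct (initial_ex HO L) as [ol _].
destruct (jee_factor (split_jee S2 Hn') (h := r ∘ (p2 ∘ t)) (m := l)
   (f' := ol ∘ u) (g' := e ∘ z)) as [w Hw]; [exact Hl| | |].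
{ ra. rw S1. rw D2. rewrite Ho, comp_assoc. f_equal. apply (initial_eq HO). }
{ rw E. now rewrite Hz. }
assert (Hnull : is_null (g ∘ l)).
{ apply (null_epi He). rewrite <- comp_assoc, E.
  destruct (kernel_null Hk) as [O2 [o2 [u2 [HO2 Ho2]]]].
  destruct (initial_ex HO2 X) as [ox _].
  destruct (pb_lift KP (a := ox ∘ u2) (b := k)) as [y [Y1 Y2]].
  { rewrite Ho2, comp_assoc. f_equal. apply (initial_eq HO2). }
  rewrite <- Y2. rw <- (proj1 Hg). rewrite Y1.
  rewrite !comp_assoc. exists O2, (g ∘ (r ∘ ox)), u2. split; [exact HO2|now ra]. }
apply mk_kernel; [exact Hnull|exact Hl|].
intros W a Ha. destruct Ha as [O3 [o3 [u3 [HO3 Ho3]]]].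
destruct (initial_ex HO3 A) as [oa _].
destruct (pb_lift KG (a := oa ∘ u3) (b := a)) as [i [I1 I2]].
{ rewrite Ho3, comp_assoc. f_equal. apply (initial_eq HO3). }
destruct (ep_pullback c i) as [V [v [v' HV]]].
assert (Rv := ep_stable HV Hc).
destruct (kernel_lift Hn (a := p1 ∘ v)) as [x Hx].
{ rewrite !comp_assoc, <- C1. ra. rw (proj1 HV). rewrite (pre2 I1). ra.
  exists O3, oa, (u3 ∘ v'). split; [exact HO3|now ra]. }
destruct (pb_lift HT (a := v) (b := x)) as [y [Y1 Y2]]; [congruence|].
destruct (reg_fill (a := w ∘ y) (b := a) Rv Hl) as [h [_ Hh]].
{ rw Hw. rewrite Y1. rewrite <- I2. ra. rw <- (proj1 HV). now rw C2. }
now exists h.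
Qed.

(** This is [normal_epi] in terms of pushouts. *)
Lemma kernel_cokernel {K X Q : D} {q : X ~> Q} {k : K ~> X} :
  is_regular_epi q -> is_kernel q k -> is_cokernel k q.
Proof.
intros Hq Hk. destruct (kernel_null Hk) as [O [o [t [HO E]]]].
exists O, t, o. split; [exact HO|]. split; [exact E|].
intros W a b Hab. destruct (normal_epi (g := a) Hq Hk) as [h Hh].
{ now exists O, b, t. }
exists h. split; [split; [exact Hh|apply (initial_eq HO)]|].
intros h' [H' _]. apply (reg_epi Hq). congruence.
Qed.

Lemma cokernel_unique {N M Q Q' : D} {i : N ~> M} {q : M ~> Q} {q' : M ~> Q'} :
  is_cokernel i q -> is_cokernel i q' -> isomorphic Q Q'.
Proof.
intros [O [t [o [HO [E U]]]]] [O' [t' [o' [HO' [E' U']]]]].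
assert (N1 : is_null (q ∘ i)) by now exists O, o, t.
assert (N2 : is_null (q' ∘ i)) by now exists O', o', t'.
destruct (initial_ex HO Q') as [b _]. destruct (initial_ex HO' Q) as [b' _].
assert (F : q' ∘ i = b ∘ t) by (apply null_eq; [exact N2|now exists O, b, t]).
assert (F' : q ∘ i = b' ∘ t') by (apply null_eq; [exact N1|now exists O', b', t']).
destruct (U _ _ _ F) as [h [[H1 _] _]]. destruct (U' _ _ _ F') as [h' [[H1' _] _]].
exists h, h'. split.
- destruct (U _ _ _ E) as [g [_ G]]. transitivity g; [symmetry|]; apply G.
  + split; [ra; now rewrite H1|apply (initial_eq HO)].
  + now rewrite !comp_idl.
- destruct (U' _ _ _ E') as [g [_ G]]. transitivity g; [symmetry|]; apply G.
  + split; [ra; now rewrite H1'|apply (initial_eq HO')].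
  + now rewrite !comp_idl.
Qed.

End Exact.

(** * Semi-abelian categories *)

Section SemiAbelianBasics.
Context {C : SemiAbelian}.

Global Instance semiabelian_exact : ExactProtomodular C.
Proof.
constructor.
- exists zero. exact (@zero_initial C).
- intros O W a b HO.
  destruct (initial_ex HO zero) as [u _]. destruct (initial_ex (@zero_initial C) O) as [v _].
  rewrite <- (comp_idl a), <- (comp_idl b), (initial_eq HO (idm O) (v ∘ u)). ra.
  f_equal. apply to_zero_unique.
- exists zero. exact (@zero_terminal C).
- intros X Y Z f g. exists (pb f g), (pb1 f g), (pb2 f g). apply pb_pullback.
- apply kernel_pair_coequalizer.
- apply regular_epi_pullback.
- apply equivalence_relation_effective.
- intros Y Y' v A p s A' p' s' h W a q E E' H1 H2 P P'.
  apply (protomodular (w := idm W) E E' H1 H2 P P').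
  + now rewrite comp_idr.
  + apply comp_idr.
  + apply iso_id.
Qed.

Lemma is_null_zero (X Y : C) (f : X ~> Y) : is_null f <-> f = zero_mor X Y.
Proof.
split.
- intros [O [o [t [HO ->]]]]. destruct (initial_ex HO zero) as [u _].
  rewrite (initial_eq HO o (from_zero Y ∘ u)). unfold zero_mor. ra.
  f_equal. apply to_zero_unique.
- intros ->. exists zero, (from_zero Y), (to_zero X). split; [apply (@zero_initial C)|easy].
Qed.

Lemma comp_copair (X Y W V : C) (h : W ~> V) (a : X ~> W) (b : Y ~> W) :
  h ∘ copair a b = copair (h ∘ a) (h ∘ b).
Proof.
apply sum_ext; ra; rewrite ?copair_in1, ?copair_in2; auto.
Qed.

Lemma copair_map (X Y X' Y' W : C) (a : X' ~> W) (b : Y' ~> W) (u : X ~> X') (v : Y ~> Y') :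
  copair a b ∘ sum_map u v = copair (a ∘ u) (b ∘ v).
Proof.
unfold sum_map. rewrite comp_copair. now rewrite !comp_assoc, copair_in1, copair_in2.
Qed.

Lemma copair_flat (A B X Y W : C) (a : B ~> W) (b : Y ~> W) (u : A ~> B) (v : X ~> Y) :
  copair a b ∘ (flat_ker B Y ∘ flat_map u v) = copair (a ∘ u) (b ∘ v) ∘ flat_ker A X.
Proof. now rewrite flat_map_spec, comp_assoc, copair_map. Qed.

Lemma flat_lift (B X W : C) (h : W ~> sum B X) :
  is_null (sum_proj B X ∘ h) -> exists k : W ~> flat B X, flat_ker B X ∘ k = h.
Proof.
intros H. apply is_null_zero in H. destruct (flat_lift_ex H) as [k [Hk _]]. now exists k.
Qed.

Lemma flat_ker_null (B X : C) : is_null (sum_proj B X ∘ flat_ker B X).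
Proof. apply is_null_zero, flat_ker_zero. Qed.

Lemma flat_unit_spec (B X : C) : flat_ker B X ∘ flat_unit B X = in2 B X.
Proof. exact (the_spec (flat_lift_ex (flat_unit_ok B X))). Qed.

Lemma flat_mult_spec (B X : C) : flat_ker B X ∘ flat_mult B X =
  copair (in1 B X) (flat_ker B X) ∘ flat_ker B (flat B X).
Proof. exact (the_spec (flat_lift_ex (flat_mult_ok B X))). Qed.

(** Adding a copy of [X] to [R] makes the pair reflexive. *)
Lemma coequalizer_ex (R X : C) (f g : R ~> X) :
  exists (Q : C) (q : X ~> Q), is_coequalizer f g q.
Proof.
destruct (@reflexive_coequalizer C _ (sum X R) X X (copair (idm X) f) (copair (idm X) g)
  (idm X) (in1 X R)) as [I [Q [e [r1 [r2 [q [_ [_ [_ [_ H]]]]]]]]]].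
- apply iso_reg, iso_id.
- apply copair_in1.
- apply copair_in1.
- exists Q, q. apply mk_coeq.
  + rewrite <- (copair_in2 (idm X) f), <- (copair_in2 (idm X) g).
    rewrite !comp_assoc. f_equal. apply H.
  + exact (coeq_epi H).
  + intros W a E. apply (coeq_lift H). rewrite !comp_copair. now rewrite E.
Qed.

Lemma pushout_ex (Z X Y : C) (f : Z ~> X) (g : Z ~> Y) :
  exists (Q : C) (i : X ~> Q) (j : Y ~> Q), is_pushout f g i j.
Proof.
destruct (coequalizer_ex (in1 X Y ∘ f) (in2 X Y ∘ g)) as [Q [q H]].
exists Q, (q ∘ in1 X Y), (q ∘ in2 X Y). split.
- ra. apply H.
- intros W a b E. destruct (coeq_lift H (a := copair a b)) as [h Hh].
  { rewrite !comp_assoc, copair_in1, copair_in2. exact E. }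
  exists h. split.
  + rewrite !comp_assoc, Hh. now rewrite copair_in1, copair_in2.
  + intros h' [H1 H2]. apply (coeq_epi H). rewrite Hh.
    apply sum_ext; rewrite ?copair_in1, ?copair_in2; ra; auto.
Qed.

(** * Actions and points *)

Lemma semidirect_jee (B X S : C) (xi : flat B X ~> X) (p : S ~> B) (i : B ~> S) (j : X ~> S) :
  is_semidirect xi p i j -> jointly_extremal_epi i j.
Proof. intros [H1 [H2 _]]. exact (split_jee H1 H2). Qed.

Lemma semidirect_proj (B X S : C) (xi : flat B X ~> X) (p : S ~> B) (i : B ~> S) (j : X ~> S) :
  is_semidirect xi p i j -> p ∘ copair i j = sum_proj B X.
Proof.
intros [H1 [H2 _]]. rewrite comp_copair, H1. unfold sum_proj. f_equal.
apply is_null_zero, (kernel_null H2).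
Qed.

(** The kernel of the regular epimorphism [copair i j] lies in [flat B X], where
    it is the kernel of [xi]; so [copair b a] kills it as soon as [b] and [a] are
    compatible with [xi]. *)
Lemma semidirect_lift (B X S Z : C) (xi : flat B X ~> X) (p : S ~> B) (i : B ~> S)
  (j : X ~> S) (b : B ~> Z) (a : X ~> Z) :
  is_semidirect xi p i j -> a ∘ xi = copair b a ∘ flat_ker B X ->
  exists h : S ~> Z, h ∘ i = b /\ h ∘ j = a.
Proof.
intros H E. pose proof (semidirect_proj H) as Hp. pose proof (semidirect_jee H) as J.
destruct H as [H1 [H2 H3]].
assert (Hq : is_regular_epi (copair i j)).
{ apply extremal_reg. intros M m g Hm Eg.
  apply (J M m (g ∘ in1 B X) (g ∘ in2 B X) Hm).
  - rw Eg. apply copair_in1.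
  - rw Eg. apply copair_in2. }
destruct (kernel_ex (copair i j)) as [N [n Hn]].
destruct (@flat_lift B X N n) as [n' Hn'].
{ rewrite <- Hp. ra. apply null_l, (kernel_null Hn). }
destruct (normal_epi (g := copair b a) Hq Hn) as [h Hh].
{ rewrite <- Hn'. rw <- E. apply null_l.
  apply (null_mono (kernel_mono H2)). rw H3. rewrite Hn'. apply (kernel_null Hn). }
exists h. rewrite <- (copair_in1 i j) at 1. rewrite <- (copair_in2 i j) at 2.
rewrite !comp_assoc, Hh. split; [apply copair_in1|apply copair_in2].
Qed.

Lemma semidirect_action (B X S : C) (xi : flat B X ~> X) (p : S ~> B) (i : B ~> S)
  (j : X ~> S) : is_semidirect xi p i j -> is_action xi.
Proof.
intros [H1 [H2 H3]]. pose proof (kernel_mono H2) as Hj. split.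
- apply Hj. rw H3. rewrite flat_unit_spec. apply copair_in2.
- apply Hj. rw H3. rw H3. rewrite flat_mult_spec, copair_flat, comp_assoc, comp_copair.
  rewrite copair_in1. f_equal. now rewrite comp_idr, H3.
Qed.

Lemma point_semidirect (B X S : C) (p : S ~> B) (i : B ~> S) (j : X ~> S) :
  p ∘ i = idm B -> is_kernel p j -> exists xi : flat B X ~> X, is_semidirect xi p i j.
Proof.
intros H1 H2. destruct (kernel_lift H2 (a := copair i j ∘ flat_ker B X)) as [xi Hxi].
{ rewrite comp_assoc, comp_copair, H1.
  rewrite (proj1 (is_null_zero _) (kernel_null H2)). apply flat_ker_null. }
exists xi. now split.
Qed.

(** The semi-direct product is the coequalizer [q] of the reflexive pair
    [f, g : B + B♭X ~> B + X], which imposes that [xi] is conjugation.  On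
    kernels over [B] the relation generated by [f, g] is covered by
    [B♭(B♭X)] with the two maps [flat_mult B X] and [flat_map 1 xi].  The action
    [xi] coequalizes them, so [xi] factors through the restriction of [q], and
    the kernel of the projection is [X] itself. *)
Lemma semidirect_ex (B X : C) (xi : flat B X ~> X) : is_action xi ->
  exists (S : C) (p : S ~> B) (i : B ~> S) (j : X ~> S), is_semidirect xi p i j.
Proof.
intros [Hu Hm].
set (f := copair (in1 B X) (flat_ker B X)). set (g := sum_map (idm B) xi).
(* [s] is a common section of [f] and [g] *)
set (s := sum_map (idm B) (flat_unit B X)).
assert (Fs : f ∘ s = idm _).
{ unfold f, s. rewrite copair_map, flat_unit_spec.
  apply sum_ext; ra; [rewrite copair_in1|rewrite copair_in2]; now ra. }
assert (Gs : g ∘ s = idm _).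
{ unfold g, s, sum_map at 1. rewrite copair_map. ra. rewrite Hu.
  apply sum_ext; ra; [rewrite copair_in1|rewrite copair_in2]; now ra. }
assert (Pf : sum_proj B X ∘ f = sum_proj B (flat B X)).
{ unfold f. rewrite comp_copair, flat_ker_zero. unfold sum_proj. now rewrite copair_in1. }
assert (Pg : sum_proj B X ∘ g = sum_proj B (flat B X)).
{ unfold g, sum_proj. rewrite copair_map. ra. now rewrite zero_mor_l. }
assert (F2 : f ∘ in2 _ _ = flat_ker B X) by apply copair_in2.
assert (G2 : g ∘ in2 _ _ = in2 B X ∘ xi) by apply copair_in2.
destruct (reflexive_coequalizer (iso_reg (iso_id _)) Fs Gs) as
  [I [Q [e [r1 [r2 [q [He [R1 [R2 [KP Hq]]]]]]]]]].
destruct (coeq_lift Hq (a := sum_proj B X)) as [p Hp]; [now rewrite Pf, Pg|].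
destruct (kernel_ex p) as [X' [j0 Hj0]]. pose proof (kernel_mono Hj0) as Mj0.
assert (Kx : q ∘ flat_ker B X = q ∘ (in2 B X ∘ xi)).
{ rewrite <- F2, <- G2, !comp_assoc. f_equal. apply Hq. }
destruct (kernel_lift Hj0 (a := q ∘ flat_ker B X)) as [q' Hq'].
{ rw Hp. apply flat_ker_null. }
destruct (kernel_lift Hj0 (a := q ∘ in2 B X)) as [j1 Hj1].
{ rw Hp. apply is_null_zero. apply copair_in2. }
assert (E1 : j1 ∘ xi = q').
{ apply Mj0. rw Hj1. now rewrite Hq', Kx. }
assert (RQ : is_regular_epi q') .
{ apply (@ep_stable C _ _ _ _ _ q j0 (flat_ker B X) q').
  - apply mk_pb; [easy|intros; now apply flat_ker_mono|].
    intros W a b Hab. destruct (@flat_lift B X W a) as [h Hh].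
    { rewrite <- Hp. ra. rewrite Hab, comp_assoc. apply null_r, (kernel_null Hj0). }
    exists h. split; [exact Hh|]. apply Mj0. rw Hq'. now rewrite Hh.
  - eexists _, _, _; exact Hq. }
assert (Rj1 : is_regular_epi j1) by (rewrite <- E1 in RQ; exact (reg_cancel RQ)).
destruct (ep_pullback q' q') as [R' [a [b KR]]].
destruct (coeq_lift (reg_coeq_kp RQ KR) (a := xi)) as [h Hh].
{ destruct (pb_lift KP (a := flat_ker B X ∘ a) (b := flat_ker B X ∘ b)) as [z [Z1 Z2]].
  { rewrite !comp_assoc, <- Hq'. ra. f_equal. apply KR. }
  destruct (ep_pullback e z) as [V [v [v' HV]]].
  assert (A1 : f ∘ v = flat_ker B X ∘ (a ∘ v')).
  { rewrite <- R1. ra. rw (proj1 HV). now rw Z1. }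
  assert (A2 : g ∘ v = flat_ker B X ∘ (b ∘ v')).
  { rewrite <- R2. ra. rw (proj1 HV). now rw Z2. }
  destruct (@flat_lift B _ V v) as [w Hw].
  { rewrite <- Pf. ra. rewrite A1, comp_assoc. apply null_r, flat_ker_null. }
  apply (reg_epi (ep_stable HV He)). ra.
  assert (B1 : a ∘ v' = flat_mult B X ∘ w).
  { apply flat_ker_mono. rewrite <- A1, <- Hw. rw (flat_mult_spec B X). easy. }
  assert (B2 : b ∘ v' = flat_map (idm B) xi ∘ w).
  { apply flat_ker_mono. rewrite <- A2, <- Hw. now rw (flat_map_spec (idm B) xi). }
  rewrite B1, B2. rewrite !comp_assoc. now rewrite Hm. }
assert (S1 : h ∘ j1 = idm X).
{ assert (T : h ∘ (j1 ∘ (xi ∘ flat_unit B X)) = xi ∘ flat_unit B X).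
  { rw E1. now rw Hh. }
  now rewrite Hu, comp_idr in T. }
assert (Ij : is_iso j1) by exact (reg_mono_iso Rj1 (split_mono S1)).
exists Q, p, (q ∘ in1 B X), (q ∘ in2 B X). split; [|split].
- rw Hp. apply copair_in1.
- rewrite <- Hj1. destruct Ij as [k [K1 K2]]. apply mk_kernel.
  + rewrite comp_assoc. apply null_r, (kernel_null Hj0).
  + apply mono_comp; [exact Mj0|exact (split_mono K1)].
  + intros W x Hx. destruct (kernel_lift Hj0 Hx) as [y <-].
    exists (k ∘ y). ra. now rw K2.
- ra. rewrite <- Kx. rewrite <- comp_copair. ra.
  replace (copair (in1 B X) (in2 B X)) with (idm (sum B X)); [now ra|].
  apply sum_ext; rewrite ?copair_in1, ?copair_in2; now ra.
Qed.

Lemma semidirect_pullback (A B X S W : C) (xi : flat B X ~> X) (p : S ~> B) (i : B ~> S)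
  (j : X ~> S) (u : A ~> B) (a : W ~> S) (b : W ~> A) (s : A ~> W) (k : X ~> W) :
  is_semidirect xi p i j -> is_pullback p u a b ->
  a ∘ s = i ∘ u -> b ∘ s = idm A -> a ∘ k = j -> is_null (b ∘ k) ->
  is_semidirect (pullback_action u xi) b s k.
Proof.
intros [H1 [H2 H3]] HP S1 S2 K1 K2. split; [exact S2|split].
- apply mk_kernel; [exact K2| |].
  + intros V x y E. apply (kernel_mono H2). rewrite <- K1. ra. now rewrite E.
  + intros V x Hx. destruct (kernel_lift H2 (a := a ∘ x)) as [y Hy].
    { rw (proj1 HP). now apply null_l. }
    exists y. apply (pb_ext HP); [now rw K1|].
    apply null_eq; [|exact Hx]. rewrite comp_assoc. now apply null_r.
- unfold pullback_action. apply (pb_ext HP).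
  + rw K1. rw H3. rewrite copair_flat. rewrite comp_assoc, comp_copair. now rewrite S1, K1, comp_idr.
  + apply null_eq.
    * rewrite comp_assoc. now apply null_r.
    * rewrite comp_assoc, comp_copair, S2.
      rewrite (proj1 (is_null_zero _) K2). apply flat_ker_null.
Qed.

Lemma pullback_is_action (A B X : C) (xi : flat B X ~> X) (u : A ~> B) :
  is_action xi -> is_action (pullback_action u xi).
Proof.
intros H. destruct (semidirect_ex H) as [S [p [i [j HS]]]].
pose proof HS as [H1 [H2 _]].
destruct (ep_pullback p u) as [W [a [b HP]]].
destruct (pb_lift HP (a := i ∘ u) (b := idm A)) as [s [S1 S2]].
{ rw H1. now ra. }
destruct (pb_lift HP (a := j) (b := zero_mor X A)) as [k [K1 K2]].
{ rewrite zero_mor_r. apply is_null_zero, (kernel_null H2). }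
apply (semidirect_action (semidirect_pullback HS HP S1 S2 K1 (proj2 (is_null_zero _) K2))).
Qed.

End SemiAbelianBasics.

(** * Precrossed modules as reflexive graphs *)

Section Graphs.
Context {C : SemiAbelian} {B : C}.

Lemma graph_of_jee (X : PXMod B) (X1 : C) (d c : X1 ~> B) (e : B ~> X1) (k : px_ob X ~> X1) :
  is_graph_of d c e k -> jointly_extremal_epi e k.
Proof. intros [H _]. exact (semidirect_jee H). Qed.

(** The codomain map [c] exists by the universal property of the semi-direct
    product: the precrossed condition is the compatibility of [px_bd X] with
    the action. *)
Lemma graph_of_ex (X : PXMod B) : exists (X1 : C) (d c : X1 ~> B) (e : B ~> X1)
  (k : px_ob X ~> X1), is_graph_of d c e k.
Proof.
destruct (semidirect_ex (px_is_action X)) as [S [p [i [j H]]]].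
destruct (semidirect_lift (b := idm B) (a := px_bd X) H) as [c [H1 H2]].
{ rewrite px_precrossed. unfold conj_action. ra. rewrite copair_flat. now ra. }
exists S, p, c, i, j. now split.
Qed.

Lemma graph_of_surj (G : C) (d c : G ~> B) (e : B ~> G) :
  d ∘ e = idm B -> c ∘ e = idm B ->
  exists (X : PXMod B) (k : px_ob X ~> G), is_graph_of d c e k.
Proof.
intros De Ce. destruct (kernel_ex d) as [K [k Hk]].
destruct (point_semidirect De Hk) as [xi H].
assert (P : (c ∘ k) ∘ xi = conj_action B ∘ flat_map (idm B) (c ∘ k)).
{ unfold conj_action. ra. rewrite copair_flat. rw (proj2 (proj2 H)).
  rewrite comp_assoc, comp_copair, Ce. now ra. }
exists (Build_PrecrossedModule (semidirect_action H) P), k. now split.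
Qed.

Lemma graph_of_mor (X Y : PXMod B) (X1 : C) (d c : X1 ~> B) (e : B ~> X1)
  (k : px_ob X ~> X1) (Y1 : C) (d' c' : Y1 ~> B) (e' : B ~> Y1) (k' : px_ob Y ~> Y1)
  (f : X ~> Y) :
  is_graph_of d c e k -> is_graph_of d' c' e' k' ->
  exists f1 : X1 ~> Y1, f1 ∘ k = k' ∘ px_map f /\ f1 ∘ e = e' /\ d' ∘ f1 = d /\ c' ∘ f1 = c.
Proof.
intros [H [H1 H2]] [H' [H1' H2']].
destruct (semidirect_lift (b := e') (a := k' ∘ px_map f) H) as [h [E1 E2]].
{ ra. rewrite px_map_act. rw (proj2 (proj2 H')). rewrite copair_flat. now ra. }
exists h. repeat split; auto.
- apply (jee_epi (semidirect_jee H)).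
  + rw E1. rewrite (proj1 H). apply H'.
  + rw E2. apply null_eq; [|exact (kernel_null (proj1 (proj2 H)))].
    rewrite comp_assoc. apply null_r, (kernel_null (proj1 (proj2 H'))).
- apply (jee_epi (semidirect_jee H)).
  + rw E1. now rewrite H1, H1'.
  + rw E2. rw H2'. rewrite H2. apply px_map_bd.
Qed.

Lemma graph_of_full (X Y : PXMod B) (X1 : C) (d c : X1 ~> B) (e : B ~> X1)
  (k : px_ob X ~> X1) (Y1 : C) (d' c' : Y1 ~> B) (e' : B ~> Y1) (k' : px_ob Y ~> Y1)
  (f1 : X1 ~> Y1) :
  is_graph_of d c e k -> is_graph_of d' c' e' k' ->
  f1 ∘ e = e' -> d' ∘ f1 = d -> c' ∘ f1 = c ->
  exists f : X ~> Y, f1 ∘ k = k' ∘ px_map f.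
Proof.
intros [H [H1 H2]] [H' [H1' H2']] E1 E2 E3.
pose proof (kernel_mono (proj1 (proj2 H'))) as M.
destruct (kernel_lift (proj1 (proj2 H')) (a := f1 ∘ k)) as [f Hf].
{ rw E2. apply (kernel_null (proj1 (proj2 H))). }
assert (F1 : px_bd Y ∘ f = px_bd X).
{ rewrite <- H2'. ra. rewrite Hf. rw E3. exact H2. }
assert (F2 : f ∘ px_act X = px_act Y ∘ flat_map (idm B) f).
{ apply M. rw Hf. rw (proj2 (proj2 H)). rw (proj2 (proj2 H')).
  rewrite copair_flat, Hf, comp_assoc, comp_copair, E1. now ra. }
exists (Build_PXHom F1 F2). now symmetry.
Qed.

Record Graph (X : PXMod B) := {
  graph_ob : C;
  graph_d : graph_ob ~> B;
  graph_c : graph_ob ~> B;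
  graph_e : B ~> graph_ob;
  graph_k : px_ob X ~> graph_ob;
  graph_spec : is_graph_of graph_d graph_c graph_e graph_k }.

(** The graph of [X], and below its domain, codomain and unit maps and the
    inclusion of [X] as the kernel of the domain map; [gm] is the functor. *)
Definition graph (X : PXMod B) : Graph X.
Proof.
apply (fun H => proj1_sig (constructive_indefinite_description (fun _ : Graph X => True) H)).
destruct (graph_of_ex X) as [X1 [d [c [e [k H]]]]].
now exists (Build_Graph H).
Qed.

Definition gr (X : PXMod B) : C := graph_ob (graph X).
Definition gd (X : PXMod B) : gr X ~> B := graph_d (graph X).
Definition gc (X : PXMod B) : gr X ~> B := graph_c (graph X).
Definition ge (X : PXMod B) : B ~> gr X := graph_e (graph X).
Definition gk (X : PXMod B) : px_ob X ~> gr X := graph_k (graph X).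
Definition gr_spec (X : PXMod B) : is_graph_of (gd X) (gc X) (ge X) (gk X) :=
  graph_spec (graph X).

Lemma gd_ge X : gd X ∘ ge X = idm B. Proof. apply gr_spec. Qed.
Lemma gc_ge X : gc X ∘ ge X = idm B. Proof. apply gr_spec. Qed.
Lemma gc_gk X : gc X ∘ gk X = px_bd X. Proof. apply gr_spec. Qed.
Lemma gk_kernel X : is_kernel (gd X) (gk X). Proof. apply gr_spec. Qed.
Lemma gk_jee X : jointly_extremal_epi (ge X) (gk X).
Proof. exact (graph_of_jee (gr_spec X)). Qed.
Lemma gd_gk X : is_null (gd X ∘ gk X).
Proof. apply kernel_null, gk_kernel. Qed.

Arguments gk_jee X : clear implicits.
Arguments gk_kernel X : clear implicits.
Arguments gd_gk X : clear implicits.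

Definition gm {X Y : PXMod B} (f : X ~> Y) : gr X ~> gr Y :=
  proj1_sig (constructive_indefinite_description _
    (graph_of_mor f (gr_spec X) (gr_spec Y))).

Lemma gm_spec {X Y : PXMod B} (f : X ~> Y) :
  gm f ∘ gk X = gk Y ∘ px_map f /\ gm f ∘ ge X = ge Y /\ gd Y ∘ gm f = gd X /\
  gc Y ∘ gm f = gc X.
Proof. unfold gm. apply proj2_sig. Qed.

Lemma gm_gk {X Y : PXMod B} (f : X ~> Y) : gm f ∘ gk X = gk Y ∘ px_map f.
Proof. apply gm_spec. Qed.
Lemma gm_ge {X Y : PXMod B} (f : X ~> Y) : gm f ∘ ge X = ge Y.
Proof. apply gm_spec. Qed.
Lemma gd_gm {X Y : PXMod B} (f : X ~> Y) : gd Y ∘ gm f = gd X.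
Proof. apply gm_spec. Qed.
Lemma gc_gm {X Y : PXMod B} (f : X ~> Y) : gc Y ∘ gm f = gc X.
Proof. apply gm_spec. Qed.

Lemma gm_inj {X Y : PXMod B} (f g : X ~> Y) : gm f = gm g -> f = g.
Proof.
intros E. apply PXHom_ext, (kernel_mono (gk_kernel Y)).
now rewrite <- !gm_gk, E.
Qed.

Lemma gm_id (X : PXMod B) : gm (idm X) = idm (gr X).
Proof.
apply (jee_epi (gk_jee X)).
- rewrite gm_ge. now ra.
- rewrite gm_gk, comp_idl. exact (comp_idr _).
Qed.

Lemma gm_comp {X Y Z : PXMod B} (g : Y ~> Z) (f : X ~> Y) : gm (g ∘ f) = gm g ∘ gm f.
Proof.
apply (jee_epi (gk_jee X)).
- ra. now rewrite !gm_ge.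
- ra. rewrite !gm_gk. rw (gm_gk g). reflexivity.
Qed.

Lemma gm_full {X Y : PXMod B} (h : gr X ~> gr Y) :
  h ∘ ge X = ge Y -> gd Y ∘ h = gd X -> gc Y ∘ h = gc X -> exists f : X ~> Y, gm f = h.
Proof.
intros E1 E2 E3. destruct (graph_of_full (gr_spec X) (gr_spec Y) E1 E2 E3) as [f Hf].
exists f. apply (jee_epi (gk_jee X)).
- now rewrite gm_ge.
- now rewrite gm_gk.
Qed.

Lemma graph_of_iso (X : PXMod B) (X1 : C) (d c : X1 ~> B) (e : B ~> X1)
  (k : px_ob X ~> X1) : is_graph_of d c e k ->
  exists (u : X1 ~> gr X) (v : gr X ~> X1), v ∘ u = idm X1 /\ u ∘ v = idm (gr X) /\
    u ∘ e = ge X /\ u ∘ k = gk X /\ gd X ∘ u = d /\ gc X ∘ u = c.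
Proof.
intros H.
destruct (graph_of_mor (idm X) H (gr_spec X)) as [u [U1 [U2 [U3 U4]]]].
destruct (graph_of_mor (idm X) (gr_spec X) H) as [v [V1 [V2 [V3 V4]]]].
assert (U1' : u ∘ k = gk X) by (rewrite U1; apply comp_idr).
assert (V1' : v ∘ gk X = k) by (rewrite V1; apply comp_idr).
exists u, v. repeat split; auto.
- apply (jee_epi (graph_of_jee H)).
  + rw U2. rewrite V2. now ra.
  + rw U1'. rewrite V1'. now ra.
- apply (jee_epi (gk_jee X)).
  + rw V2. rewrite U2. now ra.
  + rw V1'. rewrite U1'. now ra.
Qed.

Lemma gr_surj (G : C) (d c : G ~> B) (e : B ~> G) :
  d ∘ e = idm B -> c ∘ e = idm B ->
  exists (X : PXMod B) (u : G ~> gr X) (v : gr X ~> G), v ∘ u = idm G /\ u ∘ v = idm (gr X) /\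
    u ∘ e = ge X /\ gd X ∘ u = d /\ gc X ∘ u = c.
Proof.
intros De Ce. destruct (graph_of_surj De Ce) as [X [k H]].
destruct (graph_of_iso H) as [u [v [H1 [H2 [H3 [_ [H4 H5]]]]]]].
exists X, u, v. auto.
Qed.

Lemma gm_iso {X Y : PXMod B} (f : X ~> Y) : is_iso (gm f) <-> is_iso f.
Proof.
split.
- intros [h [H1 H2]]. destruct (gm_full (h := h)) as [g Hg].
  + rewrite <- (gm_ge f). rw H1. now ra.
  + rewrite <- (gd_gm f). ra. rw H2. now ra.
  + rewrite <- (gc_gm f). ra. rw H2. now ra.
  + exists g. split; apply gm_inj; now rewrite gm_comp, gm_id, Hg.
- intros [g [H1 H2]]. exists (gm g). now rewrite <- !gm_comp, H1, H2, !gm_id.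
Qed.

Lemma gm_reflects_pb {X Y Z P : PXMod B} (f : X ~> Z) (g : Y ~> Z) (p : P ~> X) (q : P ~> Y) :
  is_pullback (gm f) (gm g) (gm p) (gm q) -> is_pullback f g p q.
Proof.
intros H. apply mk_pb.
- apply gm_inj. rewrite !gm_comp. apply H.
- intros W a b E1 E2. apply gm_inj, (pb_ext H); now rewrite <- !gm_comp, ?E1, ?E2.
- intros W a b E. destruct (pb_lift H (a := gm a) (b := gm b)) as [h [H1 H2]].
  { now rewrite <- !gm_comp, E. }
  destruct (gm_full (h := h)) as [h' Hh].
  + apply (pb_ext H); [rw H1|rw H2]; now rewrite !gm_ge.
  + rewrite <- (gd_gm p). ra. rewrite H1. apply gd_gm.
  + rewrite <- (gc_gm p). ra. rewrite H1. apply gc_gm.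
  + exists h'. split; apply gm_inj; now rewrite gm_comp, Hh.
Qed.

(** The graph structure on the pullback is inherited from either factor; the
    choice is immaterial as [f] and [g] preserve domains and codomains. *)
Lemma px_pullback_ex {X Y Z : PXMod B} (f : X ~> Z) (g : Y ~> Z) :
  exists (P : PXMod B) (p : P ~> X) (q : P ~> Y),
    is_pullback f g p q /\ is_pullback (gm f) (gm g) (gm p) (gm q).
Proof.
destruct (ep_pullback (gm f) (gm g)) as [G [p [q H]]].
destruct (pb_lift H (a := ge X) (b := ge Y)) as [e [E1 E2]].
{ now rewrite !gm_ge. }
assert (Ed : gd X ∘ p = gd Y ∘ q).
{ rewrite <- (gd_gm f), <- (gd_gm g). ra. f_equal. apply H. }
assert (Ec : gc X ∘ p = gc Y ∘ q).
{ rewrite <- (gc_gm f), <- (gc_gm g). ra. f_equal. apply H. }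
destruct (@gr_surj G (gd X ∘ p) (gc X ∘ p) e) as [P [u [v [V1 [V2 [V3 [V4 V5]]]]]]].
{ ra. rewrite E1. apply gd_ge. }
{ ra. rewrite E1. apply gc_ge. }
assert (Ve : v ∘ ge P = e).
{ rewrite <- V3. rw V1. now ra. }
destruct (gm_full (X := P) (Y := X) (h := p ∘ v)) as [p' Hp].
{ ra. now rewrite Ve. } { rw <- V4. rw V2. now ra. } { rw <- V5. rw V2. now ra. }
destruct (gm_full (X := P) (Y := Y) (h := q ∘ v)) as [q' Hq].
{ ra. now rewrite Ve. } { rw <- Ed. rw <- V4. rw V2. now ra. }
{ rw <- Ec. rw <- V5. rw V2. now ra. }
assert (HP : is_pullback (gm f) (gm g) (gm p') (gm q')).
{ rewrite Hp, Hq. apply pb_along_iso; [exact H|now exists u]. }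
exists P, p', q'. split; [exact (gm_reflects_pb HP)|exact HP].
Qed.

Lemma gm_pb {X Y Z P : PXMod B} {f : X ~> Z} {g : Y ~> Z} {p : P ~> X} {q : P ~> Y} :
  is_pullback f g p q -> is_pullback (gm f) (gm g) (gm p) (gm q).
Proof.
intros H. destruct (px_pullback_ex f g) as [P' [p' [q' [H1 H2]]]].
destruct (pb_iso H1 H) as [h [h' [E1 [E2 [<- <-]]]]].
rewrite !gm_comp. apply pb_along_iso; [exact H2|]. apply gm_iso. now exists h'.
Qed.

Lemma gm_mono {X Y : PXMod B} (f : X ~> Y) : is_mono f -> is_mono (gm f).
Proof.
intros M.
assert (H : is_pullback f f (idm X) (idm X)).
{ apply mk_pb; [easy| |].
  - intros W a b. rewrite !comp_idl. easy.
  - intros W a b E. exists a. rewrite !comp_idl. split; [easy|now apply M]. }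
apply gm_pb in H. rewrite gm_id in H. intros W a b E.
destruct (pb_lift H E) as [h [H1 H2]]. congruence.
Qed.

Lemma gm_reflects_coeq {R X Q : PXMod B} (f g : R ~> X) (q : X ~> Q) :
  is_coequalizer (gm f) (gm g) (gm q) -> is_coequalizer f g q.
Proof.
intros H. pose proof (coeq_epi H) as Ep. apply mk_coeq.
- apply gm_inj. rewrite !gm_comp. apply H.
- intros W a b E. apply gm_inj, Ep. now rewrite <- !gm_comp, E.
- intros W a E. destruct (coeq_lift H (a := gm a)) as [h Hh].
  { now rewrite <- !gm_comp, E. }
  destruct (gm_full (h := h)) as [h' Hh'].
  + rewrite <- (gm_ge q). rw Hh. apply gm_ge.
  + apply Ep. ra. rewrite Hh. now rewrite !gd_gm.
  + apply Ep. ra. rewrite Hh. now rewrite !gc_gm.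
  + exists h'. apply gm_inj. now rewrite gm_comp, Hh'.
Qed.

Lemma px_coequalizer_ex {R X : PXMod B} (f g : R ~> X) :
  exists (Q : PXMod B) (q : X ~> Q), is_coequalizer (gm f) (gm g) (gm q).
Proof.
destruct (coequalizer_ex (gm f) (gm g)) as [G [q H]].
destruct (coeq_lift H (a := gd X)) as [d Hd]; [now rewrite !gd_gm|].
destruct (coeq_lift H (a := gc X)) as [c Hc]; [now rewrite !gc_gm|].
destruct (@gr_surj G d c (q ∘ ge X)) as [Q [u [v [V1 [V2 [V3 [V4 V5]]]]]]].
{ rw Hd. apply gd_ge. } { rw Hc. apply gc_ge. }
destruct (gm_full (X := X) (Y := Q) (h := u ∘ q)) as [q' Hq].
{ now ra. } { now rw V4. } { now rw V5. }
exists Q, q'. rewrite Hq. apply mk_coeq.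
- ra. now rewrite (proj1 H).
- intros W a b E. rewrite <- (comp_idr a), <- (comp_idr b), <- V2, !comp_assoc. f_equal.
  apply (coeq_epi H). now ra.
- intros W a E. destruct (coeq_lift H E) as [h Hh]. exists (h ∘ v). ra. now rw V1.
Qed.

Lemma coeq_unique {D : Category} {R X Q Q' : D} {f g : R ~> X} {q : X ~> Q} {q' : X ~> Q'} :
  is_coequalizer f g q -> is_coequalizer f g q' -> exists h, is_iso h /\ h ∘ q = q'.
Proof.
intros H H'. destruct (coeq_lift H (proj1 H')) as [h Hh].
destruct (coeq_lift H' (proj1 H)) as [h' Hh'].
exists h. split; [|exact Hh]. exists h'. split.
- apply (coeq_epi H). ra. rewrite Hh, Hh'. now ra.
- apply (coeq_epi H'). ra. rewrite Hh', Hh. now ra.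
Qed.

Lemma gm_reg {X Y : PXMod B} (q : X ~> Y) : is_regular_epi (gm q) <-> is_regular_epi q.
Proof.
split.
- intros H. destruct (px_pullback_ex q q) as [E [p1 [p2 [K1 K2]]]].
  exists E, p1, p2. apply gm_reflects_coeq. exact (reg_coeq_kp H K2).
- intros [R [f [g H]]]. destruct (px_coequalizer_ex f g) as [Q [q' H']].
  destruct (coeq_unique (gm_reflects_coeq H') H) as [h [Ih <-]].
  rewrite gm_comp. apply reg_comp_iso; [now apply gm_iso|].
  now exists (gr R), (gm f), (gm g).
Qed.

Lemma px_pushout_ex {Z X Y : PXMod B} (f : Z ~> X) (g : Z ~> Y) :
  exists (Q : PXMod B) (i : X ~> Q) (j : Y ~> Q), is_pushout f g i j.
Proof.
destruct (pushout_ex (gm f) (gm g)) as [G [i [j [E U]]]].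
destruct (U _ (gd X) (gd Y)) as [d [[D1 D2] _]]; [now rewrite !gd_gm|].
destruct (U _ (gc X) (gc Y)) as [c [[C1 C2] _]]; [now rewrite !gc_gm|].
assert (Eg : i ∘ ge X = j ∘ ge Y).
{ rewrite <- (gm_ge f), <- (gm_ge g), !comp_assoc. now rewrite E. }
destruct (@gr_surj G d c (i ∘ ge X)) as [Q [u [v [V1 [V2 [V3 [V4 V5]]]]]]].
{ rw D1. apply gd_ge. } { rw C1. apply gc_ge. }
destruct (gm_full (X := X) (Y := Q) (h := u ∘ i)) as [i' Hi].
{ now ra. } { now rw V4. } { now rw V5. }
destruct (gm_full (X := Y) (Y := Q) (h := u ∘ j)) as [j' Hj].
{ ra. now rewrite <- Eg. } { now rw V4. } { now rw V5. }
exists Q, i', j'. split.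
- apply gm_inj. rewrite !gm_comp, Hi, Hj. ra. now rewrite E.
- intros W a b Hab.
  destruct (U _ (gm a) (gm b)) as [h [[H1 H2] Hu]]; [now rewrite <- !gm_comp, Hab|].
  destruct (gm_full (X := Q) (Y := W) (h := h ∘ v)) as [h' Hh].
  + rewrite <- V3. ra. rw V1. rw H1. apply gm_ge.
  + assert (T : gd W ∘ h = d).
    { destruct (U _ (gd X) (gd Y)) as [x [_ Ux]]; [now rewrite !gd_gm|].
      transitivity x; [symmetry|]; apply Ux; auto.
      split; ra; rewrite ?H1, ?H2; apply gd_gm. }
    rw T. rewrite <- V4. ra. rewrite V2. now ra.
  + assert (T : gc W ∘ h = c).
    { destruct (U _ (gc X) (gc Y)) as [x [_ Ux]]; [now rewrite !gc_gm|].
      transitivity x; [symmetry|]; apply Ux; auto.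
      split; ra; rewrite ?H1, ?H2; apply gc_gm. }
    rw T. rewrite <- V5. ra. rewrite V2. now ra.
  + exists h'. split.
    * split; apply gm_inj; rewrite gm_comp, Hh, ?Hi, ?Hj; ra; now rw V1.
    * intros h2 [E1 E2]. apply gm_inj. rewrite Hh.
      rewrite (Hu (gm h2 ∘ u)).
      -- ra. rewrite V2. now ra.
      -- rewrite <- E1, <- E2, !gm_comp, Hi, Hj. now ra.
Qed.

(** The initial graph is [B] with identity structure maps. *)
Lemma ge_iso_initial (O : PXMod B) : ge O ∘ gd O = idm (gr O) -> is_initial O.
Proof.
intros E X.
assert (Edc : gc O = gd O).
{ rewrite <- (comp_idr (gc O)), <- E. rw (gc_ge O). now ra. }
destruct (gm_full (X := O) (Y := X) (h := ge X ∘ gd O)) as [f Hf].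
- ra. rewrite gd_ge. now ra.
- rw (gd_ge X). now ra.
- rw (gc_ge X). now rewrite Edc.
- exists f. split; [easy|]. intros f' _. apply gm_inj. rewrite Hf.
  rewrite <- (comp_idr (gm f')), <- E. rw (gm_ge f'). now ra.
Qed.

Lemma px_initial_ex : exists O : PXMod B, is_initial O.
Proof.
destruct (@gr_surj B (idm B) (idm B) (idm B)) as [O [u [v [V1 [V2 [V3 [V4 V5]]]]]]];
  try apply comp_idl.
exists O. apply ge_iso_initial. rewrite comp_idr in V3. rewrite <- V3, <- V2. f_equal.
rewrite <- (comp_idr (gd O)), <- V2. rw V4. easy.
Qed.

Lemma initial_ge_iso (O : PXMod B) : is_initial O -> ge O ∘ gd O = idm (gr O).
Proof.
intros H. destruct px_initial_ex as [O' H'].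
destruct (@gr_surj B (idm B) (idm B) (idm B)) as [O1 [u [v [V1 [V2 [V3 [V4 V5]]]]]]];
  try apply comp_idl.
destruct (initial_ex H O1) as [a _].
rewrite comp_idr in V3.
destruct (gm_full (X := O1) (Y := O) (h := ge O ∘ v)) as [b Hb].
- rewrite <- V3. ra. rewrite V1. now ra.
- rw (gd_ge O). rewrite <- (comp_idr (gd O1)), <- V2. rw V4. now ra.
- rw (gc_ge O). rewrite <- (comp_idr (gc O1)), <- V2. rw V5. now ra.
- assert (E : b ∘ a = idm O) by apply (initial_eq H).
  rewrite <- gm_id, <- E, gm_comp, Hb. ra. f_equal.
  rewrite <- (gd_gm a). rewrite <- (comp_idr (gd O1)), <- V2. rw V4. now ra.
Qed.

(** A null morphism sends each arrow to the unit at its domain, which is then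
    also its codomain; kernels are therefore graphs with equal domain and
    codomain maps. *)
Lemma null_gm {X Y : PXMod B} (f : X ~> Y) : is_null f -> gm f = ge Y ∘ gd X.
Proof.
intros [O [o [t [H ->]]]]. rewrite gm_comp.
rewrite <- (comp_idl (gm t)), <- (initial_ge_iso H). ra. rewrite gd_gm. rw (gm_ge o). easy.
Qed.

Lemma gm_null_dc {X Y : PXMod B} (f : X ~> Y) : gm f = ge Y ∘ gd X -> gd X = gc X.
Proof.
intros H. rewrite <- (gc_gm f), H. rw (gc_ge Y). now ra.
Qed.

Lemma null_dc {X Y : PXMod B} (f : X ~> Y) : is_null f -> gd X = gc X.
Proof. intros H. exact (gm_null_dc (null_gm H)). Qed.

Lemma gm_null {X Y : PXMod B} (f : X ~> Y) : gm f = ge Y ∘ gd X -> is_null f.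
Proof.
intros H. destruct px_initial_ex as [O HO].
destruct (gm_full (X := X) (Y := O) (h := ge O ∘ gd X)) as [t Ht].
- ra. rewrite gd_ge. now ra.
- rw (gd_ge O). now ra.
- rw (gc_ge O). ra. exact (gm_null_dc H).
- destruct (initial_ex HO Y) as [o _]. exists O, o, t. split; [exact HO|].
  apply gm_inj. rewrite gm_comp, H, Ht. now rw (gm_ge o).
Qed.

Lemma px_initial_sub (O W : PXMod B) (a b : W ~> O) : is_initial O -> a = b.
Proof.
intros H. apply gm_inj.
rewrite <- (comp_idl (gm a)), <- (comp_idl (gm b)), <- (initial_ge_iso H). ra.
now rewrite !gd_gm.
Qed.

Lemma px_terminal_ex : exists T : PXMod B, is_terminal T.
Proof.
destruct (prod_ex B B) as [P [p [q [U L]]]].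
destruct (L B (idm B) (idm B)) as [e [E1 E2]].
destruct (@gr_surj P p q e E1 E2) as [T [u [v [V1 [V2 [V3 [V4 V5]]]]]]].
assert (Vd : p ∘ v = gd T). { rewrite <- V4. ra. rewrite V2. now ra. }
assert (Vc : q ∘ v = gc T). { rewrite <- V5. ra. rewrite V2. now ra. }
exists T. intros X.
destruct (L (gr X) (gd X) (gc X)) as [h [H1 H2]].
destruct (gm_full (X := X) (Y := T) (h := u ∘ h)) as [f Hf].
- rewrite <- V3. ra. f_equal. apply U.
  + rw H1. now rewrite gd_ge, E1.
  + rw H2. now rewrite gc_ge, E2.
- now rw V4.
- now rw V5.
- exists f. split; [easy|]. intros f' _. apply gm_inj.
  rewrite <- (comp_idl (gm f)), <- (comp_idl (gm f')), <- V2. ra. f_equal.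
  apply U; [rw Vd; rw Vd|rw Vc; rw Vc]; now rewrite ?gd_gm, ?gc_gm.
Qed.

Global Instance px_exact : ExactProtomodular (PXMod B).
Proof.
constructor.
- exact px_initial_ex.
- intros O W a b H. exact (px_initial_sub a b H).
- exact px_terminal_ex.
- intros X Y Z f g. destruct (px_pullback_ex f g) as [P [p [q [H _]]]]. now exists P, p, q.
- intros E X Y f p1 p2 _. destruct (px_coequalizer_ex p1 p2) as [Q [q H]].
  exists Q, q. exact (gm_reflects_coeq H).
- intros X Y Z P f g p q H Hf. apply gm_reg. apply (ep_stable (gm_pb H)). now apply gm_reg.
- intros R X r1 r2 [U [Rf _]].
  destruct (Rf X (idm X)) as [d [D1 D2]].
  (* [gm] preserves the monomorphism [m] into the product of [X] with itself,
     so that [gm r1] and [gm r2] are jointly monic *)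
  destruct px_terminal_ex as [T HT].
  destruct (HT X) as [x _].
  destruct (px_pullback_ex x x) as [P [p [q [HP _]]]].
  destruct (pb_lift HP (a := r1) (b := r2)) as [m [M1 M2]].
  { destruct (HT R) as [y [_ Uy]]. transitivity y; [symmetry|]; now apply Uy. }
  assert (Hm : is_mono m).
  { intros W a b E. apply U; rewrite <- ?M1, <- ?M2; ra; now rewrite E. }
  assert (UC : forall (W : C) (a b : W ~> gr R),
    gm r1 ∘ a = gm r1 ∘ b -> gm r2 ∘ a = gm r2 ∘ b -> a = b).
  { intros W a b E1 E2. apply (gm_mono Hm). apply (pb_ext (gm_pb HP)).
    - rewrite !comp_assoc, <- gm_comp, M1. exact E1.
    - rewrite !comp_assoc, <- gm_comp, M2. exact E2. }
  destruct (@ep_effective C _ (gr R) (gr X) (gm r1) (gm r2)) as [Y [h K]].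
  { apply (reflexive_equivalence (d := gm d) UC); now rewrite <- gm_comp, ?D1, ?D2, gm_id. }
  destruct (px_coequalizer_ex r1 r2) as [Q [q' Hq]].
  destruct (coeq_lift Hq (proj1 K)) as [h' Hh].
  exists Q, q'. apply gm_reflects_pb. apply mk_pb.
  + apply Hq.
  + exact UC.
  + intros W a b E. apply (pb_lift K). rewrite <- Hh. ra. now rewrite E.
- intros Y Y' v A p s A' p' s' h W a q E E' H1 H2 P P'.
  apply gm_iso.
  apply (@ep_protomodular C _ _ _ (gm v) _ (gm p) (gm s) _ (gm p') (gm s') (gm h) _ (gm a) (gm q)).
  + now rewrite <- gm_comp, E, gm_id.
  + now rewrite <- gm_comp, E', gm_id.
  + now rewrite <- gm_comp, H1.
  + now rewrite <- gm_comp, H2.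
  + exact (gm_pb P).
  + rewrite <- gm_comp. exact (gm_pb P').
Qed.

Lemma kernel_dc {K X Y : PXMod B} {f : X ~> Y} {k : K ~> X} : is_kernel f k -> gd K = gc K.
Proof. intros H. exact (null_dc (kernel_null H)). Qed.

(** Read in the semi-abelian category, the kernel of [f] consists of the arrows
    that [f] sends to a unit. *)
Lemma gm_kernel {K X Y : PXMod B} {f : X ~> Y} {k : K ~> X} :
  is_kernel f k -> is_pullback (gm f) (ge Y) (gm k) (gd K).
Proof.
intros H. pose proof (null_gm (kernel_null H)) as E. rewrite gm_comp in E.
pose proof (gm_mono (kernel_mono H)) as M.
destruct H as [O [o [t [HO HP]]]]. apply gm_pb in HP. apply mk_pb.
- exact E.
- intros W a b E1 _. exact (M _ _ _ E1).
- intros W a b Eab. destruct (pb_lift HP (a := a) (b := ge O ∘ b)) as [h [H1 H2]].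
  { now rw (gm_ge o). }
  exists h. split; [exact H1|]. rewrite <- (gd_gm t). ra. rewrite H2.
  rw (gd_ge O). now ra.
Qed.

End Graphs.

Arguments gk_jee {C B} X.
Arguments gk_kernel {C B} X.
Arguments gd_gk {C B} X.

(** * Cooperation of morphisms *)

Section Pairing.
Context {C : SemiAbelian}.

(** Stated without the hypothesis that [u] and [v] are compatible, so that
    the pairing [pb_pair f g u v] does not depend on a proof and can be rewritten
    under. *)
Lemma pb_pair_ex (X Y Z V : C) (f : X ~> Z) (g : Y ~> Z) (u : V ~> X) (v : V ~> Y) :
  exists h : V ~> pb f g, f ∘ u = g ∘ v -> pb1 f g ∘ h = u /\ pb2 f g ∘ h = v.
Proof.
destruct (classic (f ∘ u = g ∘ v)) as [E|N].
- destruct (pb_lift (pb_pullback f g) E) as [h H]. now exists h.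
- exists (zero_mor V (pb f g)). intros E. now destruct N.
Qed.

Definition pb_pair {X Y Z V : C} (f : X ~> Z) (g : Y ~> Z) (u : V ~> X) (v : V ~> Y) :
  V ~> pb f g :=
  proj1_sig (constructive_indefinite_description _ (pb_pair_ex f g u v)).

Lemma pb_pair_spec {X Y Z V : C} {f : X ~> Z} {g : Y ~> Z} {u : V ~> X} {v : V ~> Y} :
  f ∘ u = g ∘ v -> pb1 f g ∘ pb_pair f g u v = u /\ pb2 f g ∘ pb_pair f g u v = v.
Proof. exact (proj2_sig (constructive_indefinite_description _ (pb_pair_ex f g u v))). Qed.

Lemma pb_pair1 {X Y Z V : C} {f : X ~> Z} {g : Y ~> Z} {u : V ~> X} {v : V ~> Y} :
  f ∘ u = g ∘ v -> pb1 f g ∘ pb_pair f g u v = u.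
Proof. intros E. apply (pb_pair_spec E). Qed.

Lemma pb_pair2 {X Y Z V : C} {f : X ~> Z} {g : Y ~> Z} {u : V ~> X} {v : V ~> Y} :
  f ∘ u = g ∘ v -> pb2 f g ∘ pb_pair f g u v = v.
Proof. intros E. apply (pb_pair_spec E). Qed.

Lemma pb12 {X Y Z : C} (f : X ~> Z) (g : Y ~> Z) : f ∘ pb1 f g = g ∘ pb2 f g.
Proof. apply pb_pullback. Qed.

Lemma pb_pair_ext {X Y Z V : C} {f : X ~> Z} {g : Y ~> Z} (a b : V ~> pb f g) :
  pb1 f g ∘ a = pb1 f g ∘ b -> pb2 f g ∘ a = pb2 f g ∘ b -> a = b.
Proof. apply (pb_ext (pb_pullback f g)). Qed.

Lemma pb_pair_eq {X Y Z V : C} {f : X ~> Z} {g : Y ~> Z} (h : V ~> pb f g) {u : V ~> X}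
  {v : V ~> Y} : pb1 f g ∘ h = u -> pb2 f g ∘ h = v -> h = pb_pair f g u v.
Proof.
intros H1 H2.
assert (E : f ∘ u = g ∘ v) by (rewrite <- H1, <- H2; rw (pb12 f g); easy).
apply pb_pair_ext; [rewrite (pb_pair1 E)|rewrite (pb_pair2 E)]; easy.
Qed.

Lemma pb_pair_comp {X Y Z V W : C} {f : X ~> Z} {g : Y ~> Z} {u : V ~> X} {v : V ~> Y}
  (w : W ~> V) : f ∘ u = g ∘ v -> pb_pair f g u v ∘ w = pb_pair f g (u ∘ w) (v ∘ w).
Proof. intros E. apply pb_pair_eq; [rw (pb_pair1 E)|rw (pb_pair2 E)]; easy. Qed.

End Pairing.

(** The object of composable pairs [(x, y)] with the domain of [x] equal to the
    codomain of [y]; [inl_comp] and [inr_comp] send [x] to [(x, 1)] and [y] to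
    [(1, y)]. *)
Notation composables X Y := (pb (gd X) (gc Y)).

Section Cooperation.
Context {C : SemiAbelian} {B : C}.

Definition inl_comp (X Y : PXMod B) : gr X ~> composables X Y :=
  pb_pair (gd X) (gc Y) (idm (gr X)) (ge Y ∘ gd X).
Definition inr_comp (X Y : PXMod B) : gr Y ~> composables X Y :=
  pb_pair (gd X) (gc Y) (ge X ∘ gc Y) (idm (gr Y)).

Lemma inl_ok (X Y : PXMod B) : gd X ∘ idm (gr X) = gc Y ∘ (ge Y ∘ gd X).
Proof. rw (gc_ge Y). now ra. Qed.
Lemma inr_ok (X Y : PXMod B) : gd X ∘ (ge X ∘ gc Y) = gc Y ∘ idm (gr Y).
Proof. rw (gd_ge X). now ra. Qed.

Lemma inl1 (X Y : PXMod B) : pb1 (gd X) (gc Y) ∘ inl_comp X Y = idm (gr X).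
Proof. apply pb_pair1, inl_ok. Qed.
Lemma inl2 (X Y : PXMod B) : pb2 (gd X) (gc Y) ∘ inl_comp X Y = ge Y ∘ gd X.
Proof. apply pb_pair2, inl_ok. Qed.
Lemma inr1 (X Y : PXMod B) : pb1 (gd X) (gc Y) ∘ inr_comp X Y = ge X ∘ gc Y.
Proof. apply pb_pair1, inr_ok. Qed.
Lemma inr2 (X Y : PXMod B) : pb2 (gd X) (gc Y) ∘ inr_comp X Y = idm (gr Y).
Proof. apply pb_pair2, inr_ok. Qed.

Lemma comp_jee (X Y : PXMod B) : jointly_extremal_epi (inl_comp X Y) (inr_comp X Y).
Proof.
apply (pb_jee (s := ge X) (gc_ge Y) (pb_pullback (gd X) (gc Y))).
- apply inl1. - apply inl2. - apply inr1. - apply inr2.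
Qed.
Arguments comp_jee : clear implicits.

(** An operation on composable pairs with [(x, 1)] sent to [a x] and [(1, y)] to
    [b y].  For [a] and [b] the identity of [Z] this is a composition making the
    graph of [Z] an internal category. *)
Definition cooperate {X Y Z : PXMod B} (a : X ~> Z) (b : Y ~> Z) :=
  exists m : composables X Y ~> gr Z, m ∘ inl_comp X Y = gm a /\ m ∘ inr_comp X Y = gm b.

Lemma coop_gd {X Y Z : PXMod B} {a : X ~> Z} {b : Y ~> Z} (m : composables X Y ~> gr Z) :
  m ∘ inl_comp X Y = gm a -> m ∘ inr_comp X Y = gm b ->
  gd Z ∘ m = gd Y ∘ pb2 (gd X) (gc Y).
Proof.
intros H1 H2. apply (jee_epi (comp_jee X Y)).
- ra. rewrite H1, inl2, gd_gm. rw (gd_ge Y). now ra.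
- ra. rewrite H2, inr2, gd_gm. now ra.
Qed.

Lemma coop_gc {X Y Z : PXMod B} {a : X ~> Z} {b : Y ~> Z} (m : composables X Y ~> gr Z) :
  m ∘ inl_comp X Y = gm a -> m ∘ inr_comp X Y = gm b ->
  gc Z ∘ m = gc X ∘ pb1 (gd X) (gc Y).
Proof.
intros H1 H2. apply (jee_epi (comp_jee X Y)).
- ra. rewrite H1, inl1, gc_gm. now ra.
- ra. rewrite H2, inr1, gc_gm. rw (gc_ge X). now ra.
Qed.

Lemma coop_post {X Y Z Z' : PXMod B} (g : Z ~> Z') (a : X ~> Z) (b : Y ~> Z) :
  cooperate a b -> cooperate (g ∘ a) (g ∘ b).
Proof.
intros [m [H1 H2]]. exists (gm g ∘ m). ra. now rewrite H1, H2, !gm_comp.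
Qed.

Definition comp_map {X X' Y Y' : PXMod B} (x : X' ~> X) (y : Y' ~> Y) :
  composables X' Y' ~> composables X Y :=
  pb_pair (gd X) (gc Y) (gm x ∘ pb1 (gd X') (gc Y')) (gm y ∘ pb2 (gd X') (gc Y')).

Lemma comp_map_ok {X X' Y Y' : PXMod B} (x : X' ~> X) (y : Y' ~> Y) :
  gd X ∘ (gm x ∘ pb1 (gd X') (gc Y')) = gc Y ∘ (gm y ∘ pb2 (gd X') (gc Y')).
Proof. rw (gd_gm x). rw (gc_gm y). apply pb12. Qed.

Lemma comp_map1 {X X' Y Y' : PXMod B} (x : X' ~> X) (y : Y' ~> Y) :
  pb1 (gd X) (gc Y) ∘ comp_map x y = gm x ∘ pb1 (gd X') (gc Y').
Proof. apply pb_pair1, comp_map_ok. Qed.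
Lemma comp_map2 {X X' Y Y' : PXMod B} (x : X' ~> X) (y : Y' ~> Y) :
  pb2 (gd X) (gc Y) ∘ comp_map x y = gm y ∘ pb2 (gd X') (gc Y').
Proof. apply pb_pair2, comp_map_ok. Qed.

Lemma comp_map_inl {X X' Y Y' : PXMod B} (x : X' ~> X) (y : Y' ~> Y) :
  comp_map x y ∘ inl_comp X' Y' = inl_comp X Y ∘ gm x.
Proof.
apply pb_pair_ext.
- rw (comp_map1 x y). rw (inl1 X Y). rw (inl1 X' Y'). easy.
- rw (comp_map2 x y). rw (inl2 X Y). rw (inl2 X' Y'). rw (gm_ge y). now rw (gd_gm x).
Qed.

Lemma comp_map_inr {X X' Y Y' : PXMod B} (x : X' ~> X) (y : Y' ~> Y) :
  comp_map x y ∘ inr_comp X' Y' = inr_comp X Y ∘ gm y.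
Proof.
apply pb_pair_ext.
- rw (comp_map1 x y). rw (inr1 X Y). rw (inr1 X' Y'). rw (gm_ge x). now rw (gc_gm y).
- rw (comp_map2 x y). rw (inr2 X Y). rw (inr2 X' Y'). easy.
Qed.

Lemma coop_pre {X X' Y Y' Z : PXMod B} (a : X ~> Z) (b : Y ~> Z) (x : X' ~> X) (y : Y' ~> Y) :
  cooperate a b -> cooperate (a ∘ x) (b ∘ y).
Proof.
intros [m [H1 H2]]. exists (m ∘ comp_map x y). ra.
rewrite comp_map_inl, comp_map_inr, !comp_assoc, H1, H2, !gm_comp. easy.
Qed.

(** If [b] is null then every arrow of [Y] is an endomorphism and is sent to
    a unit, so the operation can ignore the second component. *)
Lemma coop_null_r {X Y Z : PXMod B} (a : X ~> Z) (b : Y ~> Z) : is_null b -> cooperate a b.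
Proof.
intros Hb. exists (gm a ∘ pb1 (gd X) (gc Y)). split.
- rw (inl1 X Y). easy.
- rw (inr1 X Y). rw (gm_ge a). rewrite (null_gm Hb). now rewrite (null_dc Hb).
Qed.

Lemma coop_null_l {X Y Z : PXMod B} (a : X ~> Z) (b : Y ~> Z) : is_null a -> cooperate a b.
Proof.
intros Ha. exists (gm b ∘ pb2 (gd X) (gc Y)). split.
- rw (inl2 X Y). rw (gm_ge b). now rewrite (null_gm Ha).
- now rw (inr2 X Y).
Qed.

Lemma coop_pullback {X Y Z P X' Y' : PXMod B} {f : X ~> Z} {g : Y ~> Z} {p : P ~> X}
  {q : P ~> Y} {a : X' ~> P} {b : Y' ~> P} :
  is_pullback f g p q -> cooperate (p ∘ a) (p ∘ b) -> cooperate (q ∘ a) (q ∘ b) ->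
  cooperate a b.
Proof.
intros H [m [M1 M2]] [n [N1 N2]]. pose proof (gm_pb H) as G.
rewrite gm_comp in M1; rewrite gm_comp in M2; rewrite gm_comp in N1; rewrite gm_comp in N2.
destruct (pb_lift G (a := m) (b := n)) as [h [H1 H2]].
{ apply (jee_epi (comp_jee X' Y')).
  - ra. rewrite M1, N1. now rw (proj1 G).
  - ra. rewrite M2, N2. now rw (proj1 G). }
exists h. split; apply (pb_ext G); [rw H1|rw H2|rw H1|rw H2]; easy.
Qed.

Lemma comp_map_reg_r {X Y Y' : PXMod B} (y : Y' ~> Y) :
  is_regular_epi y -> is_regular_epi (comp_map (idm X) y).
Proof.
intros Hy. set (w := comp_map (idm X) y).
apply (@ep_stable C _ _ _ _ _ (gm y) (pb2 (gd X) (gc Y)) (pb2 (gd X) (gc Y')) w).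
- apply mk_pb.
  + unfold w. now rewrite comp_map2.
  + intros W u v E1 E2. apply pb_pair_ext; [|exact E1].
    rewrite <- (comp_idl (pb1 (gd X) (gc Y'))), <- gm_id, <- (comp_map1 _ y). ra.
    fold w. now rewrite E2.
  + intros W u v E. exists (pb_pair (gd X) (gc Y') (pb1 (gd X) (gc Y) ∘ v) u).
    assert (E' : gd X ∘ (pb1 (gd X) (gc Y) ∘ v) = gc Y' ∘ u).
    { rw (pb12 (gd X) (gc Y)). rewrite <- E. now rw (gc_gm y). }
    split; [exact (pb_pair2 E')|]. apply pb_pair_ext; unfold w.
    * rw (comp_map1 (idm X) y). rewrite (pb_pair1 E'), gm_id. now ra.
    * rw (comp_map2 (idm X) y). now rewrite (pb_pair2 E').
- now apply gm_reg.
Qed.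

Lemma comp_map_reg_l {X X' Y : PXMod B} (x : X' ~> X) :
  is_regular_epi x -> is_regular_epi (comp_map x (idm Y)).
Proof.
intros Hx. set (w := comp_map x (idm Y)).
apply (@ep_stable C _ _ _ _ _ (gm x) (pb1 (gd X) (gc Y)) (pb1 (gd X') (gc Y)) w).
- apply mk_pb.
  + unfold w. now rewrite comp_map1.
  + intros W u v E1 E2. apply pb_pair_ext; [exact E1|].
    rewrite <- (comp_idl (pb2 (gd X') (gc Y))), <- gm_id, <- (comp_map2 x _). ra.
    fold w. now rewrite E2.
  + intros W u v E. exists (pb_pair (gd X') (gc Y) u (pb2 (gd X) (gc Y) ∘ v)).
    assert (E' : gd X' ∘ u = gc Y ∘ (pb2 (gd X) (gc Y) ∘ v)).
    { rw <- (pb12 (gd X) (gc Y)). rewrite <- E. now rw (gd_gm x). }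
    split; [exact (pb_pair1 E')|]. apply pb_pair_ext; unfold w.
    * rw (comp_map1 x (idm Y)). now rewrite (pb_pair1 E').
    * rw (comp_map2 x (idm Y)). rewrite (pb_pair2 E'), gm_id. now ra.
- now apply gm_reg.
Qed.

(** The kernel of the regular epimorphism [comp_map 1 y] consists of pairs
    [(1, y')], and [m] is null there by the compatibility with [b]. *)
Lemma comp_descend_r {X Y Y' : PXMod B} {y : Y' ~> Y} {Z : C} (m : composables X Y' ~> Z)
  (b : gr Y ~> Z) : is_regular_epi y -> m ∘ inr_comp X Y' = b ∘ gm y ->
  exists h : composables X Y ~> Z, h ∘ comp_map (idm X) y = m /\ h ∘ inr_comp X Y = b.
Proof.
intros Hy M. pose proof (comp_map_reg_r (X := X) Hy) as Hw.
set (w := comp_map (idm X) y) in *.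
destruct (kernel_ex w) as [N [n Hn]].
assert (N1 : is_null (pb1 (gd X) (gc Y') ∘ n)).
{ rewrite <- (comp_idl (pb1 (gd X) (gc Y'))), <- gm_id, <- (comp_map1 _ y). ra.
  apply null_l, (kernel_null Hn). }
assert (N2 : is_null (gm y ∘ (pb2 (gd X) (gc Y') ∘ n))).
{ rw <- (comp_map2 (idm X) y). apply null_l, (kernel_null Hn). }
assert (En : n = inr_comp X Y' ∘ (pb2 (gd X) (gc Y') ∘ n)).
{ apply pb_pair_ext.
  - rw (inr1 X Y'). apply null_eq; [exact N1|]. apply null_l.
    replace (gc Y' ∘ _) with (gc Y ∘ (gm y ∘ (pb2 (gd X) (gc Y') ∘ n)))
      by (now rw (gc_gm y)).
    now apply null_l.
  - now rw (inr2 X Y'). }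
destruct (normal_epi (g := m) Hw Hn) as [h Hh].
{ rewrite En. rw M. now apply null_l. }
exists h. split; [exact Hh|].
apply (reg_epi (proj2 (gm_reg y) Hy)). ra. rewrite <- comp_map_inr with (x := idm X).
fold w. rw Hh. exact M.
Qed.

Lemma comp_descend_l {X X' Y : PXMod B} {x : X' ~> X} {Z : C} (m : composables X' Y ~> Z)
  (a : gr X ~> Z) : is_regular_epi x -> m ∘ inl_comp X' Y = a ∘ gm x ->
  exists h : composables X Y ~> Z, h ∘ comp_map x (idm Y) = m /\ h ∘ inl_comp X Y = a.
Proof.
intros Hx M. pose proof (comp_map_reg_l (Y := Y) Hx) as Hw.
set (w := comp_map x (idm Y)) in *.
destruct (kernel_ex w) as [N [n Hn]].
assert (N1 : is_null (pb2 (gd X') (gc Y) ∘ n)).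
{ rewrite <- (comp_idl (pb2 (gd X') (gc Y))), <- gm_id, <- (comp_map2 x _). ra.
  apply null_l, (kernel_null Hn). }
assert (N2 : is_null (gm x ∘ (pb1 (gd X') (gc Y) ∘ n))).
{ rw <- (comp_map1 x (idm Y)). apply null_l, (kernel_null Hn). }
assert (En : n = inl_comp X' Y ∘ (pb1 (gd X') (gc Y) ∘ n)).
{ apply pb_pair_ext.
  - now rw (inl1 X' Y).
  - rw (inl2 X' Y). apply null_eq; [exact N1|]. apply null_l.
    replace (gd X' ∘ _) with (gd X ∘ (gm x ∘ (pb1 (gd X') (gc Y) ∘ n)))
      by (now rw (gd_gm x)).
    now apply null_l. }
destruct (normal_epi (g := m) Hw Hn) as [h Hh].
{ rewrite En. rw M. now apply null_l. }
exists h. split; [exact Hh|].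
apply (reg_epi (proj2 (gm_reg x) Hx)). ra. rewrite <- comp_map_inl with (y := idm Y).
fold w. rw Hh. exact M.
Qed.

Lemma coop_reg {X X' Y Y' Z : PXMod B} (a : X ~> Z) (b : Y ~> Z) (x : X' ~> X) (y : Y' ~> Y) :
  is_regular_epi x -> is_regular_epi y -> cooperate (a ∘ x) (b ∘ y) -> cooperate a b.
Proof.
intros Hx Hy [m [M1 M2]]. rewrite gm_comp in M1. rewrite gm_comp in M2.
destruct (comp_descend_r Hy M2) as [h [H1 H2]].
assert (M3 : h ∘ inl_comp X' Y = gm a ∘ gm x).
{ rewrite <- M1, <- H1. ra. rewrite comp_map_inl, gm_id. now ra. }
destruct (comp_descend_l Hx M3) as [g [G1 G2]].
exists g. split; [exact G2|].
rewrite <- H2, <- G1. ra. rewrite comp_map_inr, gm_id. now ra.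
Qed.

(** * Semidirect products of precrossed modules *)

(** The conditions on [kS] in [is_semidirect_px] say that the graph of [S] is the
    graph of composable pairs, and that [jX] and [iY] become [inl_comp] and
    [inr_comp]. *)
Lemma semidirect_px_iso {X Y S : PXMod B} {jX : X ~> S} {iY : Y ~> S} :
  is_semidirect_px jX iY ->
  exists (u : gr S ~> composables X Y) (v : composables X Y ~> gr S),
    v ∘ u = idm (gr S) /\ u ∘ v = idm (composables X Y) /\
    v ∘ inl_comp X Y = gm jX /\ v ∘ inr_comp X Y = gm iY.
Proof.
intros [X1 [dX [cX [eX [kX [Y1 [dY [cY [eY [kY [W [q1 [q2 [eW [kS [pY
  [HX [HY [HP [E1 [E2 [HS [_ [F1 [F2 [F3 F4]]]]]]]]]]]]]]]]]]]]]]]]]].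
destruct (graph_of_iso HX) as [uX [vX [X2 [X3 [X4 [X5 [X6 X7]]]]]]].
destruct (graph_of_iso HY) as [uY [vY [Y2 [Y3 [Y4 [Y5 [Y6 Y7]]]]]]].
destruct (graph_of_iso HS) as [uS [vS [S2 [S3 [S4 [S5 [S6 S7]]]]]]].
assert (X8 : vX ∘ ge X = eX) by (rewrite <- X4; rw X2; now ra).
assert (X9 : vX ∘ gk X = kX) by (rewrite <- X5; rw X2; now ra).
assert (Y8 : vY ∘ ge Y = eY) by (rewrite <- Y4; rw Y2; now ra).
assert (Y9 : vY ∘ gk Y = kY) by (rewrite <- Y5; rw Y2; now ra).
assert (S8 : vS ∘ ge S = eW) by (rewrite <- S4; rw S2; now ra).
assert (S9 : vS ∘ gk S = kS) by (rewrite <- S5; rw S2; now ra).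
assert (L1 : q1 ∘ (vS ∘ gm jX) = vX).
{ apply (jee_epi (gk_jee X)); ra.
  - rewrite gm_ge, S8, E1. easy.
  - rewrite gm_gk. rw S9. now rewrite F1. }
assert (L2 : q2 ∘ (vS ∘ gm jX) = eY ∘ gd X).
{ apply (jee_epi (gk_jee X)); ra.
  - rewrite gm_ge, S8, E2, gd_ge. now ra.
  - rewrite gm_gk. rw S9. rewrite F2. apply null_eq.
    + now apply is_null_zero.
    + apply null_l, gd_gk. }
assert (L3 : q1 ∘ (vS ∘ gm iY) = eX ∘ gc Y).
{ apply (jee_epi (gk_jee Y)); ra.
  - rewrite gm_ge, S8, E1, gc_ge. now ra.
  - rewrite gm_gk. rw S9. rewrite F3, gc_gk. easy. }
assert (L4 : q2 ∘ (vS ∘ gm iY) = vY).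
{ apply (jee_epi (gk_jee Y)); ra.
  - rewrite gm_ge, S8, E2. easy.
  - rewrite gm_gk. rw S9. rewrite F4. easy. }
assert (Od : dX ∘ vX = gd X) by (rewrite <- X6; ra; rewrite X3; now ra).
assert (Oc : cY ∘ vY = gc Y) by (rewrite <- Y7; ra; rewrite Y3; now ra).
assert (A : gd X ∘ (uX ∘ q1) = gc Y ∘ (uY ∘ q2)).
{ rw X6. rw Y7. apply HP. }
destruct (pb_lift HP (a := vX ∘ pb1 (gd X) (gc Y)) (b := vY ∘ pb2 (gd X) (gc Y)))
  as [w [W1 W2]].
{ rw Od. rw Oc. apply pb12. }
exists (pb_pair (gd X) (gc Y) (uX ∘ q1) (uY ∘ q2) ∘ vS), (uS ∘ w). repeat split.
- assert (E : w ∘ pb_pair (gd X) (gc Y) (uX ∘ q1) (uY ∘ q2) = idm W).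
  { apply (pb_ext HP).
    - rw W1. rewrite (pb_pair1 A). now rw X2.
    - rw W2. rewrite (pb_pair2 A). now rw Y2. }
  rw E. exact S3.
- ra. rw S2. apply pb_pair_ext.
  + rw (pb_pair1 A). rewrite W1. rw X3. now ra.
  + rw (pb_pair2 A). rewrite W2. rw Y3. now ra.
- rewrite <- (comp_idl (gm jX)), <- S3. ra. f_equal. apply (pb_ext HP).
  + rw W1. rewrite inl1, L1. now ra.
  + rw W2. rewrite inl2, L2. rw Y8. easy.
- rewrite <- (comp_idl (gm iY)), <- S3. ra. f_equal. apply (pb_ext HP).
  + rw W1. rewrite inr1, L3. rw X8. easy.
  + rw W2. rewrite inr2, L4. now ra.
Qed.

Lemma semidirect_px_coop {X Y S Z : PXMod B} {jX : X ~> S} {iY : Y ~> S}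
  (H : is_semidirect_px jX iY) (a : X ~> Z) (b : Y ~> Z) :
  cooperate a b <-> exists h : S ~> Z, h ∘ jX = a /\ h ∘ iY = b.
Proof.
destruct (semidirect_px_iso H) as [u [v [E1 [E2 [E3 E4]]]]].
assert (U1 : u ∘ gm jX = inl_comp X Y) by (rewrite <- E3; rw E2; now ra).
assert (U2 : u ∘ gm iY = inr_comp X Y) by (rewrite <- E4; rw E2; now ra).
split.
- intros [m [M1 M2]].
  destruct (gm_full (X := S) (Y := Z) (h := m ∘ u)) as [h Hh].
  + ra. rewrite <- (gm_ge jX). rw U1. rw M1. apply gm_ge.
  + rw (coop_gd M1 M2). rewrite <- (comp_idr (gd S)), <- E1. rewrite !comp_assoc. f_equal.
    apply (jee_epi (comp_jee X Y)); ra.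
    * rewrite E3, gd_gm, inl2. rw (gd_ge Y). now ra.
    * rewrite E4, gd_gm, inr2. now ra.
  + rw (coop_gc M1 M2). rewrite <- (comp_idr (gc S)), <- E1. rewrite !comp_assoc. f_equal.
    apply (jee_epi (comp_jee X Y)); ra.
    * rewrite E3, gc_gm, inl1. now ra.
    * rewrite E4, gc_gm, inr1. rw (gc_ge X). now ra.
  + exists h. split; apply gm_inj; rewrite gm_comp, Hh; ra; rewrite ?U1, ?U2; auto.
- intros [h [<- <-]]. exists (gm h ∘ v). ra. rewrite E3, E4, !gm_comp. easy.
Qed.

Lemma semidirect_px_jee {X Y S : PXMod B} {jX : X ~> S} {iY : Y ~> S} :
  is_semidirect_px jX iY -> jointly_extremal_epi jX iY.
Proof.
intros H. destruct (semidirect_px_iso H) as [u [v [E1 [E2 [E3 E4]]]]].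
intros M m f g Hm Hf Hg. apply gm_iso.
assert (U1 : u ∘ gm jX = inl_comp X Y) by (rewrite <- E3; rw E2; now ra).
assert (U2 : u ∘ gm iY = inr_comp X Y) by (rewrite <- E4; rw E2; now ra).
assert (Hu : is_iso v) by now exists u.
destruct (comp_jee X Y (gr M) (u ∘ gm m) (gm f) (gm g)) as [k [K1 K2]].
- apply mono_comp; [exact (split_mono E1)|now apply gm_mono].
- ra. rewrite <- gm_comp, Hf. easy.
- ra. rewrite <- gm_comp, Hg. easy.
- exists (k ∘ u). split.
  + ra. rewrite comp_assoc in K1. rewrite <- comp_assoc in K1. exact K1.
  + rewrite <- E1. rewrite <- (comp_idl (gm m)), <- E1. ra.
    rewrite <- comp_assoc in K2. rw K2. now ra.
Qed.

Lemma semidirect_px_ex (X Y : PXMod B) :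
  exists (S : PXMod B) (jX : X ~> S) (iY : Y ~> S), is_semidirect_px jX iY.
Proof.
set (q1 := pb1 (gd X) (gc Y)). set (q2 := pb2 (gd X) (gc Y)).
assert (Oe : gd X ∘ ge X = gc Y ∘ ge Y) by now rewrite gd_ge, gc_ge.
set (eW := pb_pair (gd X) (gc Y) (ge X) (ge Y)).
assert (E1 : q1 ∘ eW = ge X) by exact (pb_pair1 Oe).
assert (E2 : q2 ∘ eW = ge Y) by exact (pb_pair2 Oe).
destruct (@graph_of_surj C B (composables X Y) (gd Y ∘ q2) (gc X ∘ q1) eW) as [S [kS HS]].
{ ra. rewrite E2. apply gd_ge. } { ra. rewrite E1. apply gc_ge. }
destruct (graph_of_full (gr_spec X) HS (f1 := inl_comp X Y)) as [jX HjX].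
{ apply pb_pair_ext.
  - rw (inl1 X Y). now rewrite <- E1.
  - rw (inl2 X Y). rewrite gd_ge, comp_idr. now rewrite <- E2. }
{ unfold q2. ra. rewrite inl2. rw (gd_ge Y). now ra. }
{ unfold q1. ra. rewrite inl1. now ra. }
destruct (graph_of_full (gr_spec Y) HS (f1 := inr_comp X Y)) as [iY HiY].
{ apply pb_pair_ext.
  - rw (inr1 X Y). rewrite gc_ge, comp_idr. now rewrite <- E1.
  - rw (inr2 X Y). now rewrite <- E2. }
{ unfold q2. ra. rewrite inr2. now ra. }
{ unfold q1. ra. rewrite inr1. rw (gc_ge X). now ra. }
pose proof (proj1 (proj2 (proj1 HS))) as KS.
destruct (kernel_lift (gk_kernel Y) (a := q2 ∘ kS)) as [pY HpY].
{ generalize (kernel_null KS). now ra. }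
pose proof (kernel_mono (gk_kernel Y)) as MY.
assert (A1 : q1 ∘ (kS ∘ px_map jX) = gk X).
{ rewrite <- HjX. unfold q1. rw (inl1 X Y). now ra. }
assert (A2 : is_null (q2 ∘ (kS ∘ px_map jX))).
{ rewrite <- HjX. unfold q2. rw (inl2 X Y). apply null_l, gd_gk. }
assert (A3 : q1 ∘ (kS ∘ px_map iY) = ge X ∘ px_bd Y).
{ rewrite <- HiY. unfold q1. rw (inr1 X Y). now rewrite gc_gk. }
assert (A4 : q2 ∘ (kS ∘ px_map iY) = gk Y).
{ rewrite <- HiY. unfold q2. rw (inr2 X Y). now ra. }
exists S, jX, iY.
exists (gr X), (gd X), (gc X), (ge X), (gk X), (gr Y), (gd Y), (gc Y), (ge Y), (gk Y).
exists (composables X Y), q1, q2, eW, kS, pY.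
split; [apply gr_spec|split; [apply gr_spec|split; [apply pb_pullback|]]].
split; [exact E1|split; [exact E2|split; [exact HS|split]]].
- apply (@semidirect_pullback C (px_ob Y) B (px_ob X) (gr X) (px_ob S) (px_act X)
    (gd X) (ge X) (gk X) (px_bd Y) (q1 ∘ kS) pY).
  + apply gr_spec.
  + apply mk_pb.
    * rewrite <- gc_gk. ra. rewrite HpY. unfold q1. now rw (pb12 (gd X) (gc Y)).
    * intros V a b H1 H2. apply (kernel_mono KS), pb_pair_ext.
      -- fold q1. now rewrite !comp_assoc.
      -- fold q2. rewrite !comp_assoc, <- HpY. ra. now rewrite H2.
    * intros V a b E.
      assert (E' : gd X ∘ a = gc Y ∘ (gk Y ∘ b)) by (rw (gc_gk Y); exact E).
      destruct (kernel_lift KS (a := pb_pair (gd X) (gc Y) a (gk Y ∘ b))) as [h Hh].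
      { unfold q2. ra. rewrite (pb_pair2 E'). rewrite comp_assoc. apply null_r, gd_gk. }
      exists h. split.
      -- ra. rewrite Hh. exact (pb_pair1 E').
      -- apply MY. rw HpY. rewrite Hh. exact (pb_pair2 E').
  + ra. exact A3.
  + apply MY. rw HpY. now rewrite A4.
  + ra. exact A1.
  + apply (null_mono (m := gk Y) MY). rw HpY. exact A2.
- repeat split; auto. now apply is_null_zero.
Qed.

(** * Crossed modules *)

(** The action of the arrows of [Z] on [Z] through their codomains is encoded by
    the point of composable pairs with projection to the second component. *)
Lemma act_semidirect (Z : PXMod B) :
  is_semidirect (pullback_action (gc Z) (px_act Z)) (pb2 (gd Z) (gc Z)) (inr_comp Z Z)
    (inl_comp Z Z ∘ gk Z).
Proof.
apply (semidirect_pullback (proj1 (gr_spec Z)) (pb_pullback (gd Z) (gc Z))).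
- apply inr1.
- apply inr2.
- rw (inl1 Z Z). now ra.
- rw (inl2 Z Z). apply null_l, gd_gk.
Qed.

(** Restricting the composition to pairs in the kernel of the domain map
    turns the action through [px_bd Z] into conjugation. *)
Lemma cooperate_crossed (Z : PXMod B) : cooperate (idm Z) (idm Z) -> is_crossed Z.
Proof.
intros [m [M1 M2]]. rewrite gm_id in M1, M2.
destruct (act_semidirect Z) as [_ [_ H]].
assert (E : gk Z ∘ pullback_action (gc Z) (px_act Z) = copair (idm (gr Z)) (gk Z) ∘ flat_ker _ _).
{ transitivity (m ∘ ((inl_comp Z Z ∘ gk Z) ∘ pullback_action (gc Z) (px_act Z))).
  - rw M1. easy.
  - rewrite H. rewrite comp_assoc, comp_copair, M2. now rw M1. }
apply (kernel_mono (gk_kernel Z)).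
transitivity (gk Z ∘ (pullback_action (gc Z) (px_act Z) ∘ flat_map (gk Z) (idm (px_ob Z)))).
- unfold pullback_action. ra. do 2 f_equal. apply flat_ker_mono.
  rewrite flat_map_spec. rw (flat_map_spec (gc Z) (idm (px_ob Z))). rewrite flat_map_spec.
  rewrite !comp_assoc. f_equal. unfold sum_map at 2. rewrite copair_map.
  unfold sum_map. ra. now rewrite gc_gk.
- rw E. rewrite copair_flat. unfold conj_action. rewrite comp_assoc, comp_copair. now ra.
Qed.

(** The arrows of [Z] act on [Z] through their codomains and by conjugation in
    [gr Z].  The two actions agree on units by the definition of [gr Z], and on
    [Z] by the Peiffer condition.  Units and [Z] jointly cover [gr Z], so by [UA]
    the actions are equal, which is what is needed to define the composition on
    the semi-direct product [act_semidirect]. *)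
Lemma crossed_cooperate (hUA : UA C) (Z : PXMod B) :
  is_crossed Z -> cooperate (idm Z) (idm Z).
Proof.
intros HZ. pose proof (act_semidirect Z) as HS.
pose proof (kernel_mono (gk_kernel Z)) as Mk.
(* the conjugation action of [gr Z] on [px_ob Z] *)
assert (Dg : gd Z ∘ idm (gr Z) = gd Z ∘ idm (gr Z)) by easy.
assert (Kg : gd Z ∘ zero_mor (px_ob Z) (gr Z) = gd Z ∘ gk Z).
{ apply null_eq; [apply null_l; now apply is_null_zero|apply gd_gk]. }
destruct (@point_semidirect C (gr Z) (px_ob Z) (pb (gd Z) (gd Z)) (pb1 (gd Z) (gd Z))
  (pb_pair (gd Z) (gd Z) (idm _) (idm _)) (pb_pair (gd Z) (gd Z) (zero_mor _ _) (gk Z)))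
  as [ga Hga].
{ exact (pb_pair1 Dg). }
{ apply mk_kernel.
  - rewrite (pb_pair1 Kg). now apply is_null_zero.
  - intros W a b E. apply Mk. rewrite <- (pb_pair2 Kg). ra. now rewrite E.
  - intros W a Ha. destruct (kernel_lift (gk_kernel Z) (a := pb2 (gd Z) (gd Z) ∘ a)) as [h Hh].
    { rw <- (pb12 (gd Z) (gd Z)). now apply null_l. }
    exists h. apply pb_pair_ext.
    + rw (pb_pair1 Kg). apply null_eq; [|exact Ha]. apply null_r. now apply is_null_zero.
    + now rw (pb_pair2 Kg). }
assert (Eg : gk Z ∘ ga = copair (idm (gr Z)) (gk Z) ∘ flat_ker _ _).
{ pose proof (proj2 (proj2 Hga)) as E. apply (f_equal (comp (pb2 (gd Z) (gd Z)))) in E.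
  rewrite !comp_assoc, comp_copair, (pb_pair2 Kg), (pb_pair2 Dg) in E. exact E. }
assert (Eq : pullback_action (gc Z) (px_act Z) = ga).
{ assert (A3 : is_action (pullback_action (gc Z) (px_act Z))) by exact (semidirect_action HS).
  assert (A4 : is_action ga) by exact (semidirect_action Hga).
  apply (@hUA (px_ob Z) (gr Z) B (px_ob Z) (gk Z) (ge Z) (pullback_action (gk Z) ga)
    (pullback_action (ge Z) ga)); try apply pullback_is_action; auto;
    try exact (px_is_action Z).
  - apply jee_sym, gk_jee.
  - apply Mk. transitivity (gk Z ∘ conj_action (px_ob Z)).
    + rewrite <- HZ. unfold pullback_action. ra. do 2 f_equal.  apply flat_ker_mono.
      rw (flat_map_spec (gc Z) (idm (px_ob Z))). rewrite !flat_map_spec.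
      rewrite !comp_assoc. f_equal. unfold sum_map at 1. rewrite copair_map.
      unfold sum_map. ra. now rewrite gc_gk.
    + unfold pullback_action. rw Eg. rewrite copair_flat. unfold conj_action.
      rewrite comp_assoc, comp_copair. now ra.
  - apply Mk. unfold pullback_action. rw Eg. rewrite copair_flat.
    rw (proj2 (proj2 (proj1 (gr_spec Z)))).
    rw (copair_flat (ge Z) (gk Z) (gc Z) (idm (px_ob Z))).
    rewrite copair_flat. ra. rewrite gc_ge. now ra. }
destruct (semidirect_lift (b := idm (gr Z)) (a := gk Z) HS) as [m [M1 M2]].
{ now rewrite Eq. }
exists m. rewrite gm_id. split; [|exact M1].
apply (jee_epi (gk_jee Z)).
- ra. assert (E : inl_comp Z Z ∘ ge Z = inr_comp Z Z ∘ ge Z).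
  { apply pb_pair_ext.
    - rw (inl1 Z Z). rw (inr1 Z Z). rewrite gc_ge. now ra.
    - rw (inl2 Z Z). rw (inr2 Z Z). rewrite gd_ge. now ra. }
  rewrite E. rw M1. easy.
- ra. exact M2.
Qed.

End Cooperation.

Arguments comp_jee {C B} X Y.

(** * The kernel pair of a central extension *)

Section CentralKernelPair.
Context {C : SemiAbelian} {B : C}.

(** With [n (x, κ)] and [m (κ, x)] the two operations, [z'] sends [(x, κ)]
    to the pair [(x, n (x, κ))] of the kernel pair.  This is an isomorphism by
    protomodularity, since over units both sides are the kernel of [f].  So
    [(x, m (κ, x))] corresponds to some [(x, th (κ, x))], and [th] transports an
    endomorphism [κ] of the codomain of [x] to one of its domain. *)
Lemma kernel_pair_split {X Y K E : PXMod B} {f : X ~> Y} {k : K ~> X} {p1 p2 : E ~> X}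
  {D : X ~> E} :
  is_kernel f k -> is_kernel_pair f p1 p2 -> p1 ∘ D = idm X -> p2 ∘ D = idm X ->
  cooperate (idm X) k -> cooperate k (idm X) ->
  exists (z : gr E ~> composables X K) (z' : composables X K ~> gr E),
    z' ∘ z = idm _ /\ z ∘ z' = idm _ /\ pb1 (gd X) (gc K) ∘ z = gm p1 /\
    z ∘ gm D = inl_comp X K /\
  exists th : composables K X ~> gr K, gc K ∘ th = gd X ∘ pb2 (gd K) (gc X) /\
    th ∘ inl_comp K X = idm (gr K) /\ th ∘ inr_comp K X = ge K ∘ gd X.
Proof.
intros Hk KP D1 D2 [n [N1 N2]] [m [M1 M2]].
rewrite gm_id in N1, M2.
pose proof (gm_pb KP) as G. pose proof (gm_kernel Hk) as GK.
pose proof (kernel_dc Hk) as Kdc.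
assert (GD1 : gm p1 ∘ gm D = idm _) by (now rewrite <- gm_comp, D1, gm_id).
assert (GD2 : gm p2 ∘ gm D = idm _) by (now rewrite <- gm_comp, D2, gm_id).
assert (Fn : gm f ∘ n = gm f ∘ pb1 (gd X) (gc K)).
{ apply (jee_epi (comp_jee X K)); ra.
  - now rewrite N1, inl1.
  - rewrite N2, inr1. rw (gm_ge f). rewrite (proj1 GK). now rewrite Kdc. }
assert (Fm : gm f ∘ m = gm f ∘ pb2 (gd K) (gc X)).
{ apply (jee_epi (comp_jee K X)); ra.
  - rewrite M1, inl2. rw (gm_ge f). exact (proj1 GK).
  - now rewrite M2, inr2. }
destruct (pb_lift G (a := pb1 (gd X) (gc K)) (b := n)) as [al [A1 A2]]; [now symmetry|].
destruct (pb_lift G (a := pb2 (gd K) (gc X)) (b := m)) as [be [B1 B2]]; [now symmetry|].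
assert (AL : al ∘ inl_comp X K = gm D).
{ apply (pb_ext G).
  - rw A1. now rewrite inl1, GD1.
  - rw A2. now rewrite N1, GD2. }
(* over the units of [X] both fibres are the kernel of [f] *)
assert (Ia : is_iso al).
{ apply (@ep_protomodular C _ _ _ (ge X) _ (pb1 (gd X) (gc K)) (inl_comp X K) _ (gm p1)
    (gm D) al (gr K) (inr_comp X K) (gc K)).
  - apply inl1.
  - exact GD1.
  - exact A1.
  - exact AL.
  - apply mk_pb.
    + apply inr1.
    + intros W a b E1 _. exact (split_mono (inr2 X K) E1).
    + intros W a b Eab. exists (pb2 (gd X) (gc K) ∘ a).
      assert (E' : gc K ∘ (pb2 (gd X) (gc K) ∘ a) = b).
      { rw <- (pb12 (gd X) (gc K)). rewrite Eab. rw (gd_ge X). now ra. }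
      split; [|exact E']. apply pb_pair_ext.
      * rw (inr1 X K). rewrite E'. now symmetry.
      * now rw (inr2 X K).
  - apply mk_pb.
    + rw A1. apply inr1.
    + intros W a b E1 _. apply (gm_mono (kernel_mono Hk)). rewrite <- N2, <- A2. ra.
      rewrite <- !comp_assoc in E1. now rewrite E1.
    + intros W a b Eab. destruct (pb_lift GK (a := gm p2 ∘ a) (b := b)) as [h [H1 H2]].
      { rw <- (proj1 G). rewrite Eab. now rw (gm_ge f). }
      exists h. assert (H3 : gc K ∘ h = b) by now rewrite <- Kdc.
      split; [|exact H3]. apply (pb_ext G).
      * rw A1. rw (inr1 X K). now rewrite H3.
      * rw A2. now rw N2. }
destruct Ia as [ze [Z1 Z2]].
assert (Zp : pb1 (gd X) (gc K) ∘ ze = gm p1).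
{ rewrite <- A1. ra. rewrite Z2. now ra. }
exists ze, al. split; [exact Z2|split; [exact Z1|split; [exact Zp|split]]].
{ rewrite <- AL. rw Z1. easy. }
exists (pb2 (gd X) (gc K) ∘ (ze ∘ be)). split; [|split].
- rw <- (pb12 (gd X) (gc K)). rw Zp. now rewrite B1.
- assert (BE : be ∘ inl_comp K X = al ∘ inr_comp X K).
  { apply (pb_ext G).
    - rw B1. rw A1. rewrite inl2, inr1. now rewrite Kdc.
    - rw B2. rw A2. now rewrite M1, N2. }
  ra. rewrite BE. rw Z1. apply inr2.
- assert (BE : be ∘ inr_comp K X = al ∘ inl_comp X K).
  { apply (pb_ext G).
    - rw B1. rw A1. now rewrite inr2, inl1.
    - rw B2. rw A2. now rewrite M2, N1. }
  ra. rewrite BE. rw Z1. apply inl2.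
Qed.

(** A composition can be given on any graph isomorphic to [gr T]. *)
Lemma cooperate_of_graph (T : PXMod B) (G : C) (d c : G ~> B) (e : B ~> G) (u : G ~> gr T)
  (v : gr T ~> G) (m : pb d c ~> G) :
  d ∘ e = idm B -> c ∘ e = idm B ->
  u ∘ v = idm (gr T) -> v ∘ u = idm G -> u ∘ e = ge T -> gd T ∘ u = d -> gc T ∘ u = c ->
  m ∘ pb_pair d c (idm G) (e ∘ d) = idm G -> m ∘ pb_pair d c (e ∘ c) (idm G) = idm G ->
  cooperate (idm T) (idm T).
Proof.
intros De Ce V1 V2 V3 V4 V5 M1 M2.
assert (Vd : d ∘ v = gd T) by (rewrite <- V4; ra; rewrite V1; now ra).
assert (Vc : c ∘ v = gc T) by (rewrite <- V5; ra; rewrite V1; now ra).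
assert (Ve : v ∘ ge T = e) by (rewrite <- V3; rw V2; now ra).
assert (E : d ∘ (v ∘ pb1 (gd T) (gc T)) = c ∘ (v ∘ pb2 (gd T) (gc T))).
{ rw Vd. rw Vc. apply pb12. }
exists (u ∘ (m ∘ pb_pair d c (v ∘ pb1 (gd T) (gc T)) (v ∘ pb2 (gd T) (gc T)))).
rewrite gm_id. split; ra; rewrite (pb_pair_comp _ E); ra.
- rewrite inl1, inl2. rw Ve.
  assert (F : d ∘ idm G = c ∘ (e ∘ d)) by (rw Ce; now ra).
  replace (pb_pair d c _ _) with (pb_pair d c (idm G) (e ∘ d) ∘ v).
  + rw M1. now ra.
  + rewrite (pb_pair_comp _ F). ra. now rewrite Vd.
- rewrite inr1, inr2. rw Ve.
  assert (F : d ∘ (e ∘ c) = c ∘ idm G) by (rw De; now ra).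
  replace (pb_pair d c _ _) with (pb_pair d c (e ∘ c) (idm G) ∘ v).
  + rw M2. now ra.
  + rewrite (pb_pair_comp _ F). ra. now rewrite Vc.
Qed.

(** Arrows of [T] are pairs [(g, κ)] with [κ] an endomorphism of the domain of
    [g].  Transporting along [th], they compose like arrows of a semi-direct
    product: [(g, κ) ∘ (g', κ') = (g ∘ g', th (κ, g') ∘ κ')]. *)
Lemma twisted_product_crossed (G K T : PXMod B) (u : composables G K ~> gr T)
  (v : gr T ~> composables G K) (th : composables K G ~> gr K) :
  u ∘ v = idm _ -> v ∘ u = idm _ -> u ∘ (inl_comp G K ∘ ge G) = ge T ->
  gd T ∘ u = gd G ∘ pb1 (gd G) (gc K) -> gc T ∘ u = gc G ∘ pb1 (gd G) (gc K) ->
  gd K = gc K -> cooperate (idm G) (idm G) -> cooperate (idm K) (idm K) ->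
  gc K ∘ th = gd G ∘ pb2 (gd K) (gc G) ->
  th ∘ inl_comp K G = idm (gr K) -> th ∘ inr_comp K G = ge K ∘ gd G ->
  cooperate (idm T) (idm T).
Proof.
intros V1 V2 V3 V4 V5 Kdc [mG [G1 G2]] [mu [U1 U2]] T1 T2 T3.
pose proof (coop_gd G1 G2) as Gd. pose proof (coop_gd U1 U2) as Kd.
pose proof (coop_gc U1 U2) as Kc.
rewrite gm_id in G1, G2, U1, U2.
set (q1 := pb1 (gd G) (gc K)) in *. set (q2 := pb2 (gd G) (gc K)) in *.
set (d := gd G ∘ q1). set (c := gc G ∘ q1). set (e := inl_comp G K ∘ ge G).
set (a1 := pb1 d c). set (a2 := pb2 d c).
assert (Q : gd G ∘ q1 = gc K ∘ q2) by apply pb12.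
assert (Qe1 : q1 ∘ e = ge G) by (unfold e, q1; rw (inl1 G K); now ra).
assert (Qe2 : q2 ∘ e = ge K).
{ unfold e, q2. rw (inl2 G K). rewrite gd_ge. now ra. }
assert (De : d ∘ e = idm B) by (unfold d; ra; rewrite Qe1; apply gd_ge).
assert (Ce : c ∘ e = idm B) by (unfold c; ra; rewrite Qe1; apply gc_ge).
assert (KK : forall (W : C) (a : W ~> gr K), gd K ∘ a = gc K ∘ a) by (intros; now rewrite Kdc).
assert (C1 : gd G ∘ (q1 ∘ a1) = gc G ∘ (q1 ∘ a2)).
{ rewrite !comp_assoc. exact (pb12 d c). }
assert (C2 : gd K ∘ (q2 ∘ a1) = gc G ∘ (q1 ∘ a2)).
{ rewrite KK. rw <- Q. exact C1. }
set (t := th ∘ pb_pair (gd K) (gc G) (q2 ∘ a1) (q1 ∘ a2)).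
assert (C3 : gd K ∘ t = gc K ∘ (q2 ∘ a2)).
{ rewrite KK. unfold t. rw T1. rewrite (pb_pair2 C2). rw Q. easy. }
set (y := mu ∘ pb_pair (gd K) (gc K) t (q2 ∘ a2)).
set (x := mG ∘ pb_pair (gd G) (gc G) (q1 ∘ a1) (q1 ∘ a2)).
assert (C4 : gd G ∘ x = gc K ∘ y).
{ unfold x, y. rw Gd. rw Kc. rewrite (pb_pair2 C1), (pb_pair1 C3), <- KK, C3. rw Q. easy. }
assert (F1 : d ∘ idm (composables G K) = c ∘ (e ∘ d)) by (rw Ce; now ra).
assert (F2 : d ∘ (e ∘ c) = c ∘ idm (composables G K)) by (rw De; now ra).
assert (L : forall (P Q : PXMod B) (W : C) (a : W ~> gr P),
  pb_pair (gd P) (gc Q) a (ge Q ∘ (gd P ∘ a)) = inl_comp P Q ∘ a).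
{ intros P Q0 W a. symmetry. apply pb_pair_eq; [rw (inl1 P Q0)|rw (inl2 P Q0)]; easy. }
assert (R : forall (P Q : PXMod B) (W : C) (b : W ~> gr Q),
  pb_pair (gd P) (gc Q) (ge P ∘ (gc Q ∘ b)) b = inr_comp P Q ∘ b).
{ intros P Q0 W b. symmetry. apply pb_pair_eq; [rw (inr1 P Q0)|rw (inr2 P Q0)]; easy. }
apply (cooperate_of_graph (m := pb_pair (gd G) (gc K) x y) De Ce V1 V2 V3 V4 V5).
- set (w := pb_pair d c (idm (composables G K)) (e ∘ d)).
  assert (W1 : a1 ∘ w = idm _) by exact (pb_pair1 F1).
  assert (W2 : a2 ∘ w = e ∘ d) by exact (pb_pair2 F1).
  rewrite (pb_pair_comp _ C4). symmetry. apply pb_pair_eq; ra.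
  + unfold x. ra. rewrite (pb_pair_comp _ C1). ra. rewrite W1, W2. rw Qe1. unfold d.
    rewrite L. now rw G1.
  + unfold y. ra. rewrite (pb_pair_comp _ C3). ra. unfold t. ra. rewrite (pb_pair_comp _ C2). ra.
    rewrite W1, W2. rw Qe1. rw Qe2. unfold d. rewrite Q.
    rewrite <- (KK _ q2), L. rw T2. rewrite L. now rw U1.
- set (w := pb_pair d c (e ∘ c) (idm (composables G K))).
  assert (W1 : a1 ∘ w = e ∘ c) by exact (pb_pair1 F2).
  assert (W2 : a2 ∘ w = idm _) by exact (pb_pair2 F2).
  rewrite (pb_pair_comp _ C4). symmetry. apply pb_pair_eq; ra.
  + unfold x. ra. rewrite (pb_pair_comp _ C1). ra. rewrite W1, W2. rw Qe1. unfold c. ra.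
    rewrite R. now rw G2.
  + unfold y. ra. rewrite (pb_pair_comp _ C3). ra. unfold t. ra. rewrite (pb_pair_comp _ C2). ra.
    rewrite W1, W2. rw Qe2. unfold c. ra. rewrite R. rw T3. rewrite Q. rewrite R. now rw U2.
Qed.

End CentralKernelPair.

(** * Peiffer commutators *)

Section Peiffer.
Context {C : SemiAbelian} {B : C}.

Lemma px_coproduct_ex (X Y : PXMod B) :
  exists (S : PXMod B) (i : X ~> S) (j : Y ~> S), is_coproduct i j.
Proof.
destruct (px_initial_ex (B := B)) as [O HO].
destruct (initial_ex HO X) as [x _], (initial_ex HO Y) as [y _].
destruct (px_pushout_ex x y) as [S [i [j [_ U]]]].
exists S, i, j. intros W a b. apply U. apply (initial_eq HO).
Qed.

Lemma coproduct_ext {D : Category} {X Y S W : D} {i : X ~> S} {j : Y ~> S}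
  (H : is_coproduct i j) (a b : S ~> W) : a ∘ i = b ∘ i -> a ∘ j = b ∘ j -> a = b.
Proof.
intros E1 E2. destruct (H W (b ∘ i) (b ∘ j)) as [h [_ U]].
transitivity h; [symmetry|]; now apply U.
Qed.

Lemma pushout_reg {D : Category} {Z X Y Q : D} {f : Z ~> X} {g : Z ~> Y} {i : X ~> Q}
  {j : Y ~> Q} : is_pushout f g i j -> is_regular_epi g -> is_regular_epi i.
Proof.
intros [E U] [R [r1 [r2 H]]]. exists R, (f ∘ r1), (f ∘ r2).
split.
- rewrite !comp_assoc, E. ra. now rewrite (proj1 H).
- intros W a Ha. destruct (coeq_lift H (a := a ∘ f)) as [b Hb]; [now ra|].
  destruct (U W a b) as [h [[H1 H2] Hu]]; [now symmetry|].
  exists h. split; [exact H1|]. intros h' H'. apply Hu. split; [exact H'|].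
  apply (coeq_epi H). rewrite Hb, <- H'. ra. now rw E.
Qed.

(** The coproduct covers both semi-direct products, and regular epimorphisms
    are stable under pushout. *)
Lemma peiffer_product_reg {X Y XY Q : PXMod B} {i1 : X ~> XY} {i2 : Y ~> XY} {s : XY ~> Q} :
  is_peiffer_product i1 i2 s -> is_regular_epi s.
Proof.
intros [S [T [jX [iY [iX [jY [s1 [t1 [u [v [_ [HS [HT [S1 [S2 [T1 [T2 [P <-]]]]]]]]]]]]]]]]]].
assert (J : forall (A : PXMod B) (a : X ~> A) (b : Y ~> A) (g : XY ~> A),
  jointly_extremal_epi a b -> g ∘ i1 = a -> g ∘ i2 = b -> is_regular_epi g).
{ intros A a b g Jab G1 G2. apply extremal_reg. intros M m h Hm E.
  apply (Jab M m (h ∘ i1) (h ∘ i2) Hm); now rw E. }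
apply reg_comp.
- apply (pushout_reg P), (J _ iX jY); auto. apply jee_sym, (semidirect_px_jee HT).
- apply (J _ jX iY); auto. apply (semidirect_px_jee HS).
Qed.

(** Morphisms out of the Peiffer product are pairs of morphisms out of the two
    semi-direct products that agree on the coproduct, and [l] is the image of the
    kernel of the projection from the coproduct to the Peiffer product. *)
Lemma peiffer_null {X Y A L Z : PXMod B} {m : X ~> A} {n : Y ~> A} {l : L ~> A}
  (H : is_peiffer_commutator m n l) (g : A ~> Z) :
  is_null (g ∘ l) <-> cooperate (g ∘ m) (g ∘ n) /\ cooperate (g ∘ n) (g ∘ m).
Proof.
destruct H as [_ [_ [XY [Q [K [i1 [i2 [s [k [mn [HQ [Hk [E1 [E2 [Hl [e [He E]]]]]]]]]]]]]]]]].
pose proof (peiffer_product_reg HQ) as Hs.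
destruct HQ as [S [T [jX [iY [iX [jY [s1 [t1 [u [v [Hc [HS [HT [S1 [S2 [T1 [T2 [P Ps]]]]]]]]]]]]]]]]]].
rewrite (semidirect_px_coop HS), (semidirect_px_coop HT). split.
- intros Hn. destruct (normal_epi (g := g ∘ mn) Hs Hk) as [h Hh].
  { ra. rewrite <- E, comp_assoc. now apply null_r. }
  split.
  + exists (h ∘ u). split.
    * rewrite <- S1. ra. rw Ps. rw Hh. now rewrite E1.
    * rewrite <- S2. ra. rw Ps. rw Hh. now rewrite E2.
  + assert (Pt : v ∘ t1 = s) by (rewrite <- Ps; symmetry; apply P).
    exists (h ∘ v). split.
    * rewrite <- T2. ra. rw Pt. rw Hh. now rewrite E2.
    * rewrite <- T1. ra. rw Pt. rw Hh. now rewrite E1.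
- intros [[a [A1 A2]] [b [B1 B2]]].
  destruct (proj2 P Z a b) as [h [[H1 H2] _]].
  { apply (coproduct_ext Hc); ra.
    - now rewrite S1, T1, A1, B2.
    - now rewrite S2, T2, A2, B1. }
  assert (Eg : g ∘ mn = h ∘ s).
  { apply (coproduct_ext Hc); rewrite <- Ps; ra.
    - rewrite E1, S1. rw H1. now rewrite A1.
    - rewrite E2, S2. rw H1. now rewrite A2. }
  apply (null_epi He). ra. rewrite E, comp_assoc, Eg. ra. apply null_l, (kernel_null Hk).
Qed.

(** The coproduct maps onto [A] because one of the two submodules is [A] itself,
    so [image_kernel] applies. *)
Lemma peiffer_normal {A Y L : PXMod B} {n : Y ~> A} {l : L ~> A} :
  is_peiffer_commutator (idm A) n l ->
  exists (Z : PXMod B) (g : A ~> Z), is_regular_epi g /\ is_kernel g l.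
Proof.
intros [_ [_ [XY [Q [K [i1 [i2 [s [k [mn [HQ [Hk [E1 [E2 [Hl [e [He E]]]]]]]]]]]]]]]]].
exact (image_kernel (peiffer_product_reg HQ) Hk (split_reg E1) He Hl E).
Qed.

Lemma peiffer_ex {X Y A : PXMod B} (m : X ~> A) (n : Y ~> A) : is_mono m -> is_mono n ->
  exists (L : PXMod B) (l : L ~> A), is_peiffer_commutator m n l.
Proof.
intros Hm Hn.
destruct (px_coproduct_ex X Y) as [XY [i1 [i2 Hc]]].
destruct (semidirect_px_ex X Y) as [S [jX [iY HS]]].
destruct (semidirect_px_ex Y X) as [T [jY [iX HT]]].
destruct (Hc S jX iY) as [s [[S1 S2] _]]. destruct (Hc T iX jY) as [t [[T1 T2] _]].
destruct (px_pushout_ex s t) as [Q [u [v P]]].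
destruct (kernel_ex (u ∘ s)) as [K [k Hk]].
destruct (Hc A m n) as [mn [[M1 M2] _]].
destruct (image_ex (mn ∘ k)) as [L [e [l [He [Hl E]]]]].
exists L, l. split; [exact Hm|split; [exact Hn|]].
exists XY, Q, K, i1, i2, (u ∘ s), k, mn. split; [|split; [exact Hk|split; [exact M1|split;
  [exact M2|]]]].
- exists S, T, jX, iY, iX, jY, s, t, u, v.
  repeat (split; [eassumption|]). reflexivity.
- split; [exact Hl|]. now exists e.
Qed.

End Peiffer.

(** * Reflections and central extensions *)

Section Galois.
Context {C : SemiAbelian} (hUA : UA C) {B : C}.

Lemma crossed_hom_cooperate {X Z : PXMod B} (f : X ~> Z) :
  is_crossed Z -> cooperate f f.
Proof.
intros H. pose proof (coop_pre f f (crossed_cooperate hUA H)) as E.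
now rewrite comp_idl in E.
Qed.

(** Membership in the commutator of [X] with itself, expressed without choosing
    a reflection; see [peiffer_vanishes] and [reflection_vanishes]. *)
Definition vanishes {V X : PXMod B} (a : V ~> X) :=
  forall (Z : PXMod B) (f : X ~> Z), is_crossed Z -> is_null (f ∘ a).

Lemma id_mono {D : Category} (X : D) : is_mono (idm X).
Proof. apply iso_mono, iso_id. Qed.

Lemma peiffer_quotient_crossed {X L Z : PXMod B} {l : L ~> X} {g : X ~> Z} :
  is_peiffer_commutator (idm X) (idm X) l -> is_regular_epi g -> is_null (g ∘ l) ->
  is_crossed Z.
Proof.
intros H Hg Hn. apply (peiffer_null H) in Hn. destruct Hn as [Hn _].
apply cooperate_crossed. apply (coop_reg (x := g) (y := g)); auto.
rewrite comp_idl. rewrite comp_idr in Hn. exact Hn.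
Qed.

Lemma peiffer_vanishes {V X L : PXMod B} {l : L ~> X} (a : V ~> X) :
  is_peiffer_commutator (idm X) (idm X) l ->
  vanishes a <-> exists h, l ∘ h = a.
Proof.
intros H. split.
- intros Ha. destruct (peiffer_normal H) as [Z [g [Hg Hk]]].
  apply (kernel_lift Hk). apply Ha.
  exact (peiffer_quotient_crossed H Hg (kernel_null Hk)).
- intros [h <-] Z f HZ. rewrite comp_assoc. apply null_r. apply (peiffer_null H).
  rewrite comp_idr. split; now apply crossed_hom_cooperate.
Qed.

(** The reflection is the quotient by the commutator of [X] with itself. *)
Lemma reflection_ex (X : PXMod B) :
  exists (G : PXMod B) (q : X ~> G), is_reflection q /\ is_regular_epi q.
Proof.
destruct (peiffer_ex (@id_mono _ X) (@id_mono _ X)) as [L [l H]].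
destruct (peiffer_normal H) as [Z [g [Hg Hk]]].
exists Z, g. split; [|exact Hg]. split.
{ exact (peiffer_quotient_crossed H Hg (kernel_null Hk)). }
intros Y f HY. destruct (normal_epi (g := f) Hg Hk) as [h Hh].
{ apply (peiffer_vanishes l H); [|exact HY]. exists (idm L). apply comp_idr. }
exists h. split; [exact Hh|]. intros h' H'. apply (reg_epi Hg). congruence.
Qed.

Lemma reflection_lift {X G Y : PXMod B} {q : X ~> G} (H : is_reflection q) (f : X ~> Y) :
  is_crossed Y -> exists g, g ∘ q = f.
Proof. intros HY. destruct (proj2 H Y f HY) as [g [Hg _]]. now exists g. Qed.

Lemma reflection_epi {X G Y : PXMod B} {q : X ~> G} (H : is_reflection q) (a b : G ~> Y) :
  is_crossed Y -> a ∘ q = b ∘ q -> a = b.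
Proof.
intros HY E. destruct (proj2 H Y (b ∘ q) HY) as [g [_ U]].
transitivity g; [symmetry|]; now apply U.
Qed.

Lemma reflection_unique {X G G' : PXMod B} {q : X ~> G} {q' : X ~> G'} :
  is_reflection q -> is_reflection q' -> exists h, is_iso h /\ h ∘ q = q'.
Proof.
intros H H'. destruct (reflection_lift H q' (proj1 H')) as [h Hh].
destruct (reflection_lift H' q (proj1 H)) as [h' Hh'].
exists h. split; [|exact Hh]. exists h'. split.
- apply (reflection_epi H); [apply H|]. ra. rewrite Hh, Hh'. now ra.
- apply (reflection_epi H'); [apply H'|]. ra. rewrite Hh', Hh. now ra.
Qed.

Lemma reflection_vanishes {V X G : PXMod B} {q : X ~> G} (H : is_reflection q) (a : V ~> X) :
  vanishes a <-> is_null (q ∘ a).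
Proof.
split.
- intros Ha. apply Ha, H.
- intros Hn Z f HZ. destruct (reflection_lift H f HZ) as [g <-]. ra. now apply null_l.
Qed.

(** Reflections are unique up to isomorphism, so the defining pullback of a
    trivial extension may be taken with any choice of them. *)
Lemma trivial_pullback {X Y GX GY : PXMod B} {f : X ~> Y} {qX : X ~> GX} {qY : Y ~> GY}
  {Gf : GX ~> GY} :
  is_trivial_extension f -> is_reflection qX -> is_reflection qY -> Gf ∘ qX = qY ∘ f ->
  is_pullback qY Gf f qX.
Proof.
intros [_ [GX' [GY' [qX' [qY' [Gf' [RX' [RY' P]]]]]]]] RX RY E.
destruct (reflection_unique RX RX') as [x [[x' [X1 X2]] Hx]].
destruct (reflection_unique RY RY') as [y [[y' [Y1 Y2]] Hy]].
assert (Ex : x' ∘ qX' = qX) by (rewrite <- Hx; rw X1; now ra).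
assert (Ey : y' ∘ qY' = qY) by (rewrite <- Hy; rw Y1; now ra).
assert (EG : Gf' ∘ x = y ∘ Gf).
{ apply (reflection_epi RX (proj1 RY')). ra. rewrite Hx, E. rw Hy. symmetry. apply P. }
apply mk_pb.
- now symmetry.
- intros W a b E1 E2. apply (pb_ext P); [exact E1|]. rewrite <- Hx. ra. now rewrite E2.
- intros W a b Eab. destruct (pb_lift P (a := a) (b := x ∘ b)) as [h [H1 H2]].
  { rw EG. rewrite <- Hy. ra. now rewrite Eab. }
  exists h. split; [exact H1|]. rewrite <- Ex. ra. rewrite H2. now rw X1.
Qed.

(** For a trivial extension [X] is a pullback of [Y] and a crossed module.  In
    the latter all morphisms cooperate, and in [Y] the kernel [k] becomes null. *)
Lemma trivial_cooperate {X Y K : PXMod B} {f : X ~> Y} {k : K ~> X} :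
  is_trivial_extension f -> is_kernel f k -> cooperate (idm X) k /\ cooperate k (idm X).
Proof.
intros [_ [GX [GY [qX [qY [Gf [RX [RY P]]]]]]]] Hk.
assert (N : is_null (f ∘ k)) by exact (kernel_null Hk).
assert (Q : cooperate qX qX) by (apply crossed_hom_cooperate, RX).
split; apply (coop_pullback P).
- now apply coop_null_r.
- pose proof (coop_pre (idm X) k Q) as E. exact E.
- now apply coop_null_l.
- exact (coop_pre k (idm X) Q).
Qed.

(** Cooperation descends along regular epimorphisms, so it may be checked on the
    trivial pullback of [f], which has the same kernel. *)
Lemma central_cooperate {X Y K : PXMod B} {f : X ~> Y} {k : K ~> X} :
  is_central_extension f -> is_kernel f k -> cooperate (idm X) k /\ cooperate k (idm X).
Proof.
intros [Hf [Z [W [p [p' [f' [Hp [P T]]]]]]]] Hk.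
destruct (kernel_ex f') as [K' [k' Hk']].
destruct (trivial_cooperate T Hk') as [A1 A2].
pose proof (ep_stable (pb_sym P) Hp) as Hp'.
(* the kernels of [f] and of its pullback [f'] coincide *)
destruct (kernel_lift Hk (a := p' ∘ k')) as [h Hh].
{ rw (proj1 P). apply null_l, (kernel_null Hk'). }
assert (Hr : is_regular_epi h).
{ destruct (kernel_null Hk) as [O [o [t [HO E]]]].
  destruct (initial_ex HO Z) as [oz _].
  destruct (pb_lift P (a := k) (b := oz ∘ t)) as [y [Y1 Y2]].
  { rewrite E, comp_assoc. f_equal. apply (initial_eq HO). }
  destruct (kernel_lift Hk' (a := y)) as [s Hs].
  { rewrite Y2. now exists O, oz, t. }
  apply (split_reg (s := s)). apply (kernel_mono Hk). rw Hh. rewrite Hs, Y1. now ra. }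
split.
- apply (coop_reg (x := p') (y := h)); auto. rewrite comp_idl, Hh.
  pose proof (coop_post p' A1) as E. now rewrite comp_idr in E.
- apply (coop_reg (x := h) (y := p')); auto. rewrite comp_idl, Hh.
  pose proof (coop_post p' A2) as E. now rewrite comp_idr in E.
Qed.

(** With [q] the reflection of [X] on [G], the graph [E1] is [X1 ×_B K1] by
    [kernel_pair_split]; let [T] be the graph [G1 ×_B K1].  Then [E] is the
    pullback of [T] along [q], and [T] is crossed by [twisted_product_crossed].
    Moreover [T] is the reflection of [E]: the kernel of [r : E ~> T] lies in the
    diagonal, where it is the kernel of [q], so every morphism from [E] to a
    crossed module kills it. *)
Lemma kernel_pair_trivial {X Y K E : PXMod B} {f : X ~> Y} {k : K ~> X} {p1 p2 : E ~> X} :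
  is_kernel f k -> is_kernel_pair f p1 p2 -> cooperate (idm X) k -> cooperate k (idm X) ->
  is_trivial_extension p1.
Proof.
intros Hk KP H1 H2.
destruct (kp_diag KP) as [D [D1 D2]].
destruct (kernel_pair_split Hk KP D1 D2 H1 H2) as
  [z [z' [Z1 [Z2 [Z3 [Z4 [th [T1 [T2 T3]]]]]]]]].
pose proof (kernel_dc Hk) as Kdc.
destruct (reflection_ex X) as [G [q [Rq Hq]]].
(* the transport along [x] only depends on the class of [x] in [G] *)
destruct (comp_descend_r (b := ge K ∘ gd G) (m := th) Hq) as [thG [U1 U2]].
{ ra. now rewrite gd_gm. }
assert (thG1 : gc K ∘ thG = gd G ∘ pb2 (gd K) (gc G)).
{ apply (reg_epi (comp_map_reg_r (X := K) Hq)). ra.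
  rewrite U1, T1, comp_map2. now rw (gd_gm q). }
assert (thG2 : thG ∘ inl_comp K G = idm (gr K)).
{ rewrite <- T2, <- U1. ra. rewrite comp_map_inl, gm_id. now ra. }
assert (HK : cooperate (idm K) (idm K)).
{ destruct Hk as [O [o [t [HO P]]]]. apply (coop_pullback P).
  - pose proof (coop_pre k (idm K) H1) as A. rewrite comp_idl in A. rewrite comp_idr in *. exact A.
  - apply coop_null_r. rewrite comp_idr. exists O, (idm O), t. now rewrite comp_idl. }
set (d := gd G ∘ pb1 (gd G) (gc K)). set (c := gc G ∘ pb1 (gd G) (gc K)).
set (e := inl_comp G K ∘ ge G).
assert (E1 : pb1 (gd G) (gc K) ∘ e = ge G) by (unfold e; rw (inl1 G K); now ra).
assert (E2 : pb2 (gd G) (gc K) ∘ e = ge K).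
{ unfold e. rw (inl2 G K). rewrite gd_ge. now ra. }
destruct (@gr_surj C B _ d c e) as [T [u [v [V1 [V2 [V3 [V4 V5]]]]]]].
{ unfold d. ra. rewrite E1. apply gd_ge. }
{ unfold c. ra. rewrite E1. apply gc_ge. }
assert (Vd : d ∘ v = gd T) by (rewrite <- V4; ra; rewrite V2; now ra).
assert (Vc : c ∘ v = gc T) by (rewrite <- V5; ra; rewrite V2; now ra).
assert (Ve : v ∘ ge T = e) by (rewrite <- V3; rw V1; now ra).
assert (CT : is_crossed T).
{ apply cooperate_crossed.
  apply (twisted_product_crossed V2 V1 V3 V4 V5 Kdc (crossed_cooperate hUA (proj1 Rq)) HK
    thG1 thG2 U2). }
assert (Ez : gd G ∘ (gm q ∘ gm p1) = gc K ∘ (pb2 (gd X) (gc K) ∘ z)).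
{ rw (gd_gm q). rewrite <- Z3. now rw (pb12 (gd X) (gc K)). }
set (ep := pb_pair (gd G) (gc K) (gm q ∘ gm p1) (pb2 (gd X) (gc K) ∘ z)).
assert (P1 : pb1 (gd G) (gc K) ∘ ep = gm q ∘ gm p1) by exact (pb_pair1 Ez).
assert (P2 : pb2 (gd G) (gc K) ∘ ep = pb2 (gd X) (gc K) ∘ z) by exact (pb_pair2 Ez).
assert (zD : pb2 (gd X) (gc K) ∘ (z ∘ gm D) = ge K ∘ gd X).
{ rewrite Z4. apply inl2. }
assert (epD : ep ∘ gm D = inl_comp G K ∘ gm q).
{ apply pb_pair_ext.
  - rw P1. rw (inl1 G K). rewrite <- (gm_comp p1), D1, gm_id. now ra.
  - rw P2. rw (inl2 G K). rewrite zD. now rewrite gd_gm. }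
destruct (gm_full (X := E) (Y := T) (h := u ∘ ep)) as [r Hr].
{ ra. rewrite <- V3. f_equal. unfold e. rewrite <- (gm_ge D). rw epD. now rewrite gm_ge. }
{ rw V4. unfold d. rw P1. rw (gd_gm q). apply gd_gm. }
{ rw V5. unfold c. rw P1. rw (gc_gm q). apply gc_gm. }
destruct (gm_full (X := T) (Y := G) (h := pb1 (gd G) (gc K) ∘ v)) as [pT HpT].
{ ra. now rewrite Ve. }
{ rewrite <- Vd. unfold d. now ra. }
{ rewrite <- Vc. unfold c. now ra. }
assert (Hpb : is_pullback q pT p1 r).
{ apply gm_reflects_pb. rewrite Hr, HpT. apply mk_pb.
  - ra. rw V1. now rewrite P1.
  - intros W a b A1 A2.
    assert (A3 : ep ∘ a = ep ∘ b).
    { rewrite <- (comp_idl (ep ∘ a)), <- (comp_idl (ep ∘ b)), <- V1. ra.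
      f_equal. rewrite <- !comp_assoc in A2. exact A2. }
    rewrite <- (comp_idl a), <- (comp_idl b), <- Z1. ra. f_equal. apply pb_pair_ext.
    + rw Z3. rw Z3. exact A1.
    + rw <- P2. rw <- P2. now rewrite A3.
  - intros W a b Eab. rewrite <- comp_assoc in Eab.
    assert (F : gd X ∘ a = gc K ∘ (pb2 (gd G) (gc K) ∘ (v ∘ b))).
    { rw <- (pb12 (gd G) (gc K)). rewrite <- Eab. now rw (gd_gm q). }
    exists (z' ∘ pb_pair (gd X) (gc K) a (pb2 (gd G) (gc K) ∘ (v ∘ b))).
    assert (F1 : gm p1 ∘ (z' ∘ pb_pair (gd X) (gc K) a (pb2 (gd G) (gc K) ∘ (v ∘ b))) = a).
    { rewrite <- Z3. ra. rw Z2. exact (pb_pair1 F). }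
    split; [exact F1|]. rewrite <- (comp_idl b) at 2. rewrite <- V2. ra. f_equal.
    apply pb_pair_ext.
    + rw P1. rewrite F1. exact Eab.
    + rw P2. rw Z2. exact (pb_pair2 F). }
assert (Rr : is_regular_epi r) by exact (ep_stable Hpb Hq).
assert (RR : is_reflection r).
{ split; [exact CT|]. intros Z h HZ.
  destruct (kernel_ex r) as [K0 [k0 Hk0]].
  assert (Nq : is_null (q ∘ (p1 ∘ k0))).
  { rw (proj1 Hpb). apply null_l, (kernel_null Hk0). }
  assert (Ek : k0 = D ∘ (p1 ∘ k0)).
  { apply (pb_ext Hpb).
    - rw D1. easy.
    - apply null_eq; [exact (kernel_null Hk0)|].
      apply gm_null. rewrite (gm_comp r), Hr, (gm_comp D). ra. rw epD.
      rewrite <- gm_comp, (null_gm Nq), <- V3. unfold e. now ra. }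
  destruct (reflection_lift Rq (h ∘ D) HZ) as [h' Hh'].
  destruct (normal_epi (g := h) Rr Hk0) as [x Hx].
  { rewrite Ek. rw <- Hh'. now apply null_l. }
  exists x. split; [exact Hx|]. intros x' Hx'. apply (reg_epi Rr). congruence. }
split; [exact (split_reg D1)|]. exists T, G, r, q, pT. auto.
Qed.

Lemma cooperate_central {X Y K : PXMod B} {f : X ~> Y} {k : K ~> X} :
  is_regular_epi f -> is_kernel f k -> cooperate (idm X) k -> cooperate k (idm X) ->
  is_central_extension f.
Proof.
intros Hf Hk H1 H2. split; [exact Hf|].
destruct (ep_pullback f f) as [E [p1 [p2 KP]]].
exists X, E, f, p2, p1. split; [exact Hf|]. split; [exact (pb_sym KP)|].
exact (kernel_pair_trivial Hk KP H1 H2).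
Qed.

Lemma central_kernel_pair {X Y E : PXMod B} {f : X ~> Y} {p1 p2 : E ~> X} :
  is_central_extension f -> is_kernel_pair f p1 p2 -> is_trivial_extension p1.
Proof.
intros Hf KP. destruct (kernel_ex f) as [K [k Hk]].
destruct (central_cooperate Hf Hk) as [H1 H2].
exact (kernel_pair_trivial Hk KP H1 H2).
Qed.

(** * Galois groups *)

(** The intersection of the kernel of [u] with the commutator of [U] with
    itself. *)
Definition is_vanishing_kernel {U X D : PXMod B} (u : U ~> X) (d : D ~> U) :=
  is_null (u ∘ d) /\ vanishes d /\ is_mono d /\
  forall (V : PXMod B) (a : V ~> U), is_null (u ∘ a) -> vanishes a -> exists h, d ∘ h = a.

(** Since [p1] is trivial, [E] is the pullback of [U] and its own reflection
    [GE].  Hence elements of [GE] in the kernel of [G1] are the elements [(0, a)]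
    of [E], that is, elements [a] of the kernel of [u]; being in the kernel of
    [G2] means that [a] vanishes in the reflection of [U]. *)
Lemma galois_vanishing_kernel {U X G : PXMod B} {u : U ~> X} :
  is_central_extension u -> is_galois_group u G -> exists d : G ~> U, is_vanishing_kernel u d.
Proof.
intros Hu [E [GE [GU [p1 [p2 [qE [qU [G1 [G2 [K1 [K2 [k1 [k2 [l
  [KP [RE [RU [E1 [E2 [HK1 [HK2 [a1 [a2 [HP Hl]]]]]]]]]]]]]]]]]]]]]]]].
pose proof (trivial_pullback (central_kernel_pair Hu KP) RE RU E1) as P.
assert (Ml : is_mono l).
{ rewrite <- Hl. apply mono_comp; [exact (kernel_mono HK1)|].
  exact (pb_mono (pb_sym HP) (kernel_mono HK2)). }
assert (N1 : is_null (G1 ∘ l)).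
{ rewrite <- Hl. rewrite comp_assoc. apply null_r, (kernel_null HK1). }
assert (N2 : is_null (G2 ∘ l)).
{ rewrite <- Hl, (proj1 HP). rewrite comp_assoc. apply null_r, (kernel_null HK2). }
pose proof N1 as [O [o [t [HO Ho]]]].
destruct (initial_ex HO U) as [w _].
destruct (pb_lift P (a := w ∘ t) (b := l)) as [s [S1 S2]].
{ rewrite Ho, comp_assoc. f_equal. apply (initial_eq HO). }
assert (Nw : forall (V : PXMod B) (h : V ~> G), is_null ((w ∘ t) ∘ h)).
{ intros V h. apply null_r. now exists O, w, t. }
exists (p2 ∘ s). split; [|split; [|split]].
- rw <- (proj1 KP). apply null_l. rewrite S1. now exists O, w, t.
- apply (reflection_vanishes RU). rw <- E2. now rewrite S2.
- intros V a b Eab. apply Ml. rewrite <- S2. ra. f_equal. apply (pb_ext KP).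
  + rewrite !(comp_assoc p1), S1. apply null_eq; apply Nw.
  + now rewrite !comp_assoc.
- intros V a Ha Va.
  (* [b] is the element (0, a) of the kernel pair *)
  destruct Ha as [O' [o' [t' [HO' Ho']]]].
  destruct (initial_ex HO' U) as [w' _].
  destruct (pb_lift KP (a := w' ∘ t') (b := a)) as [b [B1 B2]].
  { rewrite Ho', comp_assoc. f_equal. apply (initial_eq HO'). }
  assert (Nb : is_null (p1 ∘ b)) by (rewrite B1; now exists O', w', t').
  destruct (kernel_lift HK1 (a := qE ∘ b)) as [x Hx].
  { rw E1. now apply null_l. }
  destruct (kernel_lift HK2 (a := qE ∘ b)) as [y Hy].
  { rw E2. rewrite B2. exact (proj1 (reflection_vanishes RU a) Va). }
  destruct (pb_lift HP (a := x) (b := y)) as [h [H1 H2]]; [congruence|].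
  exists h. rewrite <- B2. ra. f_equal. apply (pb_ext P).
  + apply null_eq; [|exact Nb]. rewrite comp_assoc, S1. apply Nw.
  + rw S2. rewrite <- Hl. ra. now rewrite H1.
Qed.

Lemma galois_ex {U X : PXMod B} (u : U ~> X) : exists G, is_galois_group u G.
Proof.
destruct (ep_pullback u u) as [E [p1 [p2 KP]]].
destruct (reflection_ex E) as [GE [qE [RE _]]].
destruct (reflection_ex U) as [GU [qU [RU _]]].
destruct (reflection_lift RE (qU ∘ p1) (proj1 RU)) as [G1 E1].
destruct (reflection_lift RE (qU ∘ p2) (proj1 RU)) as [G2 E2].
destruct (kernel_ex G1) as [K1 [k1 H1]]. destruct (kernel_ex G2) as [K2 [k2 H2]].
destruct (ep_pullback k1 k2) as [G [a [b HP]]].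
exists G. exists E, GE, GU, p1, p2, qE, qU, G1, G2, K1, K2, k1, k2, (k1 ∘ a).
repeat (split; [eassumption|]). now exists a, b.
Qed.

(** An element [(t1 d, t2 d)] of the kernel pair of [v] is determined by its
    first component and its image in the reflection of the kernel pair.  Both
    are the same for [(t1 d, t1 d)], the images being null. *)
Lemma central_vanishing_eq {U V X D : PXMod B} {v : V ~> X} (t1 t2 : U ~> V) (d : D ~> U) :
  is_central_extension v -> v ∘ t1 = v ∘ t2 -> vanishes d -> t1 ∘ d = t2 ∘ d.
Proof.
intros Hv E Hd.
destruct (ep_pullback v v) as [R [p1 [p2 KP]]].
pose proof (central_kernel_pair Hv KP) as [_ [GR [GV [qR [qV [Gp [RR [RV P]]]]]]]].
destruct (kp_diag KP) as [D0 [D1 D2]].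
destruct (pb_lift KP E) as [h [H1 H2]].
assert (Eh : h ∘ d = D0 ∘ (t1 ∘ d)).
{ apply (pb_ext P).
  - rw H1. now rw D1.
  - apply null_eq.
    + pose proof (Hd GR (qR ∘ h) (proj1 RR)) as A. now rewrite <- comp_assoc in A.
    + pose proof (Hd GR (qR ∘ (D0 ∘ t1)) (proj1 RR)) as A. now rewrite <- !comp_assoc in A. }
rewrite <- H2. ra. rewrite Eh. now rw D2.
Qed.

Lemma vanishes_post {V X Y : PXMod B} (g : X ~> Y) (a : V ~> X) :
  vanishes a -> vanishes (g ∘ a).
Proof. intros H Z f HZ. rewrite comp_assoc. now apply H. Qed.

(** Weak universality gives morphisms over [X] in both directions.  Their
    composites need not be identities, but they are on vanishing elements by
    [central_vanishing_eq]. *)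
Lemma weakly_universal_vanishing_kernel {U V X D D' : PXMod B} {u : U ~> X} {v : V ~> X} {d : D ~> U}
  {d' : D' ~> V} :
  is_weakly_universal_central u -> is_weakly_universal_central v ->
  is_vanishing_kernel u d -> is_vanishing_kernel v d' -> isomorphic D D'.
Proof.
intros [Cu Wu] [Cv Wv] [A1 [A2 [A3 A4]]] [B1 [B2 [B3 B4]]].
destruct (Wu V v Cv) as [t Ht]. destruct (Wv U u Cu) as [t' Ht'].
destruct (B4 D (t ∘ d)) as [h Hh].
{ now rw Ht. } { now apply vanishes_post. }
destruct (A4 D' (t' ∘ d')) as [h' Hh'].
{ now rw Ht'. } { now apply vanishes_post. }
exists h, h'. split.
- apply A3. rw Hh'. rewrite Hh.
  pose proof (central_vanishing_eq (t1 := t' ∘ t) (t2 := idm U) (d := d) Cu) as E.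
  rewrite comp_idl, <- comp_assoc in E. apply E; [|exact A2].
  ra. rewrite comp_assoc. now rewrite Ht'.
- apply B3. rw Hh. rewrite Hh'.
  pose proof (central_vanishing_eq (t1 := t ∘ t') (t2 := idm V) (d := d') Cv) as E.
  rewrite comp_idl, <- comp_assoc in E. apply E; [|exact B2].
  ra. rewrite comp_assoc. now rewrite Ht.
Qed.

(** * The Hopf formula *)

(** The kernel of the induced extension is the image of [k], and [q] kills the
    commutator of [P] and [k], so the required cooperation descends along [q]. *)
Lemma hopf_central {X P Pbar K N : PXMod B} {p : P ~> X} {k : K ~> P} {n : N ~> P}
  {q : P ~> Pbar} :
  is_regular_epi p -> is_kernel p k -> is_peiffer_commutator (idm P) k n ->
  is_regular_epi q -> is_kernel q n ->
  exists ubar : Pbar ~> X, ubar ∘ q = p /\ is_central_extension ubar.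
Proof.
intros Hp Hk Hn Hq Hqn.
assert (Np : is_null (p ∘ n)).
{ apply (peiffer_null Hn). pose proof (kernel_null Hk).
  split; [now apply coop_null_r|now apply coop_null_l]. }
destruct (normal_epi (g := p) Hq Hqn Np) as [ubar Hubar].
exists ubar. split; [exact Hubar|].
destruct (kernel_ex ubar) as [Kb [kb Hkb]].
destruct (kernel_lift Hkb (a := q ∘ k)) as [r Hr].
{ rw Hubar. exact (kernel_null Hk). }
assert (Rr : is_regular_epi r).
{ apply (ep_stable (f := q) (g := kb) (p := k)); [|exact Hq]. apply mk_pb.
  - now symmetry.
  - intros W a b E1 _. exact (kernel_mono Hk E1).
  - intros W a b Eab. destruct (kernel_lift Hk (a := a)) as [h Hh].
    { rewrite <- Hubar. ra. rewrite Eab, comp_assoc. apply null_r, (kernel_null Hkb). }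
    exists h. split; [exact Hh|]. apply (kernel_mono Hkb). rw Hr. now rewrite Hh. }
destruct (proj1 (peiffer_null Hn q) (kernel_null Hqn)) as [Q1 Q2].
rewrite comp_idr in Q1. rewrite comp_idr in Q2.
apply (cooperate_central (k := kb)).
- rewrite <- Hubar in Hp. exact (reg_cancel Hp).
- exact Hkb.
- apply (coop_reg (x := q) (y := r)); auto. now rewrite comp_idl, Hr.
- apply (coop_reg (x := r) (y := q)); auto. now rewrite comp_idl, Hr.
Qed.

(** A lifting [t] of [p] through a central extension [c] maps [k] into the kernel
    of [c].  So it kills the commutator [n] and factors through [q]. *)
Lemma hopf_weakly_universal {X P Pbar K N : PXMod B} {p : P ~> X} {k : K ~> P} {n : N ~> P}
  {q : P ~> Pbar} {ubar : Pbar ~> X} :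
  is_projective P -> is_kernel p k -> is_peiffer_commutator (idm P) k n ->
  is_regular_epi q -> is_kernel q n -> ubar ∘ q = p -> is_central_extension ubar ->
  is_weakly_universal_central ubar.
Proof.
intros HP Hk Hn Hq Hqn Hubar Hc. split; [exact Hc|].
intros Z c HZ. destruct (HP _ _ c p (proj1 HZ)) as [t Ht].
destruct (kernel_ex c) as [Kc [kc Hkc]].
destruct (central_cooperate HZ Hkc) as [A1 A2].
destruct (kernel_lift Hkc (a := t ∘ k)) as [s Hs].
{ rw Ht. exact (kernel_null Hk). }
destruct (normal_epi (g := t) Hq Hqn) as [tb Htb].
{ apply (peiffer_null Hn). rewrite <- Hs, comp_idr. split.
  - pose proof (coop_pre t s A1) as E. now rewrite comp_idl in E.
  - pose proof (coop_pre s t A2) as E. now rewrite comp_idl in E. }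
exists tb. apply (reg_epi Hq). ra. now rewrite Htb, Ht.
Qed.

(** The intersection [m] is the inverse image along [q] of [d], since a
    morphism from [P] to a crossed module kills [n] and factors through [q].  So
    [m] covers [d], and the kernel of this cover is the kernel [n] of [q]. *)
Lemma vanishing_kernel_cokernel {X P Pbar K PP N M D : PXMod B} {p : P ~> X} {k : K ~> P}
  {pp : PP ~> P} {n : N ~> P} {m : M ~> P} {i : N ~> M} {q : P ~> Pbar} {ubar : Pbar ~> X}
  {d : D ~> Pbar} :
  is_kernel p k -> is_peiffer_commutator (idm P) (idm P) pp ->
  is_intersection k pp m -> m ∘ i = n ->
  is_regular_epi q -> is_kernel q n -> ubar ∘ q = p -> is_vanishing_kernel ubar d ->
  exists r : M ~> D, is_cokernel i r.
Proof.
intros Hk Hpp [a [b [HI Hm]]] Hi Hq Hqn Hubar [D1 [D2 [D3 D4]]].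
destruct (peiffer_normal Hpp) as [Z0 [g0 [_ Hg0]]].
assert (Mm : is_mono m).
{ rewrite <- Hm. apply mono_comp; [exact (kernel_mono Hk)|].
  exact (pb_mono (pb_sym HI) (kernel_mono Hg0)). }
assert (Vm : vanishes m).
{ apply (peiffer_vanishes m Hpp). exists b. rewrite <- Hm. symmetry. apply HI. }
destruct (D4 M (q ∘ m)) as [r Hr].
{ rw Hubar. rewrite <- Hm, comp_assoc. apply null_r, (kernel_null Hk). }
{ now apply vanishes_post. }
assert (Rr : is_regular_epi r).
{ apply (ep_stable (f := q) (g := d) (p := m)); [|exact Hq]. apply mk_pb.
  - now symmetry.
  - intros W x y E1 _. exact (Mm _ _ _ E1).
  - intros W x y Exy. destruct (kernel_lift Hk (a := x)) as [x1 Hx1].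
    { rewrite <- Hubar. ra. rewrite Exy, comp_assoc. now apply null_r. }
    destruct (proj1 (peiffer_vanishes x Hpp)) as [x2 Hx2].
    { intros Z f HZ. destruct (normal_epi (g := f) Hq Hqn) as [f' <-].
      - rewrite <- Hi, comp_assoc. now apply null_r, Vm.
      - ra. rewrite Exy, comp_assoc. now apply null_r, D2. }
    destruct (pb_lift HI (a := x1) (b := x2)) as [h [H1 H2]]; [congruence|].
    assert (Hh : m ∘ h = x) by (rewrite <- Hm; ra; now rewrite H1).
    exists h. split; [exact Hh|]. apply D3. rw Hr. now rewrite Hh. }
exists r. apply kernel_cokernel; [exact Rr|]. apply mk_kernel.
- apply (null_mono (m := d) D3). rw Hr. rewrite Hi. exact (kernel_null Hqn).
- intros W x y E. apply (kernel_mono Hqn). rewrite <- Hi. ra. now rewrite E.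
- intros W x Hx. destruct (kernel_lift Hqn (a := m ∘ x)) as [h Hh].
  { rw <- Hr. now apply null_l. }
  exists h. apply Mm. now rw Hi.
Qed.

(** The commutator [n] is contained in [k] because [p] is null on [k], and in [pp]
    because it vanishes in crossed modules. *)
Lemma hopf_quotient_ex {X P : PXMod B} (p : P ~> X) : exists Q, is_hopf_quotient p Q.
Proof.
destruct (kernel_ex p) as [K [k Hk]].
destruct (peiffer_ex (@id_mono _ P) (@id_mono _ P)) as [PP [pp Hpp]].
destruct (peiffer_ex (@id_mono _ P) (kernel_mono Hk)) as [N [n Hn]].
destruct (ep_pullback k pp) as [M [a [b HM]]].
destruct (kernel_lift Hk (a := n)) as [x Hx].
{ apply (peiffer_null Hn). pose proof (kernel_null Hk).
  split; [now apply coop_null_r|now apply coop_null_l]. }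
destruct (peiffer_normal Hpp) as [Z [g [Hg Hgk]]].
destruct (proj1 (peiffer_vanishes n Hpp)) as [y Hy].
{ intros Y f HY. apply (peiffer_null Hn).
  pose proof (crossed_hom_cooperate f HY) as E. split.
  - exact (coop_pre (idm P) k E).
  - exact (coop_pre k (idm P) E). }
destruct (pb_lift HM (a := x) (b := y)) as [i [I1 I2]]; [congruence|].
destruct (kernel_null Hk) as [O [o [t [HO E]]]].
destruct (px_pushout_ex i (t ∘ x)) as [Q [q [oq HQ]]].
exists Q, K, PP, N, M, k, pp, n, (k ∘ a), i, q.
split; [exact Hk|split; [exact Hpp|split; [exact Hn|split; [now exists a, b|split]]]].
- ra. now rewrite I1.
- now exists O, (t ∘ x), oq.
Qed.

End Galois.

(* Both sides are determined up to isomorphism: they exist, and any choice of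
   the one is isomorphic to any choice of the other. *)
Theorem mainTheorem4 (C : SemiAbelian) (hUA : UA C) (B : C)
    (hproj : enough_projectives (PXMod B))
    (X P : PXMod B) (p : P ~> X)
    (hP : is_projective P) (hp : is_regular_epi p) :
  (exists pi1 : PXMod B, is_fundamental_group X pi1) /\
  (exists Q : PXMod B, is_hopf_quotient p Q) /\
  (forall pi1 Q : PXMod B, is_fundamental_group X pi1 -> is_hopf_quotient p Q ->
     isomorphic pi1 Q).
Proof.
split; [|split].
- destruct (kernel_ex p) as [K [k Hk]].
  destruct (peiffer_ex (@id_mono _ P) (kernel_mono Hk)) as [N [n Hn]].
  destruct (peiffer_normal Hn) as [Pbar [q [Hq Hqn]]].
  destruct (hopf_central hUA hp Hk Hn Hq Hqn) as [ubar [Hubar Hc]].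
  destruct (galois_ex hUA ubar) as [G HG].
  exists G, Pbar, ubar. split; [|exact HG].
  exact (hopf_weakly_universal hUA hP Hk Hn Hq Hqn Hubar Hc).
- exact (hopf_quotient_ex hUA p).
- intros G Q [U [u [Wu Hu]]] [K [PP [N [M [k [pp [n [m [i [c [Hk [Hpp [Hn [HI [Hi Hc]]]]]]]]]]]]]]].
  destruct (peiffer_normal Hn) as [Pbar [q [Hq Hqn]]].
  destruct (hopf_central hUA hp Hk Hn Hq Hqn) as [ubar [Hubar Cubar]].
  pose proof (hopf_weakly_universal hUA hP Hk Hn Hq Hqn Hubar Cubar) as Wubar.
  destruct (galois_ex hUA ubar) as [D HD].
  destruct (galois_vanishing_kernel hUA Cubar HD) as [d Hd].
  destruct (galois_vanishing_kernel hUA (proj1 Wu) Hu) as [d' Hd'].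
  destruct (vanishing_kernel_cokernel hUA Hk Hpp HI Hi Hq Hqn Hubar Hd) as [r Hr].
  destruct (weakly_universal_vanishing_kernel hUA Wu Wubar Hd' Hd) as [x Hx].
  destruct (cokernel_unique Hr Hc) as [y Hy].
  exists (y ∘ x). now apply iso_comp.
Qed.
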